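(* Let $d\ge3$, let $H$ be a simple graph with maximum degree at most $d-1$, and let $G$ be the subdivision of $H$ obtained by inserting one new node on each edge. Then $t(G,d)$ is finite.
   Context: Graphs are finite and simple. $G=(V,E)$ is $d$-sparse if it has no subgraph isomorphic to $K_{a,b}$ with $a,b\ge1$, $a+b>d$ (such a subdivision is $d$-sparse). $S^{d-1}$ is the unit sphere of $\mathbb{R}^d$, $A_k$ the surface area of $S^k\subset\mathbb{R}^{k+1}$, and $\mathrm{Det}(y_1,\dots,y_m)=\sqrt{\det((y_i^{\top}y_j)_{i,j})}$ ($=1$ for the empty family). For an ordering $p:V\to\{1,\dots,|V|\}$ let $N_p(v)=\{w:vw\in E,\ p(w)<p(v)\}$, $d_p(v)=|N_p(v)|$, $x_p(v)=(x_w:w\in N_p(v))$, and let $\rho_p$ be the distribution on $(S^{d-1})^V$ of the random sequential ortho-homomorphism (process nodes in increasing $p$, choosing $x_v$ uniformly on the sphere $\{y\in S^{d-1}:y\perp x_w\ \forall w\in N_p(v)\}$). The ortho-homomorphism density is $t(G,d)=\int\frac{A_{d-1}^{|E|-|V|}}{A_{d-2}^{|E|}}\prod_{v\in V}\frac{A_{d-d_p(v)-1}}{\mathrm{Det}(x_p(v))}\,d\rho_p(x)\in(0,\infty]$, which does not depend on $p$. *)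

(* Defs.v *)
From HB Require Import structures.
From mathcomp Require Import all_boot all_order all_algebra.
From mathcomp Require Import all_classical all_reals all_analysis.

Set Implicit Arguments.
Unset Strict Implicit.
Unset Printing Implicit Defensive.

Import Order.TTheory GRing.Theory Num.Theory.
Local Open Scope ring_scope.

Section Defs.
Variable R : realType.

(* A_k = surface area of S^k in R^(k+1):  A_0 = 2, A_1 = 2 pi,
   A_(k+2) = 2 pi / (k+1) * A_k   (i.e. A_k = 2 pi^((k+1)/2) / Gamma((k+1)/2)) *)
Fixpoint sphere_area (k : nat) : R :=
  match k with
  | 0 => 2
  | 1 => 2 * pi
  | k'.+2 => (2 * pi / k'.+1%:R) * sphere_area k'
  end.

Definition simple_graph (W : finType) (e : rel W) : Prop :=
  symmetric e /\ irreflexive e.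

Definition nedges (W : finType) (e : rel W) : nat :=
  #|[set uv : {set W} | [exists x, exists y, e x y && (uv == [set x; y])]]|.

Definition is_edge_set (V : finType) (e : rel V) (s : {set V}) : bool :=
  [exists x, exists y, e x y && (s == [set x; y])].

Definition edge_type (V : finType) (e : rel V) := {s : {set V} | is_edge_set e s}.

Definition subdiv_vertex (V : finType) (e : rel V) : finType :=
  (V + edge_type e)%type.

Definition subdiv_rel (V : finType) (e : rel V) : rel (subdiv_vertex e) :=
  fun a b =>
    match a, b with
    | inl v, inr s => v \in val s
    | inr s, inl v => v \in val s
    | _, _ => false
    end.

Section Ordering.
Variables (W : finType) (e : rel W) (d : nat) (p : W -> 'I_#|W|).

Definition Np (v : W) : {set W} := [set w | e v w & (p w < p v)%N].
Definition dp (v : W) : nat := #|Np v|.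

Definition xp_mx (x : W -> 'rV[R]_d) (v : W) : 'M[R]_(dp v, d) :=
  \matrix_(i < dp v) x (enum_val i).

(* Det(y_1,...,y_m) = sqrt(det Gram) ; = 1 for the empty family *)
Definition Det m (Y : 'M[R]_(m, d)) : R := Num.sqrt (\det (Y *m Y^T)).

Definition enorm (y : 'rV[R]_d) : R := Num.sqrt (\sum_j y ord0 j ^+ 2).
Definition normalize (y : 'rV[R]_d) : 'rV[R]_d :=
  if enorm y == 0 then 0 else (enorm y)^-1 *: y.

(* orthogonal projection onto the orthogonal complement of the row space of Y *)
Definition orth_proj m (Y : 'M[R]_(m, d)) : 'M[R]_d :=
  proj_mx (kermx Y^T) <<Y>>%MS.

(* One step of the random sequential ortho-homomorphism: a uniform point of
   the unit sphere of {y : y _|_ x_w, w in N_p(v)} is obtained by projecting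
   a standard Gaussian vector gv onto that subspace and normalising. *)
Definition rso_step (x : W -> 'rV[R]_d) (g : W * 'I_d -> R) (v : W) : 'rV[R]_d :=
  normalize ((\row_j g (v, j)) *m orth_proj (xp_mx x v)).

Fixpoint rso_proc (k : nat) (g : W * 'I_d -> R) : W -> 'rV[R]_d :=
  match k with
  | 0 => fun _ => 0
  | k'.+1 => fun v => if (p v : nat) == k' then rso_step (rso_proc k' g) g v
                      else rso_proc k' g v
  end.

Definition rso (g : W * 'I_d -> R) : W -> 'rV[R]_d := rso_proc #|W| g.

Local Open Scope ereal_scope.

Definition einv (r : R) : \bar R := if r == 0%R then +oo else (r^-1)%:E.

Definition t_integrand (x : W -> 'rV[R]_d) : \bar R :=
  ((sphere_area d.-1 ^ ((nedges e)%:Z - (#|W|)%:Z)%R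
    / sphere_area d.-2 ^+ nedges e)%R)%:E *
  \prod_(v : W) ((sphere_area (d - dp v).-1)%:E * einv (Det (xp_mx x v))).

Fixpoint gauss_iint (s : seq (W * 'I_d)) (f : (W * 'I_d -> R) -> \bar R)
    (g : W * 'I_d -> R) : \bar R :=
  match s with
  | [::] => f g
  | i :: s' => \int[lebesgue_measure]_(z in [set: R])
       ((normal_pdf 0 1 z)%:E *
        gauss_iint s' f (fun j => if j == i then z else g j))
  end.

(* t(G,d), computed with the ordering p, as an integral against rho_p
   (rho_p = pushforward of the standard Gaussian on (R^d)^W by rso) *)
Definition tdens : \bar R :=
  gauss_iint (enum [set: (W * 'I_d)%type]) (fun g => t_integrand (rso g))
    (fun _ => 0%R).

End Ordering.
End Defs.

(* Main.v *)
(* Write |u /\ v| for the norm of the 2-minors of (u, v).  In the sequential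
   process, replace each projection onto a hyperplane u^perp by an invertible map
   that tends to it as eps -> 0.  A change of variables, one vertex at a time,
   turns the resulting weighted Gaussian process into independent Gaussian vectors
   with the density prod_(uv edge) eps^-1 exp (- <x_u, x_v>^2 / (2 eps^2)).  By
   Fatou's lemma it is enough to bound these integrals uniformly in eps.

   For the subdivision of H, integrating out the midpoint of an edge uv leaves a
   factor O (1 / (|x_u /\ x_v| + eps^2)), which is at most
   kappa_uv / (|x_u| |x_v|) with kappa_uv = 1 + |x_u| |x_v| / (|x_u /\ x_v| + eps^2).
   Each vertex of H has degree at most d - 1, so it collects at most |x_v|^-(d-1),
   and the product of the kappa's is at most exp ((d/2) S), where S is the sum of
   ln kappa_uv / (deg u + 1) over the oriented edges uv.  Averaging over the
   removed vertex shows that some vertex v of H can be deleted at the cost of a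
   single factor kappa_vu^(d/2).  That factor times |x_v|^-(d-1) exp (- |x_v|^2 / 4)
   is integrable in x_v uniformly in x_u, because kappa_vu is singular along a line,
   of codimension d - 1 > d/2; here d >= 3 is used.  Induction on the number of
   vertices concludes. *)

Require Import Defs.
From HB Require Import structures.
From mathcomp Require Import all_boot all_order all_algebra.
From mathcomp Require Import all_classical all_reals all_analysis.
From mathcomp Require Import measurable_realfun ring lra.
Import Order.TTheory GRing.Theory Num.Theory.
Import numFieldNormedType.Exports.
Set Implicit Arguments.
Unset Strict Implicit.
Unset Printing Implicit Defensive.
Local Open Scope classical_set_scope.
Local Open Scope ring_scope.
Local Open Scope ereal_scope.

(** * Iterated Lebesgue integrals over finitely many coordinates *)

(** The exact process has a law that is singular with respect to Lebesgue measure. The map [Bmx e u]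
    has determinant [e / qn e u], so the change of variables costs [qn e u / e], and the regularised
    Gram determinant in the denominator cancels [qn e u]. What remains is 1/e per edge, independent
    of the configuration. This is why the weights 1/Det of t(G,d) lead to a symmetric product over
    the edges, in which the ordering no longer appears. The points of the process are normalised
    while the Gaussian vectors are not. The norms lost are bounded by powers of 1 + |x|^2, which
    half of the Gaussian exponent absorbs; the other half serves for the integration. The vertices
    of H cannot be integrated out at face value. If the d - 1 neighbours of v lie on one line, the
    product of the factors 1 / |x_u /\ x_v| has exponent d - 1 along a line of codimension d - 1,
    and this just fails to be integrable. The averaging lowers the exponent to d/2. *)

Section Update.
Variables (I : eqType) (A : Type).
Implicit Types (g : I -> A) (y z : A).

Definition upd g i z : I -> A := fun j => if j == i then z else g j.

Lemma upd_upd g i y z : upd (upd g i y) i z = upd g i z.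
Proof. by apply/funext => k; rewrite /upd; case: eqP. Qed.

Lemma upd_eq g i z : upd g i z i = z.
Proof. by rewrite /upd eqxx. Qed.

Lemma upd_swap g i j y z : i != j -> upd (upd g i y) j z = upd (upd g j z) i y.
Proof.
move=> ij; apply/funext => k; rewrite /upd.
by case: (eqVneq k j) => // ->; rewrite eq_sym (negbTE ij).
Qed.

End Update.

Section IteratedIntegral.
Variables (R : realType) (I : eqType).
Implicit Types (f : (I -> R) -> \bar R) (g : I -> R) (s t : seq I).
Local Notation mu := (@lebesgue_measure R).

(* Measurability along every measurable family of coordinates: this is preserved
   by partial integration and avoids a product sigma-algebra on [I -> R]. *)
Definition coord_measurable f := forall d (T : measurableType d) (h : I -> T -> R),
  (forall i, measurable_fun [set: T] (h i)) ->
  measurable_fun [set: T] (fun x => f (fun i => h i x)).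

Fixpoint lint s f g : \bar R :=
  match s with
  | [::] => f g
  | i :: s' => \int[mu]_z lint s' f (upd g i z)
  end.

Lemma measurable_upd d (T : measurableType d) (h : I -> T -> R) (i : I) (z : T -> R) :
  (forall i, measurable_fun [set: T] (h i)) -> measurable_fun [set: T] z ->
  forall j, measurable_fun [set: T] (fun x => upd (fun i => h i x) i (z x) j).
Proof. by move=> mh mz j; rewrite /upd; case: eqP. Qed.

Lemma coord_measurable_section f g i :
  coord_measurable f -> measurable_fun [set: R] (fun z => f (upd g i z)).
Proof.
move=> mf; apply: (mf _ _ (fun j (z : R) => upd g i z j)) => j.
by rewrite /upd; case: eqP => // _; exact: measurable_id.
Qed.

Lemma lint_ge0 s f g : (forall g, 0 <= f g) -> 0 <= lint s f g.
Proof.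
by move=> f0; elim: s g => //= i s IH g; apply: integral_ge0 => z _; exact: IH.
Qed.

Lemma coord_measurable_lint s f :
  (forall g, 0 <= f g) -> coord_measurable f -> coord_measurable (lint s f).
Proof.
move=> f0 mf; elim: s => //= i s IH d T h mh.
pose F (xz : T * measurableTypeR R) := lint s f (upd (fun i => h i xz.1) i xz.2).
apply: (@measurable_fun_fubini_tonelli_F _ _ T (measurableTypeR R) R mu F).
  2: by move=> x; exact: lint_ge0.
apply: (IH _ _ (fun j (xz : T * R) => upd (fun i => h i xz.1) i xz.2 j)) => j.
apply: measurable_upd => // k.
exact: measurableT_comp (mh k) measurable_fst.
Qed.

Lemma le_lint s f1 f2 g : (forall g, 0 <= f1 g) ->
  coord_measurable f1 -> coord_measurable f2 -> (forall g, f1 g <= f2 g) ->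
  lint s f1 g <= lint s f2 g.
Proof.
move=> f0 m1 m2 le12.
have f20 g' : 0 <= f2 g' by apply: le_trans (le12 _).
elim: s g => //= i s IH g; apply: ge0_le_integral => //.
- by move=> z _; exact: lint_ge0.
- by apply: coord_measurable_section; apply: coord_measurable_lint.
- by apply: coord_measurable_section; apply: coord_measurable_lint.
Qed.

Lemma eq_lint s f1 f2 g : f1 =1 f2 -> lint s f1 g = lint s f2 g.
Proof. by move=> /funext ->. Qed.

Lemma lint_cat s t f g : lint (s ++ t) f g = lint s (lint t f) g.
Proof.
elim: s g => //= i s IH g; apply: eq_integral => z _; exact: IH.
Qed.

Lemma lint_swap i j s f g : (forall g, 0 <= f g) -> coord_measurable f ->
  i != j -> lint (i :: j :: s) f g = lint (j :: i :: s) f g.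
Proof.
move=> f0 mf ij /=.
pose F (yz : measurableTypeR R * measurableTypeR R) :=
  lint s f (upd (upd g i yz.1) j yz.2).
rewrite (@fubini_tonelli _ _ (measurableTypeR R) (measurableTypeR R) R mu mu F).
- apply: eq_integral => z _; apply: eq_integral => y _.
  by rewrite /F /= upd_swap.
- apply: (coord_measurable_lint s f0 mf
    (h := fun k (yz : measurableTypeR R * measurableTypeR R) =>
      upd (upd g i yz.1) j yz.2 k)) => k.
  apply: (measurable_upd (h := fun k (yz : measurableTypeR R * measurableTypeR R) =>
      upd g i yz.1 k)) => [l|]; last exact: measurable_snd.
  by rewrite /upd; case: eqP => // _; exact: measurable_fst.
- by move=> x; exact: lint_ge0.
Qed.

Lemma lint_move i s t f g : (forall g, 0 <= f g) -> coord_measurable f ->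
  i \notin s -> lint (i :: s ++ t) f g = lint (s ++ i :: t) f g.
Proof.
move=> f0 mf; elim: s g => // j s IH g.
rewrite inE negb_or => /andP[ij iNs].
rewrite cat_cons lint_swap //= ; apply: eq_integral => z _.
exact: IH.
Qed.

Lemma lint_perm s t f g : (forall g, 0 <= f g) -> coord_measurable f ->
  uniq s -> perm_eq s t -> lint s f g = lint t f g.
Proof.
move=> f0 mf; elim: s t g => [|i s IH] t g us pst.
  by move: pst; rewrite perm_sym => /perm_nilP ->.
have it : i \in t by rewrite -(perm_mem pst) mem_head.
have ut : uniq t by rewrite -(perm_uniq pst).
case/splitPr: it pst ut => t1 t2 pst; rewrite cat_uniq /= => /and3P[_].
rewrite negb_or => /andP[iNt1 _] _.
rewrite -lint_move //=; apply: eq_integral => z _; apply: IH.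
  by case/andP: us.
by move: pst; rewrite perm_sym -[i :: t2]cat1s perm_catCA cat1s perm_cons perm_sym.
Qed.

Lemma lint_eq_const s f g c :
  (forall g', (forall i, i \notin s -> g' i = g i) -> f g' = c g') ->
  lint s f g = lint s c g.
Proof.
elim: s g => [|i s IH] g fc; first exact: fc.
apply: eq_integral => z _; apply: IH => g' g'g; apply: fc => j.
rewrite inE negb_or => /andP[ji js].
by rewrite g'g // /upd (negbTE ji).
Qed.

Lemma lintZl s f g (c : \bar R) : 0 <= c -> (forall g, 0 <= f g) ->
  coord_measurable f -> lint s (fun g => c * f g) g = c * lint s f g.
Proof.
move=> c0 f0 mf; elim: s g => //= i s IH g.
under eq_integral do rewrite IH.
rewrite ge0_integralZl //.
- by apply: coord_measurable_section; apply: coord_measurable_lint.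
- by move=> z _; exact: lint_ge0.
Qed.

Lemma lint_factor s f g (G : (I -> R) -> \bar R) : (forall g, 0 <= G g) ->
  (forall g i z, i \in s -> G (upd g i z) = G g) -> (forall g, 0 <= f g) ->
  coord_measurable f -> lint s (fun g => G g * f g) g = G g * lint s f g.
Proof.
move=> G0 Gs f0 mf; rewrite -lintZl //.
suff H g' : (forall i, i \notin s -> g' i = g i) -> G g' = G g.
  by apply: lint_eq_const => g' /H ->.
elim: s g' Gs => [|i s IH] g' Gs g'g.
  by congr G; apply/funext => i; rewrite g'g.
(* Reset coordinate [i] of [g'] to its value in [g], which [G] does not see; the other coordinates
   follow by induction. *)
rewrite -(Gs g' i (g i)) ?mem_head //.
apply: IH => [h j z js|j js]; first by apply: Gs; rewrite inE js orbT.
by rewrite /upd; case: eqP => [->//|/eqP ji]; apply: g'g; rewrite inE negb_or ji.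
Qed.

Lemma lint_fatou s (F : nat -> (I -> R) -> \bar R) g :
  (forall n g, 0 <= F n g) -> (forall n, coord_measurable (F n)) ->
  lint s (fun g => limn_einf (F^~ g)) g <= limn_einf (fun n => lint s (F n) g).
Proof.
move=> F0 mF.
have L0 (u : (\bar R)^nat) : (forall n, 0 <= u n) -> 0 <= limn_einf u.
  move=> u0; rewrite limn_einf_lim; apply: lime_ge.
    exact: is_cvg_einfs.
  by apply: nearW => n; apply: le_ereal_inf_tmp => _ [m _ <-].
have mL (G : nat -> (I -> R) -> \bar R) : (forall n, coord_measurable (G n)) ->
    coord_measurable (fun g => limn_einf (G^~ g)).
  move=> mG d T h mh.
  under eq_fun do rewrite limn_einf_lim.
  apply: (emeasurable_fun_cvg (fun n x => einfs (fun n => G n (fun i => h i x)) n)).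
  - by move=> n; apply: measurable_fun_einfs => k; exact: mG.
  - by move=> x _; exact: is_cvg_einfs.
elim: s g => //= i s IH g.
apply: le_trans (@fatou _ _ _ mu _ measurableT
  (fun n z => lint s (F n) (upd g i z)) _ _).
- apply: ge0_le_integral => //.
  + by move=> z _; apply: lint_ge0 => g'; exact: L0.
  + apply: coord_measurable_section; apply: coord_measurable_lint; last exact: mL.
    by move=> g'; exact: L0.
  + apply: (coord_measurable_section (f := fun g => limn_einf (fun n => lint s (F n) g))).
    by apply: mL => n; exact: coord_measurable_lint.
- by move=> n; by apply: coord_measurable_section; apply: coord_measurable_lint.
- by move=> n z _; exact: lint_ge0.
Qed.

End IteratedIntegral.

(** * Linear changes of variables, from affine maps of one coordinate up to rank-one perturbations
    of the identity *)

Section AffineSubstitution.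
Variable R : realType.
Local Notation mu := (@lebesgue_measure R).

Lemma measurable_affine (a b : R) :
  measurable_fun setT ((fun z => a * z + b)%R : measurableTypeR R -> measurableTypeR R).
Proof. by apply: measurable_funD => //; exact: mulrl_measurable. Qed.

Lemma ge0_integral_affine (a b : R) (f : R -> \bar R) : a != 0%R ->
  measurable_fun setT f -> (forall z, 0 <= f z) ->
  \int[mu]_z f (a * z + b)%R = (`|a|^-1)%:E * \int[mu]_z f z.
Proof.
move=> a0 mf f0.
have na0 : (0 < `|a|)%R by rewrite normr_gt0.
pose phi : measurableTypeR R -> measurableTypeR R := (fun z => a * z + b)%R.
have mphi : measurable_fun setT phi := measurable_affine a b.
pose Phi : {mfun measurableTypeR R >-> measurableTypeR R} :=
  HB.pack phi (isMeasurableFun.Build _ _ _ _ _ mphi).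
pose k : {nonneg R} := NngNum (ltW na0).
pose pf : {measure set (measurableTypeR R) -> \bar R} :=
  measure_function_pushforward__canonical__measure_function_Measure mu mphi.
pose nu : {measure set (measurableTypeR R) -> \bar R} := mscale k pf.
(* |a| times the image of Lebesgue measure gives every half-open interval its length, so it is
   Lebesgue measure. For a < 0 the preimage is closed on the left instead of the right, with the
   same length. *)
have nuE A : measurable A -> mu A = nu A.
  move=> mA; apply: lebesgue_measure_unique => // X [[u v]] /= _ <-.
  rewrite /nu /= /mscale /= /pushforward.
  have [a_gt0|a_lt0|a00] := ltgtP a 0%R.
  - have -> : Phi @^-1` `]u, v] = `[((v - b) / a)%R, ((u - b) / a)%R[%classic.
      apply/seteqP; split => x /=; rewrite /Phi /phi /= !in_itv /=;
        rewrite ler_ndivrMr // ltr_ndivlMr // lerBrDr ltrBlDr (mulrC x);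
        by move=> /andP[-> ->].
    rewrite !lebesgue_measure_itv /= !lte_fin ltr_ndivlMr // divfK // ltrD2r.
    case: ifP => uv; last by rewrite mule0.
    rewrite -EFinM; congr (_%:E); rewrite ltr0_norm //.
    by field.
  - have -> : Phi @^-1` `]u, v] = `]((u - b) / a)%R, ((v - b) / a)%R]%classic.
      apply/seteqP; split => x /=; rewrite /Phi /phi /= !in_itv /=;
        rewrite ler_pdivlMr // ltr_pdivrMr // lerBrDr ltrBlDr (mulrC x);
        by move=> /andP[-> ->].
    rewrite !lebesgue_measure_itv /= !lte_fin ltr_pdivrMr // divfK // ltrD2r.
    case: ifP => uv; last by rewrite mule0.
    rewrite -EFinM; congr (_%:E); rewrite gtr0_norm //.
    by field.
  - by rewrite a00 eqxx in a0.
have -> : \int[mu]_z f z = (`|a|)%:E * \int[pf]_z f z.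
  rewrite (@eq_measure_integral _ _ _ setT nu mu f) => [|A mA _]; last exact: nuE.
  by rewrite /nu ge0_integral_mscale.
rewrite muleA -EFinM mulVf ?gt_eqF // mul1e.
rewrite ge0_integral_pushforward //.
Qed.

End AffineSubstitution.

Section ElementarySubstitution.
Variables (R : realType) (I : eqType).
Implicit Types (f : (I -> R) -> \bar R) (g : I -> R) (s : seq I).

Lemma lint_shear s i f g (a : R) (b : (I -> R) -> R) : uniq s -> i \in s ->
  a != 0%R -> (forall g, 0 <= f g) -> coord_measurable f ->
  coord_measurable (EFin \o b) -> (forall g z, b (upd g i z) = b g) ->
  lint s (fun g => f (upd g i (a * g i + b g)%R)) g = (`|a|^-1)%:E * lint s f g.
Proof.
move=> us si a0 f0 mf mb bi.
pose f' g := f (upd g i (a * g i + b g)%R).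
have mf' : coord_measurable f'.
  move=> d T h mh.
  apply: (mf _ _ (fun j x => upd (fun i => h i x) i (a * h i x + b (h^~ x))%R j)).
  apply: measurable_upd => //; apply: measurable_funD.
    exact: measurable_funM.
  by have /measurable_EFinP := mb _ _ _ mh.
(* With coordinate [i] integrated innermost, [b] is a constant of the inner integral. *)
have ps : perm_eq s (rcons (rem i s) i).
  by rewrite perm_sym perm_rcons perm_sym perm_to_rem.
rewrite (lint_perm _ _ mf' us ps) ?(lint_perm _ _ mf us ps) //; last by move=> ?; exact: f0.
rewrite -cats1 !lint_cat -lintZl //; last 2 first.
- by move=> g'; exact: lint_ge0.
- exact: coord_measurable_lint.
apply: eq_lint => g' /=.
rewrite -(@ge0_integral_affine _ a (b g')) //.
- by apply: eq_integral => z _; rewrite /f' bi upd_eq upd_upd.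
- exact: coord_measurable_section.
Qed.

End ElementarySubstitution.

Lemma measurable_bigop d (T : measurableType d) d' (T' : measurableType d') (J : Type)
    (op : T' -> T' -> T') (idx : T') (r : seq J) (P : pred J) (F : J -> T -> T') :
  (forall f g : T -> T', measurable_fun [set: T] f -> measurable_fun [set: T] g ->
    measurable_fun [set: T] (fun x => op (f x) (g x))) ->
  (forall j, P j -> measurable_fun [set: T] (F j)) ->
  measurable_fun [set: T] (fun x => \big[op/idx]_(j <- r | P j) F j x).
Proof.
move=> mop mF; elim: r => [|j r IH].
  by under eq_fun do rewrite big_nil; exact: measurable_cst.
under eq_fun do rewrite big_cons; case Pj: (P j) => //.
by apply: mop => //; exact: mF.
Qed.

Lemma measurable_sumP d (T : measurableType d) (R : realType) (J : Type) (r : seq J)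
    (P : pred J) (F : J -> T -> R) :
  (forall j, P j -> measurable_fun [set: T] (F j)) ->
  measurable_fun [set: T] (fun x => \sum_(j <- r | P j) F j x)%R.
Proof. by move=> mF; apply: measurable_bigop => // f g; exact: measurable_funD. Qed.

Lemma measurable_prodP d (T : measurableType d) (R : realType) (J : Type) (r : seq J)
    (P : pred J) (F : J -> T -> R) :
  (forall j, P j -> measurable_fun [set: T] (F j)) ->
  measurable_fun [set: T] (fun x => \prod_(j <- r | P j) F j x)%R.
Proof. by move=> mF; apply: measurable_bigop => // f g; exact: measurable_funM. Qed.

Section RankOneSubstitution.
Variables (R : realType) (I : finType).
Implicit Types (f : (I -> R) -> \bar R) (g u : I -> R) (s : seq I).

Lemma coord_measurable_comp f (M : (I -> R) -> I -> R) : coord_measurable f ->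
  (forall i, coord_measurable (fun g => (M g i)%:E)) ->
  coord_measurable (fun g => f (M g)).
Proof.
move=> mf mM d T h mh; apply: (mf _ _ (fun i x => M (h^~ x) i)) => i.
by have /measurable_EFinP := mM i _ _ _ mh.
Qed.

Lemma coord_measurableM (f1 f2 : (I -> R) -> \bar R) :
  coord_measurable f1 -> coord_measurable f2 -> coord_measurable (fun g => f1 g * f2 g).
Proof. by move=> m1 m2 d T h mh; apply: emeasurable_funM; [exact: m1|exact: m2]. Qed.

Lemma coord_measurable_upd i j (b : (I -> R) -> R) : coord_measurable (EFin \o b) ->
  coord_measurable (fun g => (upd g i (b g) j)%:E).
Proof.
move=> mb d T h mh; apply/measurable_EFinP; apply: measurable_upd => //.
by have /measurable_EFinP := mb _ _ _ mh.
Qed.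

Lemma lint_shears s j f g u (c : R) (t : seq I) : uniq s -> (forall i, i \in s) ->
  uniq t -> j \notin t -> (forall g, 0 <= f g) -> coord_measurable f ->
  lint s (fun g => f (fun k => if k \in t then g k - c * u k * g j else g k)%R) g
  = lint s f g.
Proof.
move=> us sT + + f0 mf; elim: t => // i t IH /= /andP[it ut].
rewrite inE negb_or => /andP[ji jt]; rewrite -IH //.
pose f' g := f (fun k => if k \in t then g k - c * u k * g j else g k)%R.
have mf' : coord_measurable f'.
  apply: coord_measurable_comp => // k d T h mh; apply/measurable_EFinP.
  by case: (k \in _) => //; apply: measurable_funB => //;
     apply: measurable_funM => //; apply: measurable_funM.
have f'0 h : 0 <= f' h by exact: f0.
have := @lint_shear _ _ s i f' g 1%R (fun g => - (c * u i * g j))%R us (sT i) (oner_neq0 _).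
rewrite normr1 invr1 mul1e => <- //.
- apply: eq_lint => g'; rewrite /f'; congr f; apply/funext => k.
  rewrite inE /upd (negbTE ji) mul1r; case: (eqVneq k i) => [->|//=].
  by rewrite (negbTE it).
- move=> d T h mh; apply/measurable_EFinP; apply: measurable_funN.
  exact: measurable_funM.
- by move=> g' z; rewrite /upd (negbTE ji).
Qed.

(** The map 1 - c u u^T has determinant 1 - c |u|^2. It is written as a product of maps that change
    one coordinate each, so that one-dimensional substitutions suffice. *)
Lemma lint_rank_one s f g u (c : R) : uniq s -> (forall i, i \in s) ->
  (1 - c * \sum_i u i ^+ 2 != 0)%R -> (forall g, 0 <= f g) -> coord_measurable f ->
  lint s (fun g => f (fun k => g k - c * (\sum_i g i * u i) * u k)%R) g
  = (`|1 - c * \sum_i u i ^+ 2|^-1)%:E * lint s f g.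
Proof.
move=> us sT la0 f0 mf.
case: (pickP (fun i => u i != 0%R)) => [j uj|u0]; last first.
  have {}u0 i : u i = 0%R by apply/eqP; have := u0 i; case: eqP.
  rewrite big1 => [|i _]; last by rewrite u0 expr0n.
  rewrite mulr0 subr0 normr1 invr1 mul1e; apply: eq_lint => g'.
  by congr f; apply/funext => k; rewrite u0 mulr0 subr0.
set la := (1 - _)%R in la0 *.
pose S g := (\sum_(i | i != j) g i * u i)%R.
have S_upd h z : S (upd h j z) = S h.
  by apply: eq_bigr => i ij; rewrite /upd (negbTE ij).
have mS : coord_measurable (fun g => (S g)%:E).
  move=> d T h mh; apply/measurable_EFinP; rewrite /S.
  by apply: measurable_sumP => i _; exact: measurable_funM.
(* Let t be the scalar product of g and u. Store t in the pivot coordinate j, subtract c t u_k from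
   every other coordinate ([f3]), multiply the pivot by [la] ([f2]), because the new vector has
   scalar product [la] t with u, and solve for its coordinate j ([f1]). The factors |u_j| of the
   first and last maps cancel. *)
pose f1 g := f (upd g j ((u j)^-1 * g j + - (u j)^-1 * S g)%R).
pose f2 g := f1 (upd g j (la * g j + 0)%R).
pose f3 g := f2 (fun k => if k \in [seq k <- enum I | k != j]
                          then g k - c * u k * g j else g k)%R.
have mu1 : coord_measurable f1.
  apply: coord_measurable_comp => // k; apply: coord_measurable_upd.
  move=> d T h mh; apply/measurable_EFinP; apply: measurable_funD.
    exact: measurable_funM.
  by apply: measurable_funM => //; have /measurable_EFinP := mS _ _ _ mh.
have mu2 : coord_measurable f2.
  apply: coord_measurable_comp => // k; apply: coord_measurable_upd.
  move=> d T h mh; apply/measurable_EFinP; apply: measurable_funD => //.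
  exact: measurable_funM.
have mu3 : coord_measurable f3.
  apply: coord_measurable_comp => // k d T h mh; apply/measurable_EFinP.
  by case: (k \in _) => //; apply: measurable_funB => //;
     apply: measurable_funM => //; apply: measurable_funM.
transitivity (lint s (fun g => f3 (upd g j (u j * g j + S g)%R)) g).
  apply: eq_lint => h; rewrite /f3 /f2 /f1; congr f; apply/funext => k.
  have Sh : (\sum_i h i * u i = u j * h j + S h)%R.
    by rewrite (bigD1 j) //= mulrC.
  rewrite Sh; set t := (u j * h j + S h)%R.
  set h1 := upd h j t.
  pose h2 k := (if k \in [seq k <- enum I | k != j] then h1 k - c * u k * h1 j else h1 k)%R.
  rewrite -/h2.
  have h1j : h1 j = t by exact: upd_eq.
  have h2j : h2 j = t by rewrite /h2 mem_filter eqxx.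
  have h2k i : i != j -> h2 i = (h i - c * u i * t)%R.
    by move=> ij; rewrite /h2 mem_filter ij mem_enum /= h1j /h1 /upd (negbTE ij).
  rewrite -[X in (la * X)%R]/(h2 j) h2j addr0 S_upd upd_upd.
  case: (eqVneq k j) => [->|kj]; last first.
    by rewrite /upd (negbTE kj) h2k //; ring.
  rewrite (upd_eq h2) upd_eq.
  have -> : S h2 = (S h - c * t * \sum_(i | i != j) u i ^+ 2)%R.
    rewrite /S mulr_sumr -sumrB; apply: eq_bigr => i ij.
    by rewrite h2k //; ring.
  by rewrite /la (bigD1 j) //= /t; field.
have f10 h : 0 <= f1 h by exact: f0.
have f20 h : 0 <= f2 h by exact: f0.
have f30 h : 0 <= f3 h by exact: f0.
rewrite (lint_shear _ us (sT j) uj) //.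
rewrite (@lint_shears s j f2 g u c [seq k <- enum I | k != j]) //; last first.
- by rewrite mem_filter eqxx.
- by apply: filter_uniq; exact: enum_uniq.
rewrite (lint_shear (b := fun=> 0%R) _ us (sT j) la0) //.
have uj' : (u j)^-1%R != 0%R by rewrite invr_eq0.
rewrite (lint_shear (b := fun g => (- (u j)^-1 * S g)%R) _ us (sT j) uj') //; last first.
- by move=> h z; rewrite S_upd.
- move=> d T h mh; apply/measurable_EFinP; apply: measurable_funM => //.
  by have /measurable_EFinP := mS _ _ _ mh.
rewrite !muleA -!EFinM; congr (_%:E * _).
by rewrite normfV invrK; field; rewrite !normr_eq0 uj la0.
Qed.

End RankOneSubstitution.

(** * The regularised Gram-Schmidt process *)

Section GramSchmidt.
Local Open Scope ring_scope.
Variables (R : realType) (d : nat).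
Implicit Types (e : R) (u v x : 'rV[R]_d).

Definition dot u v : R := \sum_j u ord0 j * v ord0 j.

(* For e = 0, [Bmx e u] is the orthogonal projection onto the hyperplane u^perp,
   [Tmx e Y] the one onto the orthogonal complement of the rows of Y, and
   [Dmx e Y] is Det Y.  For e > 0, [Bmx e u] is symmetric with eigenvalue
   e / qn e u on u and 1 on u^perp, hence invertible. *)
Definition qn e u : R := Num.sqrt (e ^+ 2 + dot u u).

Definition Bmx e u : 'M[R]_d := 1%:M - (qn e u * (qn e u + e))^-1 *: (u^T *m u).

Fixpoint Tmx e k : 'M[R]_(k, d) -> 'M[R]_d :=
  match k with
  | 0 => fun _ => 1%:M
  | k'.+1 => fun Y =>
      Bmx e (row ord0 Y *m (Tmx e (row' ord0 Y))^T) *m Tmx e (row' ord0 Y)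
  end.

Fixpoint Dmx e k : 'M[R]_(k, d) -> R :=
  match k with
  | 0 => fun _ => 1
  | k'.+1 => fun Y => qn e (row ord0 Y *m (Tmx e (row' ord0 Y))^T) * Dmx e (row' ord0 Y)
  end.

Lemma dotE u v : dot u v = (u *m v^T) ord0 ord0.
Proof. by rewrite mxE; apply: eq_bigr => j _; rewrite mxE. Qed.

Lemma dotC u v : dot u v = dot v u.
Proof. by apply: eq_bigr => j _; rewrite mulrC. Qed.

Lemma dot_ge0 u : 0 <= dot u u.
Proof. by apply: sumr_ge0 => j _; rewrite -expr2 sqr_ge0. Qed.

Lemma dot_eq0 u : (dot u u == 0) = (u == 0).
Proof.
apply/eqP/eqP => [|->]; last by rewrite /dot big1 // => j _; rewrite mxE mul0r.
move/eqP; rewrite psumr_eq0 => [/allP u0|j _]; last by rewrite -expr2 sqr_ge0.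
apply/rowP => j; apply/eqP; rewrite mxE.
by have := u0 j (mem_index_enum _); rewrite -expr2 sqrf_eq0.
Qed.

Lemma dotZl (c : R) u v : dot (c *: u) v = c * dot u v.
Proof. by rewrite !dotE -scalemxAl mxE. Qed.

Lemma dotBl u v x : dot (u - v) x = dot u x - dot v x.
Proof. by rewrite !dotE mulmxBl !mxE. Qed.

Lemma dot_mul u v (M : 'M[R]_d) : dot (u *m M) v = dot u (v *m M^T).
Proof. by rewrite !dotE trmx_mul trmxK mulmxA. Qed.

Lemma qn_ge0 e u : 0 <= qn e u. Proof. exact: sqrtr_ge0. Qed.

Lemma qn_sqr e u : qn e u ^+ 2 = e ^+ 2 + dot u u.
Proof. by rewrite sqr_sqrtr // addr_ge0 ?sqr_ge0 ?dot_ge0. Qed.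

Lemma qn_gt0 e u : 0 < e -> 0 < qn e u.
Proof. by move=> e0; rewrite sqrtr_gt0 ltr_pwDl ?exprn_gt0 ?dot_ge0. Qed.

Lemma qn0_eq0 u : (qn 0 u == 0) = (u == 0).
Proof. by rewrite -dot_eq0 -sqrf_eq0 qn_sqr expr0n add0r. Qed.

Lemma BmxE e u x :
  x *m Bmx e u = x - ((qn e u * (qn e u + e))^-1 * dot x u) *: u.
Proof.
rewrite mulmxBr mulmx1 -scalemxAr mulmxA -scalerA; congr (_ - _ *: _).
by rewrite [x *m u^T]mx11_scalar mul_scalar_mx -dotE.
Qed.

Lemma Bmx_entry e u i j : Bmx e u i j
  = (i == j)%:R - (qn e u * (qn e u + e))^-1 * (u ord0 i * u ord0 j).
Proof. by rewrite !mxE big_ord1 !mxE. Qed.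

Lemma Bmx_tr e u : (Bmx e u)^T = Bmx e u.
Proof. by rewrite /Bmx linearB linearZ /= trmx1 trmx_mul trmxK. Qed.

Lemma Bmx_coef e u : 0 < e -> 1 - (qn e u * (qn e u + e))^-1 * dot u u = e / qn e u.
Proof.
move=> e0; have q0 := qn_gt0 u e0.
have -> : dot u u = qn e u ^+ 2 - e ^+ 2 by rewrite qn_sqr addrC addKr.
by field; rewrite !gt_eqF ?addr_gt0.
Qed.

Lemma Bmx_coef0 u : (1 - (qn 0 u * (qn 0 u + 0))^-1 * dot u u) *: u = 0.
Proof.
have [->|u0] := eqVneq u 0; first by rewrite scaler0.
have <- : qn 0 u ^+ 2 = dot u u by rewrite qn_sqr expr0n add0r.
by rewrite addr0 -expr2 mulVf ?subrr ?scale0r // sqrf_eq0 qn0_eq0.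
Qed.

(* This identity turns the Gaussian density of x into that of [x *m Bmx e u] times
   a narrow Gaussian in the direction of u. *)
Lemma dot_Bmx_sqr e u x : 0 < e ->
  dot x x = dot (x *m Bmx e u) (x *m Bmx e u)
            + (dot (x *m Bmx e u) u) ^+ 2 / e ^+ 2.
Proof.
move=> e0; have q0 := qn_gt0 u e0; rewrite BmxE; set c := (_ * _)^-1.
have qE : dot u u = qn e u ^+ 2 - e ^+ 2 by rewrite qn_sqr addrC addKr.
rewrite !dotBl !dotZl !(dotC _ (x - _)) !dotBl !dotZl (dotC u x) qE /c.
by field; rewrite !gt_eqF ?addr_gt0.
Qed.

Lemma dot_Bmx_le e u x : 0 <= e -> dot (x *m Bmx e u) (x *m Bmx e u) <= dot x x.
Proof.
rewrite le_eqVlt => /predU1P[<-|e0]; last first.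
  by rewrite [leRHS](dot_Bmx_sqr u x e0) lerDl divr_ge0 ?sqr_ge0.
have [->|u0] := eqVneq u 0.
  by rewrite BmxE scaler0 subr0.
rewrite BmxE; set c := (_ * _)^-1.
have cE : c * dot u u = 1.
  have <- : qn 0 u ^+ 2 = dot u u by rewrite qn_sqr expr0n add0r.
  by rewrite /c addr0 -expr2 mulVf // sqrf_eq0 qn0_eq0.
have c0 : 0 <= c by rewrite invr_ge0 addr0 mulr_ge0 ?qn_ge0.
rewrite !dotBl !dotZl !(dotC _ (x - _)) !dotBl !dotZl (dotC u x).
have : 0 <= c * dot x u ^+ 2 by rewrite mulr_ge0 ?sqr_ge0.
have -> : dot x u - c * dot x u * dot u u = 0 by rewrite mulrAC cE mul1r subrr.
by rewrite mulr0 subr0 => ?; rewrite gerBl -mulrA -expr2.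
Qed.

Lemma dot_Tmx_le e k (Y : 'M[R]_(k, d)) x : 0 <= e ->
  dot (x *m Tmx e Y) (x *m Tmx e Y) <= dot x x.
Proof.
move=> e0; elim: k Y x => [|k IH] Y x /=; first by rewrite mulmx1.
by rewrite mulmxA; apply: le_trans (IH _ _) (dot_Bmx_le _ _ e0).
Qed.

Lemma dot_Tmx_tr_le e k (Y : 'M[R]_(k, d)) x : 0 <= e ->
  dot (x *m (Tmx e Y)^T) (x *m (Tmx e Y)^T) <= dot x x.
Proof.
move=> e0; elim: k Y x => [|k IH] Y x /=; first by rewrite trmx1 mulmx1.
by rewrite trmx_mul mulmxA Bmx_tr; apply: le_trans (dot_Bmx_le _ _ e0) (IH _ _).
Qed.

Lemma Dmx_gt0 e k (Y : 'M[R]_(k, d)) : 0 < e -> 0 < Dmx e Y.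
Proof. by move=> e0; elim: k Y => //= k IH Y; rewrite mulr_gt0 ?qn_gt0. Qed.

Lemma Dmx_ge0 e k (Y : 'M[R]_(k, d)) : 0 <= Dmx e Y.
Proof. by elim: k Y => //= k IH Y; rewrite mulr_ge0 ?qn_ge0. Qed.

Lemma qn_Tmx_tr_le e k (Y : 'M[R]_(k, d)) x : 0 <= e <= 1 ->
  qn e (x *m (Tmx e Y)^T) <= 1 + dot x x.
Proof.
move=> /andP[e0 e1]; set u := _ *m _.
have le1 : 1 + dot u u <= 1 + dot x x by rewrite lerD2l; exact: dot_Tmx_tr_le.
apply: le_trans le1; have := dot_ge0 u => u0.
rewrite -(@ler_pXn2r _ 2) ?nnegrE ?qn_ge0 ?addr_ge0 // qn_sqr.
apply: (@le_trans _ _ (1 + dot u u)); first by rewrite lerD2r exprn_ile1.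
by rewrite -[leLHS]mulr1 expr2 ler_pM ?addr_ge0 // lerDl.
Qed.

(** Being uniform in [e], this bound lets a product of determinants tend to 0 as soon as one factor
    does, whether or not the others converge. *)
Lemma Dmx_le e k (Y : 'M[R]_(k, d)) : 0 <= e <= 1 ->
  Dmx e Y <= \prod_(i < k) (1 + dot (row i Y) (row i Y)).
Proof.
move=> e01; elim: k Y => [|k IH] Y /=; first by rewrite big_ord0.
rewrite big_ord_recl ler_pM ?qn_ge0 ?Dmx_ge0 //.
  exact: qn_Tmx_tr_le.
apply: le_trans (IH _) _; rewrite le_eqVlt; apply/predU1P; left.
apply: eq_bigr => i _; suff -> : row i (row' ord0 Y) = row (lift ord0 i) Y by [].
by apply/rowP => j; rewrite !mxE.
Qed.

Lemma col_mx_row k (Y : 'M[R]_(k.+1, d)) :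
  Y = col_mx (row ord0 Y) (row' ord0 Y) :> 'M[R]_(1 + k, d).
Proof.
apply/matrixP => i j; case: (@splitP 1 k i) => i' ii'.
  have -> : i = lshift k i' by apply: val_inj.
  by rewrite col_mxEu mxE; congr (Y _ j); apply: val_inj; rewrite /= ord1.
have -> : i = rshift 1 i' by apply: val_inj.
by rewrite col_mxEd mxE; congr (Y _ j); apply: val_inj.
Qed.

(** These two properties characterise the orthogonal projection onto the complement of the row
    space. Dependent rows are allowed: a row in the span of the later ones gives u = 0, and
    [Bmx 0 0] is the identity. *)
Lemma Tmx0_spec k (Y : 'M[R]_(k, d)) :
  Tmx 0 Y *m Y^T = 0 /\ (1%:M - Tmx 0 Y <= Y)%MS.
Proof.
elim: k Y => [|k IH] Y /=.
  split; last by rewrite subrr sub0mx.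
  by rewrite mul1mx; apply/matrixP => i [].
have [] := IH (row' ord0 Y); set r := row ord0 Y; set Y' := row' _ _; set T := Tmx 0 Y'.
move=> TY /submxP[K TK].
(* T annihilates 1 - T^T, whose columns lie in the span of those of Y'^T. Hence T = T T^T, which is
   symmetric. *)
have Tsym : T^T = T.
  have : T *m T^T = T.
    have -> : T^T = 1%:M - (Y'^T) *m K^T.
      by rewrite -trmx_mul -TK linearB /= trmx1 opprB addrC subrK.
    by rewrite mulmxBr mulmx1 mulmxA TY mul0mx subr0.
  by move=> <-; rewrite trmx_mul trmxK.
set u := r *m T^T.
have Bu : Bmx 0 u *m u^T = 0.
  apply/trmx_inj; rewrite trmx_mul trmxK trmx0 Bmx_tr BmxE.
  by rewrite -[X in X - _]scale1r -scalerBl Bmx_coef0.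
have YE : Y = col_mx r Y' := col_mx_row Y.
have rY : (r <= Y)%MS by rewrite row_sub.
have Y'Y : (Y' <= Y)%MS.
  by apply/row_subP => i; rewrite (_ : row i Y' = row (lift ord0 i) Y) ?row_sub //;
    apply/rowP => j; rewrite !mxE.
have uY : (u <= Y)%MS.
  have -> : u = r - r *m K *m Y'.
    by rewrite /u Tsym -mulmxA -TK mulmxBr mulmx1 opprB addrC subrK.
  by rewrite addmx_sub // eqmx_opp (submx_trans _ Y'Y) // submxMl.
split.
  have E : Bmx 0 u *m T *m row_mx (r^T) (Y'^T) = 0.
    rewrite mul_mx_row -!mulmxA TY mulmx0.
    have -> : T *m r^T = u^T by rewrite trmx_mul trmxK.
    by rewrite Bu row_mx0.
  by move: E; rewrite -tr_col_mx -YE.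
have -> : 1%:M - Bmx 0 u *m T = (1%:M - T) + (1%:M - Bmx 0 u) *m T.
  by rewrite [in RHS]mulmxBl mul1mx addrA subrK.
rewrite addmx_sub //; first by rewrite TK (submx_trans _ Y'Y) // submxMl.
rewrite /Bmx opprB addrC subrK -scalemxAl scalemx_sub // -mulmxA.
have -> : u *m T = u - u *m K *m Y'.
  by rewrite -mulmxA -TK mulmxBr mulmx1 opprB addrC subrK.
apply: submx_trans (submxMl _ _) _.
by rewrite addmx_sub // eqmx_opp (submx_trans _ Y'Y) // submxMl.
Qed.

Lemma Tmx0_tr k (Y : 'M[R]_(k, d)) : (Tmx 0 Y)^T = Tmx 0 Y.
Proof.
have [TY /submxP[K TK]] := Tmx0_spec Y; set T := Tmx 0 Y in TY TK *.
have : T *m T^T = T.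
  have -> : T^T = 1%:M - Y^T *m K^T by rewrite -trmx_mul -TK linearB /= trmx1 opprB addrC subrK.
  by rewrite mulmxBr mulmx1 mulmxA TY mul0mx subr0.
by move=> <-; rewrite trmx_mul trmxK.
Qed.

Lemma mulmx_tr_eq0 m (M : 'M[R]_(m, d)) : M *m M^T = 0 -> M = 0.
Proof.
move=> MM; apply/row_matrixP => i; rewrite row0; apply/eqP; rewrite -dot_eq0.
have /matrixP/(_ i i) := MM; rewrite !mxE => MMi; apply/eqP; rewrite -[RHS]MMi.
by apply: eq_bigr => j _; rewrite !mxE.
Qed.

End GramSchmidt.

Section GramDeterminant.
Local Open Scope ring_scope.
Variables (R : realType) (d : nat).

(** One Gram-Schmidt step: the unitriangular [L] replaces the first row by its component orthogonal
    to the other rows, which makes the Gram matrix block diagonal. *)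
Lemma det_gram_Dmx k (Y : 'M[R]_(k, d)) : \det (Y *m Y^T) = Dmx 0 Y ^+ 2.
Proof.
elim: k Y => [|k IH] Y /=; first by rewrite det_mx00 expr1n.
have [] := Tmx0_spec (row' ord0 Y); set r := row ord0 Y; set Y' := row' _ _.
rewrite Tmx0_tr; set T := Tmx 0 Y' => TY /submxP[K TK].
set u := r *m T; have YE : Y = col_mx r Y' := col_mx_row Y.
have uE : u = r - r *m K *m Y'.
  by rewrite -mulmxA -TK mulmxBr mulmx1 opprB addrC subrK.
pose L : 'M[R]_(1 + k) := block_mx 1%:M (- (r *m K)) 0 1%:M.
have detL : \det L = 1 by rewrite det_ublock !det1 mulr1.
have LY : L *m col_mx r Y' = col_mx u Y'.
  by rewrite mul_block_col !mul1mx mul0mx add0r mulNmx uE.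
have uY : u *m Y'^T = 0 by rewrite -mulmxA TY mulmx0.
have -> : \det (Y *m Y^T) = \det (L *m col_mx r Y' *m (L *m col_mx r Y')^T).
  by rewrite trmx_mul mulmxA -(mulmxA L) !det_mulmx det_tr detL mulr1 mul1r -YE.
rewrite LY tr_col_mx mul_col_row uY.
have -> : Y' *m u^T = 0 by apply: trmx_inj; rewrite trmx_mul trmxK trmx0.
by rewrite det_ublock exprMn qn_sqr expr0n add0r dotE det_mx11 IH.
Qed.

Lemma DetE k (Y : 'M[R]_(k, d)) : Det Y = Dmx 0 Y.
Proof. by rewrite /Det det_gram_Dmx sqrtr_sqr ger0_norm ?Dmx_ge0. Qed.

(** Only the row space matters, so X may hold the normalised points and Y the vectors before
    normalisation. In the decomposition 1 = (1 - T) + T the projection kills the first summand and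
    fixes the second. *)
Lemma orth_projE m k (X : 'M[R]_(m, d)) (Y : 'M[R]_(k, d)) : (X :=: Y)%MS ->
  orth_proj X = Tmx 0 Y.
Proof.
move=> XY; have [TY TK] := Tmx0_spec Y.
have /submxP[J XJ] : (X <= Y)%MS by rewrite XY.
have cap0 : (kermx X^T :&: <<X>>%MS = 0)%MS.
  set M := (_ :&: _)%MS; apply: mulmx_tr_eq0.
  have /submxP[L ML] : (M <= X)%MS by rewrite (submx_trans (capmxSr _ _)) ?genmxE.
  have MX : M *m X^T = 0 by apply/sub_kermxP; exact: capmxSl.
  by rewrite [in X in _ *m X]ML trmx_mul mulmxA MX mul0mx.
have T1 : (Tmx 0 Y <= kermx X^T)%MS.
  by apply/sub_kermxP; rewrite XJ trmx_mul mulmxA TY mul0mx.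
have T2 : (1%:M - Tmx 0 Y <= <<X>>)%MS by rewrite genmxE XY.
rewrite /orth_proj -[LHS]mul1mx -(subrK (Tmx 0 Y) 1%:M) mulmxDl.
by rewrite proj_mx_0 // proj_mx_id // add0r.
Qed.

Lemma det_gram_scale k (X Y : 'M[R]_(k, d)) (c : 'I_k -> R) :
  (forall i, row i Y = c i *: row i X) ->
  \det (Y *m Y^T) = (\prod_i c i) ^+ 2 * \det (X *m X^T).
Proof.
move=> YX; have -> : Y = diag_mx (\row_i c i) *m X.
  apply/matrixP => i j; rewrite mul_diag_mx !mxE.
  by have /rowP/(_ j) := YX i; rewrite !mxE.
rewrite trmx_mul mulmxA -(mulmxA _ X) !det_mulmx det_tr det_diag.
under eq_bigr do rewrite mxE.
by ring.
Qed.

End GramDeterminant.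

(** * One vertex of the process as a Gaussian change of variables *)

Section GaussianStep.
Variables (R : realType) (d : nat).

Definition rowv (y : 'I_d -> R) : 'rV[R]_d := \row_j y j.

(** Up to the factor sqrt(2 pi), the density of a centred normal law of standard deviation [e]: a
    smooth substitute for the constraint t = 0. *)
Definition gker (e t : R) : R := (e^-1 * expR (- (t ^+ 2 / (2 * e ^+ 2))))%R.

Lemma gker_ge0 e t : (0 < e)%R -> (0 <= gker e t)%R.
Proof. by move=> e0; rewrite mulr_ge0 ?expR_ge0 // invr_ge0 ltW. Qed.

Definition gdens (x : 'rV[R]_d) : R := expR (- (dot x x / 2)).

Definition row_measurable (F : 'rV[R]_d -> \bar R) :=
  forall e (T : measurableType e) (h : T -> 'rV[R]_d),
  (forall j, measurable_fun [set: T] (fun x => h x ord0 j)) ->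
  measurable_fun [set: T] (fun x => F (h x)).

Lemma row_measurable_rowv F : row_measurable F -> coord_measurable (fun y => F (rowv y)).
Proof. by move=> mF e T h mh; apply: mF => j; (under eq_fun do rewrite mxE); exact: mh. Qed.

Lemma measurable_dot e (T : measurableType e) (f h : T -> 'rV[R]_d) :
  (forall j, measurable_fun [set: T] (fun x => f x ord0 j)) ->
  (forall j, measurable_fun [set: T] (fun x => h x ord0 j)) ->
  measurable_fun [set: T] (fun x => dot (f x) (h x)).
Proof.
by move=> mf mh; rewrite /dot; apply: measurable_sumP => j _; exact: measurable_funM.
Qed.

Lemma measurable_gker e0 e (T : measurableType e) (f : T -> R) :
  measurable_fun [set: T] f -> measurable_fun [set: T] (fun x => gker e0 (f x)).
Proof.
move=> mf; apply: measurable_funM => //; apply: measurableT_comp => //.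
apply: measurable_funN; apply: measurable_funM => //.
exact: measurable_funX.
Qed.

Lemma measurable_gdens e (T : measurableType e) (f : T -> 'rV[R]_d) :
  (forall j, measurable_fun [set: T] (fun x => f x ord0 j)) ->
  measurable_fun [set: T] (fun x => gdens (f x)).
Proof.
move=> mf; apply: measurableT_comp => //; apply: measurable_funN.
by apply: measurable_funM => //; exact: measurable_dot.
Qed.

Lemma measurable_mulmxr e (T : measurableType e) (f : T -> 'rV[R]_d) (M : 'M[R]_d) :
  (forall j, measurable_fun [set: T] (fun x => f x ord0 j)) ->
  forall j, measurable_fun [set: T] (fun x => (f x *m M) ord0 j).
Proof.
move=> mf j; under eq_fun do rewrite mxE.
by apply: measurable_sumP => i _; exact: measurable_funM.
Qed.

(** The inverse Jacobian [qn e u / e] cancels the weight 1 / [qn e u]. The remaining 1/e and the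
    exponential that [dot_Bmx_sqr] splits off form the kernel [gker]. *)
Lemma gauss_rank_one e u (F : 'rV[R]_d -> \bar R) g : (0 < e)%R ->
  (forall x, 0 <= F x) -> row_measurable F ->
  lint (enum 'I_d) (fun y =>
    (gdens (rowv y) / qn e u)%:E * F (rowv y *m Bmx e u)) g =
  lint (enum 'I_d) (fun y => (gdens (rowv y) * gker e (dot (rowv y) u))%:E * F (rowv y)) g.
Proof.
move=> e0 F0 mF; have q0 := qn_gt0 u e0.
set c := ((qn e u * (qn e u + e))^-1)%R.
pose G x := (gdens x * gker e (dot x u))%:E * F x.
have G0 x : 0 <= G x by rewrite mule_ge0 // lee_fin mulr_ge0 ?expR_ge0 ?gker_ge0.
have mG : row_measurable G.
  move=> e' T h mh; apply: emeasurable_funM; last exact: mF.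
  apply/measurable_EFinP; apply: measurable_funM; first exact: measurable_gdens.
  by apply: measurable_gker; exact: measurable_dot.
have c1 : (1 - c * \sum_i u ord0 i ^+ 2 = e / qn e u)%R.
  by rewrite -(Bmx_coef u e0) /dot -/c; congr (1 - c * _)%R.
have Gn0 : (0 < e / qn e u)%R by rewrite divr_gt0.
have := @lint_rank_one R 'I_d (enum 'I_d) (fun y => G (rowv y)) g (fun j => u ord0 j) c
  (enum_uniq _) (fun i => mem_enum _ i).
rewrite c1 gt_eqF // gtr0_norm // invf_div.
move=> /(_ isT (fun y => G0 (rowv y)) (row_measurable_rowv mG)) HG.
transitivity ((e / qn e u)%:E * ((qn e u / e)%:E *
    lint (enum 'I_d) (fun y => G (rowv y)) g)); last first.
  by rewrite muleA -EFinM mulrA divfK ?gt_eqF // divff ?gt_eqF // mul1e.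
rewrite -HG -lintZl; last 3 first.
- by rewrite lee_fin ltW.
- by move=> y; exact: G0.
- move=> e' T h mh; apply: mG => j.
  under eq_fun do rewrite mxE; apply: measurable_funB => //.
  apply: measurable_funM => //; apply: measurable_funM => //.
  by apply: measurable_sumP => i _; exact: measurable_funM.
apply: eq_lint => y.
have -> : rowv (fun k => (y k - c * (\sum_i y i * u ord0 i) * u ord0 k)%R)
    = rowv y *m Bmx e u.
  rewrite BmxE; apply/rowP => j; rewrite !mxE; congr (_ - _ * _ * _)%R.
  by apply: eq_bigr => i _; rewrite mxE.
rewrite /G muleA -EFinM; congr (_%:E * _).
rewrite /gker /gdens (dot_Bmx_sqr u (rowv y) e0).
set x := dot _ _; set z := dot _ _.
rewrite [(- ((x + _) / 2))%R](_ : _ = - (x / 2) + - (z ^+ 2 / (2 * e ^+ 2)))%R; last first.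
  by field; rewrite gt_eqF.
by rewrite expRD; field; rewrite !gt_eqF.
Qed.

(** The transpose in [Tmx] is there for this lemma. Write r for the first row and T for the map of
    the other rows; then u = r T^T, so <y, u> = <y T, r>, and the kernel along u becomes a kernel
    along the original row r once T has been applied. *)
Lemma gauss_Tmx e k (Y : 'M[R]_(k, d)) (F : 'rV[R]_d -> \bar R) g : (0 < e)%R ->
  (forall x, 0 <= F x) -> row_measurable F ->
  lint (enum 'I_d) (fun y =>
    (gdens (rowv y) / Dmx e Y)%:E * F (rowv y *m Tmx e Y)) g =
  lint (enum 'I_d) (fun y =>
    (gdens (rowv y) * \prod_(i < k) gker e (dot (rowv y) (row i Y)))%:E * F (rowv y)) g.
Proof.
move=> e0; elim: k Y F => [|k IH] Y F F0 mF /=.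
  by apply: eq_lint => y; rewrite big_ord0 divr1 mulr1 mulmx1.
set u := _ *m (Tmx e _)^T; set Y' := row' ord0 Y.
have D0 := Dmx_gt0 Y' e0; have q0 := qn_gt0 u e0.
pose F1 x := ((Dmx e Y')^-1)%:E * F (x *m Tmx e Y').
have F10 x : 0 <= F1 x by rewrite mule_ge0 // lee_fin invr_ge0 ltW.
have mF1 : row_measurable F1.
  move=> e' T h mh; apply: emeasurable_funM => //.
  by apply: mF => j; exact: measurable_mulmxr.
transitivity (lint (enum 'I_d) (fun y =>
    (gdens (rowv y) / qn e u)%:E * F1 (rowv y *m Bmx e u)) g).
  apply: eq_lint => y; rewrite /F1 muleA -EFinM mulmxA; congr (_%:E * _).
  by field; rewrite !gt_eqF.
rewrite gauss_rank_one //.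
pose F2 x := (gker e (dot x (row ord0 Y)))%:E * F x.
have F20 x : 0 <= F2 x by rewrite mule_ge0 // lee_fin gker_ge0.
have mF2 : row_measurable F2.
  move=> e' T h mh; apply: emeasurable_funM; last exact: mF.
  apply/measurable_EFinP; apply: measurable_gker; exact: measurable_dot.
transitivity (lint (enum 'I_d) (fun y =>
    (gdens (rowv y) / Dmx e Y')%:E * F2 (rowv y *m Tmx e Y')) g).
  apply: eq_lint => y; rewrite /F1 /F2 !muleA -!EFinM /u -dot_mul.
  by congr (_%:E * _); ring.
rewrite IH //; apply: eq_lint => y; rewrite /F2 muleA -EFinM big_ord_recl.
congr (_%:E * _); rewrite -mulrA [X in (_ * X)%R]mulrC.
congr (_ * (_ * _))%R; apply: eq_bigr => i _; congr gker; congr dot.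
by apply/rowP => j; rewrite !mxE.
Qed.

End GaussianStep.

Section MeasurableProcess.
Local Open Scope ring_scope.
Variables (R : realType) (disp : measure_display) (T : measurableType disp).

Lemma measurable_inv_ge0 (f : T -> R) : (forall x, 0 <= f x) ->
  measurable_fun [set: T] f -> measurable_fun [set: T] (fun x => (f x)^-1).
Proof.
move=> f0 mf; under eq_fun do rewrite -powR_inv1 ?f0 //.
exact: measurableT_comp (measurable_powR _) mf.
Qed.

Lemma measurable_sqrt_ge0 (f : T -> R) : (forall x, 0 <= f x) ->
  measurable_fun [set: T] f -> measurable_fun [set: T] (fun x => Num.sqrt (f x)).
Proof.
move=> f0 mf; under eq_fun do rewrite -powR12_sqrt ?f0 //.
exact: measurableT_comp (measurable_powR _) mf.
Qed.

Lemma measurable_qn d e (u : T -> 'rV[R]_d) :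
  (forall j, measurable_fun [set: T] (fun x => u x ord0 j)) ->
  measurable_fun [set: T] (fun x => qn e (u x)).
Proof.
move=> mu; apply: measurable_sqrt_ge0 => [x|].
  by rewrite addr_ge0 ?sqr_ge0 ?dot_ge0.
by apply: measurable_funD => //; exact: measurable_dot.
Qed.

Lemma measurable_Tmx_Dmx d e k (Y : T -> 'M[R]_(k, d)) : 0 <= e ->
  (forall i j, measurable_fun [set: T] (fun x => Y x i j)) ->
  (forall i j, measurable_fun [set: T] (fun x => Tmx e (Y x) i j)) /\
  measurable_fun [set: T] (fun x => Dmx e (Y x)).
Proof.
move=> e0; elim: k Y => [|k IH] Y mY /=.
  by split => [i j|]; exact: measurable_cst.
have [i j|mT mD] := IH (fun x => row' ord0 (Y x)).
  by under eq_fun do rewrite mxE; exact: mY.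
have mu j : measurable_fun [set: T]
    (fun x => (row ord0 (Y x) *m (Tmx e (row' ord0 (Y x)))^T) ord0 j).
  under eq_fun do rewrite mxE.
  apply: measurable_sumP => i _; apply: measurable_funM.
    by under eq_fun do rewrite mxE; exact: mY.
  by under eq_fun do rewrite mxE; exact: mT.
split; last by apply: measurable_funM => //; exact: measurable_qn.
move=> i j; under eq_fun do rewrite mxE.
apply: measurable_sumP => l _; apply: measurable_funM; last exact: mT.
under eq_fun do rewrite Bmx_entry.
apply: measurable_funB; first exact: measurable_cst.
apply: measurable_funM; last first.
  exact: measurable_funM.
have mq := measurable_qn e mu.
apply: measurable_inv_ge0 => [x|].
  by rewrite mulr_ge0 ?addr_ge0 ?qn_ge0.
by apply: measurable_funM => //; exact: measurable_funD.
Qed.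

End MeasurableProcess.

(** * The sequential process, and its replacement by independent Gaussian vectors with edge
    kernels *)

Section Process.
Variables (R : realType) (W : finType) (adj : rel W) (d : nat) (p : W -> 'I_#|W|).
Implicit Types (a : W -> 'rV[R]_d) (g : W * 'I_d -> R) (v : W).

Definition cfg g v : 'rV[R]_d := rowv (fun j => g (v, j)).

(* The sequential process without normalisation: for e = 0 its value at v is a
   multiple of the point [rso] assigns to v (see [rso_procE]). *)
Fixpoint sproc (e : R) (k : nat) a : W -> 'rV[R]_d :=
  match k with
  | 0 => a
  | k'.+1 => fun v => if (p v : nat) == k'
                      then a v *m Tmx e (xp_mx adj p (sproc e k' a) v)
                      else sproc e k' a v
  end.

Definition cfg_measurable (H : (W -> 'rV[R]_d) -> \bar R) :=
  forall disp (T : measurableType disp) (h : W -> T -> 'rV[R]_d),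
  (forall v j, measurable_fun [set: T] (fun x => h v x ord0 j)) ->
  measurable_fun [set: T] (fun x => H (fun v => h v x)).

Lemma coord_measurable_cfg H : cfg_measurable H -> coord_measurable (fun g => H (cfg g)).
Proof.
move=> mH disp T h mh; apply: (mH _ _ (fun v x => cfg (fun i => h i x) v)) => v j.
by under eq_fun do rewrite mxE; exact: mh.
Qed.

Lemma xp_mxE a v i j : xp_mx adj p a v i j = a (enum_val i) ord0 j.
Proof. by rewrite mxE. Qed.

Lemma xp_mx_row a v i : row i (xp_mx adj p a v) = a (enum_val i).
Proof. by apply/rowP => j; rewrite !mxE. Qed.

Lemma Np_lt v (i : 'I_(dp adj p v)) : (p (enum_val i) < p v)%N.
Proof. by have := enum_valP i; rewrite inE => /andP[]. Qed.

Lemma eq_xp_mx a b v : (forall w, (p w < p v)%N -> a w = b w) ->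
  xp_mx adj p a v = xp_mx adj p b v.
Proof.
by move=> ab; apply/matrixP => i j; rewrite !xp_mxE ab // Np_lt.
Qed.

Lemma measurable_sproc disp (T : measurableType disp) e k (h : W -> T -> 'rV[R]_d) :
  (0 <= e)%R -> (forall v j, measurable_fun [set: T] (fun x => h v x ord0 j)) ->
  forall v j, measurable_fun [set: T] (fun x => sproc e k (fun v => h v x) v ord0 j).
Proof.
move=> e0 mh; elim: k => [//|k IH] v j /=.
case: ((p v : nat) == k) => //.
under eq_fun do rewrite mxE.
apply: measurable_sumP => i _; apply: measurable_funM => //.
have [] // := @measurable_Tmx_Dmx R _ T d e _
  (fun x => xp_mx adj p (sproc e k (fun v => h v x)) v) e0.
by move=> i' j'; under eq_fun do rewrite mxE; exact: IH.
Qed.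

Definition glue g v (y : 'I_d -> R) : W * 'I_d -> R :=
  fun z => if z.1 == v then y z.2 else g z.

Lemma cfg_glue g v y : cfg (glue g v y) = upd (cfg g) v (rowv y).
Proof.
apply/funext => w; rewrite /upd; apply/rowP => j; case: eqP => [->|/eqP wv].
  by rewrite !mxE /glue eqxx.
by rewrite !mxE /glue /= (negbTE wv).
Qed.

End Process.

Section BlockIntegral.
Variables (R : realType) (W : finType) (d : nat).
Implicit Types (g : W * 'I_d -> R) (v : W) (s : seq (W * 'I_d)).

Lemma lint_glue (t : seq 'I_d) (f : (W * 'I_d -> R) -> \bar R) g v :
  lint [seq (v, j) | j <- t] f g
  = lint t (fun y => f (glue g v y)) (fun j => g (v, j)).
Proof.
elim: t g => [|j t IH] g /=.
  congr f; apply/funext => -[w i]; rewrite /glue /=.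
  by case: eqP => // ->.
apply: eq_integral => z _; rewrite IH.
have -> : (fun i => upd g (v, j) z (v, i)) = upd (fun i => g (v, i)) j z.
  by apply/funext => i; rewrite /upd xpair_eqE eqxx.
apply: eq_lint => y; congr f; apply/funext => -[w i]; rewrite /glue /upd /=.
by case: (eqVneq w v) => // wv; rewrite xpair_eqE (negbTE wv).
Qed.

Lemma lint_block s (f : (W * 'I_d -> R) -> \bar R) g v :
  uniq s -> (forall j, (v, j) \in s) -> (forall g, 0 <= f g) -> coord_measurable f ->
  lint s f g = lint [seq z <- s | z.1 != v]
    (fun g => lint (enum 'I_d) (fun y => f (glue g v y)) (fun j => g (v, j))) g.
Proof.
move=> us vs f0 mf.
have ps : perm_eq s ([seq z <- s | z.1 != v] ++ [seq (v, j) | j <- enum 'I_d]).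
  apply: uniq_perm => //.
    rewrite cat_uniq filter_uniq //= map_inj_uniq ?enum_uniq ?andbT => [|i j [//]].
    by apply/hasPn => z /mapP[j _ ->]; rewrite mem_filter eqxx.
  move=> [w j]; rewrite mem_cat mem_filter /=; case: (eqVneq w v) => [->|wv] /=.
    by rewrite vs; apply/esym/mapP; exists j => //; rewrite mem_enum.
  rewrite [X in _ || X](_ : _ = false) ?orbF //.
  by apply/mapP => -[i _ [wv' _]]; rewrite wv' eqxx in wv.
rewrite (lint_perm _ f0 mf us ps) lint_cat; apply: eq_lint => h; exact: lint_glue.
Qed.

End BlockIntegral.

Section ProcessIntegral.
Variables (R : realType) (W : finType) (adj : rel W) (d : nat) (p : W -> 'I_#|W|).
Hypothesis pinj : injective p.
Implicit Types (a : W -> 'rV[R]_d) (g : W * 'I_d -> R) (v : W).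
Local Notation sproc := (sproc adj p).
Local Notation xp_mx := (xp_mx adj p).
Variables (e : R) (H : (W -> 'rV[R]_d) -> \bar R).
Hypothesis e0 : (0 < e)%R.
Hypothesis H0 : forall a, 0 <= H a.
Hypothesis mH : cfg_measurable H.

Definition vertex_kernel a v : R := (\prod_(i < dp adj p v) gker e (dot (a v) (a (enum_val i))))%R.

(* Interpolates between the weight of the process and a product of kernels: the
   vertices are switched one at a time, the last one in the ordering first. *)
Definition hybrid k a : R :=
  (\prod_v (if (p v < k)%N then (Dmx e (xp_mx a v))^-1 else vertex_kernel a v))%R.

(** The first [k] steps read only vertices whose position is less than [k]. *)
Lemma sproc_upd k a v x : (k <= p v)%N ->
  sproc e k (upd a v x) = upd (sproc e k a) v x.
Proof.
elim: k => //= k IH kv; apply/funext => w; rewrite /upd.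
rewrite (IH (ltnW kv)); case: (eqVneq (p w : nat) k) => [wk|//].
have wv : w != v by apply/eqP => wv; rewrite -wv wk ltnn in kv.
rewrite (negbTE wv); congr (_ *m Tmx _ _); apply: eq_xp_mx => u uw.
by rewrite /upd; case: eqP => // uv; move: uw; rewrite uv wk ltnNge ltnW.
Qed.

Lemma sproc_step k a v x : (p v : nat) = k ->
  sproc e k.+1 (upd a v x)
  = upd (sproc e k a) v (x *m Tmx e (xp_mx (sproc e k a) v)).
Proof.
move=> pv /=; rewrite sproc_upd ?pv //; apply/funext => w; rewrite /upd.
case: (eqVneq w v) => [->|wv].
  rewrite pv !eqxx; congr (_ *m Tmx _ _); apply: eq_xp_mx => u uv.
  by case: eqP => // uv'; rewrite uv' ltnn in uv.
case: eqP => // pw; case/eqP: wv; apply: pinj; apply: val_inj; rewrite /= pw; exact/esym.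
Qed.

Lemma vertex_kernel_ge0 a v : (0 <= vertex_kernel a v)%R.
Proof. by apply: prodr_ge0 => i _; exact: gker_ge0. Qed.

Lemma hybrid_ge0 k a : (0 <= hybrid k a)%R.
Proof.
by apply: prodr_ge0 => v _; case: ifP => _; rewrite ?vertex_kernel_ge0 // invr_ge0 Dmx_ge0.
Qed.

Lemma measurable_hybrid disp (T : measurableType disp) k (h : W -> T -> 'rV[R]_d) :
  (forall v j, measurable_fun [set: T] (fun x => h v x ord0 j)) ->
  measurable_fun [set: T] (fun x => hybrid k (fun v => h v x)).
Proof.
move=> mh; apply: measurable_prodP => v _; case: (p v < k)%N.
  apply: measurable_inv_ge0 => [x|]; first exact: Dmx_ge0.
  apply: (measurable_Tmx_Dmx (ltW e0) _).2 => i j.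
  by under eq_fun do rewrite mxE; exact: mh.
apply: measurable_prodP => i _; apply: measurable_gker.
by apply: measurable_dot => j; exact: mh.
Qed.

Definition ginteg k a : \bar R :=
  ((\prod_v gdens (a v)) * hybrid k (sproc e k a))%:E * H (sproc e k a).

Lemma ginteg_ge0 k a : 0 <= ginteg k a.
Proof.
rewrite /ginteg mule_ge0 // lee_fin mulr_ge0 ?hybrid_ge0 //.
by apply: prodr_ge0 => v _; exact: expR_ge0.
Qed.

Lemma measurable_ginteg k : cfg_measurable (ginteg k).
Proof.
move=> disp T h mh; have ms := @measurable_sproc R W adj d p _ T e k h (ltW e0) mh.
apply: emeasurable_funM; last exact: (mH (h := fun v x => sproc e k (fun v => h v x) v)).
apply/measurable_EFinP; apply: measurable_funM.
  by apply: measurable_prodP => v _; exact: measurable_gdens.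
exact: (measurable_hybrid k (h := fun v x => sproc e k (fun v => h v x) v)).
Qed.

Lemma upd_row_measurable (F : (W -> 'rV[R]_d) -> \bar R) a v : cfg_measurable F ->
  row_measurable (fun x => F (upd a v x)).
Proof.
move=> mF disp T h mh; apply: (mF _ _ (fun w t => upd a v (h t) w)) => w j.
by rewrite /upd; case: eqP.
Qed.

(** Only the Gaussian vector of the vertex [v] in position [k] is integrated. Apart from its own
    density and weight, the integrand depends on it through the processed vector at [v], including
    the kernels of later neighbours, so that [gauss_Tmx] applies with this dependence as [F]. *)
Lemma ginteg_step k (s : seq (W * 'I_d)) g : (k < #|W|)%N -> uniq s -> (forall z, z \in s) ->
  lint s (fun g => ginteg k.+1 (cfg g)) g = lint s (fun g => ginteg k (cfg g)) g.
Proof.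
move=> kW us sT.
have [v pv] : exists v, (p v : nat) = k.
  have [q qK pK] : bijective p by apply: inj_card_bij => //; rewrite card_ord.
  by exists (q (Ordinal kW)); rewrite pK.
have sv j : (v, j) \in s by [].
rewrite !(lint_block _ us sv); last 4 first.
- by move=> ?; exact: ginteg_ge0.
- by apply: coord_measurable_cfg; exact: measurable_ginteg.
- by move=> ?; exact: ginteg_ge0.
- by apply: coord_measurable_cfg; exact: measurable_ginteg.
apply: eq_lint => h; set a := cfg h; set b := sproc e k a.
pose c := (\prod_(w | w != v) gdens (a w))%R.
pose psi a := (\prod_(w | w != v)
  (if (p w < k)%N then (Dmx e (xp_mx a w))^-1 else vertex_kernel a w))%R.
pose F x := (c * psi (upd b v x))%:E * H (upd b v x).
have c0 : (0 <= c)%R by apply: prodr_ge0 => w _; exact: expR_ge0.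
have F0 x : 0 <= F x.
  rewrite /F mule_ge0 // lee_fin mulr_ge0 //; apply: prodr_ge0 => w _.
  by case: ifP => _; rewrite ?vertex_kernel_ge0 // invr_ge0 Dmx_ge0.
have mF : row_measurable F.
  apply: (upd_row_measurable (F := fun a => (c * psi a)%:E * H a)) => disp T h' mh.
  apply: emeasurable_funM; last exact: mH.
  apply/measurable_EFinP; apply: measurable_funM => //.
  apply: measurable_prodP => w _; case: (p w < k)%N.
    apply: measurable_inv_ge0 => [x|]; first exact: Dmx_ge0.
    apply: (measurable_Tmx_Dmx (ltW e0) _).2 => i j.
    by under eq_fun do rewrite mxE; exact: mh.
  apply: measurable_prodP => i _; apply: measurable_gker.
  by apply: measurable_dot => j; exact: mh.
have gE x : (\prod_w gdens (upd a v x w) = gdens x * c)%R.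
  rewrite (bigD1 v) //= upd_eq; congr (_ * _)%R; apply: eq_bigr => w wv.
  by rewrite /upd (negbTE wv).
have xv x : xp_mx (upd b v x) v = xp_mx b v.
  apply: eq_xp_mx => w wv; rewrite /upd; case: eqP => // wv'.
  by rewrite wv' ltnn in wv.
transitivity (lint (enum 'I_d) (fun y => (gdens (rowv y) / Dmx e (xp_mx b v))%:E *
    F (rowv y *m Tmx e (xp_mx b v))) (fun j => h (v, j))).
  apply: eq_lint => y; rewrite cfg_glue /ginteg sproc_step // -/b gE /F.
  rewrite muleA -EFinM; congr (_%:E * _).
  rewrite /hybrid (bigD1 v) //= pv ltnSn xv.
  set x := upd b v _.
  have -> : (\prod_(i | i != v)
      (if (p i < k.+1)%N then (Dmx e (xp_mx x i))^-1 else vertex_kernel x i)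
     = psi x)%R.
    apply: eq_bigr => w wv; rewrite ltnS leq_eqVlt.
    rewrite (_ : (p w == k :> nat) = false) //; apply/eqP => pw.
    by case/eqP: wv; apply: pinj; apply: val_inj; rewrite /= pw pv.
  by ring.
rewrite gauss_Tmx //; apply: eq_lint => y.
rewrite cfg_glue /ginteg sproc_upd ?pv // -/b gE /F.
rewrite muleA -EFinM; congr (_%:E * _).
rewrite /hybrid (bigD1 v) //= pv ltnn -/(psi _).
suff -> : vertex_kernel (upd b v (rowv y)) v =
    (\prod_(i < dp adj p v) gker e (dot (rowv y) (row i (xp_mx b v))))%R by ring.
apply: eq_bigr => i _; rewrite xp_mx_row upd_eq /upd.
case: eqP => // iv; have := Np_lt i; by rewrite iv ltnn.
Qed.

Lemma ginteg_process (s : seq (W * 'I_d)) g : uniq s -> (forall z, z \in s) ->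
  lint s (fun g => ginteg #|W| (cfg g)) g = lint s (fun g => ginteg 0 (cfg g)) g.
Proof.
move=> us sT; have : (#|W| <= #|W|)%N by [].
elim: {-2}#|W| => // k IH kW.
by rewrite ginteg_step // IH // ltnW.
Qed.

End ProcessIntegral.

(** * The limit as the regularisation tends to 0 *)

Section Limits.
Local Open Scope ring_scope.
Variables (R : realType) (d : nat).
Variable ee : nat -> R.
Hypothesis ee01 : forall n, 0 <= ee n <= 1.
Hypothesis ee_cvg : ee n @[n --> \oo] --> (0 : R).

Lemma cvg_sumP (J : Type) (r : seq J) (P : pred J) (u : J -> nat -> R) (l : J -> R) :
  (forall j, P j -> u j n @[n --> \oo] --> l j) ->
  (\sum_(j <- r | P j) u j n) @[n --> \oo] --> \sum_(j <- r | P j) l j.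
Proof.
move=> ul; elim: r => [|j r IH].
  by rewrite big_nil; under eq_fun do rewrite big_nil; exact: cvg_cst.
rewrite big_cons; under eq_fun do rewrite big_cons; case Pj: (P j) => //.
by apply: (@cvgD _ R^o) => //; exact: ul.
Qed.

Lemma cvg_prodP (J : Type) (r : seq J) (P : pred J) (u : J -> nat -> R) (l : J -> R) :
  (forall j, P j -> u j n @[n --> \oo] --> l j) ->
  (\prod_(j <- r | P j) u j n) @[n --> \oo] --> \prod_(j <- r | P j) l j.
Proof.
move=> ul; elim: r => [|j r IH].
  by rewrite big_nil; under eq_fun do rewrite big_nil; exact: cvg_cst.
rewrite big_cons; under eq_fun do rewrite big_cons; case Pj: (P j) => //.
by apply: cvgM => //; exact: ul.
Qed.

Lemma cvg_dot (u v : nat -> 'rV[R]_d) (x y : 'rV[R]_d) :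
  (forall j, u n ord0 j @[n --> \oo] --> x ord0 j) ->
  (forall j, v n ord0 j @[n --> \oo] --> y ord0 j) ->
  dot (u n) (v n) @[n --> \oo] --> dot x y.
Proof. by move=> ux vy; apply: cvg_sumP => j _; apply: cvgM. Qed.

Lemma cvg_qn (u : nat -> 'rV[R]_d) (x : 'rV[R]_d) :
  (forall j, u n ord0 j @[n --> \oo] --> x ord0 j) ->
  qn (ee n) (u n) @[n --> \oo] --> qn 0 x.
Proof.
move=> ux.
have S : ee n ^+ 2 + dot (u n) (u n) @[n --> \oo] --> (0 : R) ^+ 2 + dot x x.
  apply: (@cvgD _ R^o); last exact: cvg_dot.
  by under eq_fun do rewrite expr2; rewrite expr2; apply: cvgM.
apply: (cvg_comp _ _ S); exact: sqrt_continuous.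
Qed.

Lemma cvg_mulmx_entry m k l (A : nat -> 'M[R]_(m, k)) (B : nat -> 'M[R]_(k, l))
    (A0 : 'M[R]_(m, k)) (B0 : 'M[R]_(k, l)) :
  (forall i j, A n i j @[n --> \oo] --> A0 i j) ->
  (forall i j, B n i j @[n --> \oo] --> B0 i j) ->
  forall i j, (A n *m B n) i j @[n --> \oo] --> (A0 *m B0) i j.
Proof.
move=> AA BB i j; rewrite mxE; under eq_fun do rewrite mxE.
by apply: cvg_sumP => h _; apply: cvgM.
Qed.

(** [Bmx e u] is discontinuous at e = 0, u = 0, hence the condition on the determinant for [Tmx].
    The convergence of [Dmx] needs no condition: if the determinant of the later rows vanishes in
    the limit, the remaining factor [qn] stays bounded and the product still tends to 0. *)
Lemma cvg_Tmx_Dmx k (Y : nat -> 'M[R]_(k, d)) (Z : 'M[R]_(k, d)) :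
  (forall i j, Y n i j @[n --> \oo] --> Z i j) ->
  (Dmx (ee n) (Y n) @[n --> \oo] --> Dmx 0 Z) /\
  (Dmx 0 Z != 0 -> forall i j, Tmx (ee n) (Y n) i j @[n --> \oo] --> Tmx 0 Z i j).
Proof.
elim: k Y Z => [|k IH] Y Z YZ /=.
  by split => [|_ i j]; exact: cvg_cst.
have [i j|DY TY] := IH (fun n => row' ord0 (Y n)) (row' ord0 Z).
  by rewrite mxE; under eq_fun do rewrite mxE; exact: YZ.
have rY j : (row ord0 (Y n)) ord0 j @[n --> \oo] --> (row ord0 Z) ord0 j.
  by rewrite mxE; under eq_fun do rewrite mxE; exact: YZ.
have [D0|D0] := eqVneq (Dmx 0 (row' ord0 Z)) 0.
  rewrite D0 mulr0 eqxx; split => //.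
  rewrite D0 in DY.
  have B : (1 + dot (row ord0 (Y n)) (row ord0 (Y n))) * Dmx (ee n) (row' ord0 (Y n))
      @[n --> \oo] --> (0 : R).
    rewrite -[X in _ --> X](mulr0 (1 + dot (row ord0 Z) (row ord0 Z))).
    by apply: cvgM => //; apply: (@cvgD _ R^o); [exact: cvg_cst|exact: cvg_dot].
  apply: (squeeze_cvgr (f := fun=> 0) _ _ B); last exact: cvg_cst.
  apply: nearW => n; rewrite mulr_ge0 ?qn_ge0 ?Dmx_ge0 //=.
  by rewrite ler_wpM2r ?Dmx_ge0 // qn_Tmx_tr_le.
have {}TY := TY D0.
pose u n := row ord0 (Y n) *m (Tmx (ee n) (row' ord0 (Y n)))^T.
pose w := row ord0 Z *m (Tmx 0 (row' ord0 Z))^T.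
have uw i j : u n i j @[n --> \oo] --> w i j.
  rewrite /u /w; apply: cvg_mulmx_entry => {}i {}j; first by rewrite ord1.
  by rewrite mxE; under eq_fun do rewrite mxE; exact: TY.
have quw := cvg_qn (uw ord0).
split; first by apply: cvgM.
rewrite mulf_eq0 negb_or => /andP[q0 _]; apply: cvg_mulmx_entry => // i j.
rewrite Bmx_entry; under eq_fun do rewrite Bmx_entry.
apply: (@cvgB _ R^o); first exact: cvg_cst.
apply: cvgM; last by apply: cvgM; exact: uw.
apply: cvgV; first by rewrite addr0 mulf_neq0.
by apply: cvgM => //; apply: (@cvgD _ R^o).
Qed.

End Limits.

Section ProcessLimit.
Local Open Scope ring_scope.
Variables (R : realType) (W : finType) (adj : rel W) (d : nat) (p : W -> 'I_#|W|).
Implicit Types (a : W -> 'rV[R]_d) (v w : W).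
Local Notation sproc := (sproc adj p).
Local Notation xp_mx := (xp_mx adj p).
Variable ee : nat -> R.
Hypothesis ee01 : forall n, 0 <= ee n <= 1.
Hypothesis ee_cvg : ee n @[n --> \oo] --> (0 : R).

Lemma sproc_stable e a v k l : (p v < k)%N -> (k <= l)%N -> sproc e l a v = sproc e k a v.
Proof.
move=> vk; elim: l => [|l IH]; first by rewrite leqn0 => /eqP ->.
rewrite leq_eqVlt => /predU1P[-> //|]; rewrite ltnS => kl /=.
by rewrite (ltn_eqF (leq_trans vk kl)) IH.
Qed.

Lemma sproc_final e a v k : (p v <= k)%N -> (k <= #|W|)%N ->
  xp_mx (sproc e #|W| a) v = xp_mx (sproc e k a) v.
Proof.
move=> vk kW; apply: eq_xp_mx => w wv; apply: sproc_stable => //.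
exact: leq_trans vk.
Qed.

Lemma dot_sproc_le e k a v : 0 <= e -> dot (sproc e k a v) (sproc e k a v) <= dot (a v) (a v).
Proof.
move=> e0; elim: k => //= k IH; case: ((p v : nat) == k) => //.
exact: dot_Tmx_le.
Qed.

Lemma cvg_sproc a k : (k <= #|W|)%N ->
  (forall v, (p v < k)%N -> Dmx 0 (xp_mx (sproc 0 #|W| a) v) != 0) ->
  forall v j, sproc (ee n) k a v ord0 j @[n --> \oo] --> sproc 0 k a v ord0 j.
Proof.
elim: k => [|k IH] kW good v j /=; first exact: cvg_cst.
have {}IH : forall v j, sproc (ee n) k a v ord0 j @[n --> \oo] --> sproc 0 k a v ord0 j.
  by apply: IH => [|w wk]; [exact: ltnW|apply: good; exact: ltnW].
case: eqP => [pv|_]; last exact: IH.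
apply: (cvg_mulmx_entry (A := fun=> a v)) => [i l|]; first exact: cvg_cst.
apply: (cvg_Tmx_Dmx ee01 ee_cvg _).2 => [i l|].
  by rewrite mxE; under eq_fun do rewrite mxE; exact: IH.
by rewrite -(sproc_final 0 a (v := v)) ?pv ?good ?pv // ltnW.
Qed.

Lemma cvg_Dmx_sproc a v :
  (forall w, (p w < p v)%N -> Dmx 0 (xp_mx (sproc 0 #|W| a) w) != 0) ->
  Dmx (ee n) (xp_mx (sproc (ee n) #|W| a) v) @[n --> \oo]
    --> Dmx 0 (xp_mx (sproc 0 #|W| a) v).
Proof.
move=> good; have vW : (p v <= #|W|)%N by exact: ltnW.
rewrite (sproc_final 0 a (leqnn _) vW); under eq_fun do rewrite (sproc_final _ a (leqnn _) vW).
apply: (cvg_Tmx_Dmx ee01 ee_cvg _).1 => i j.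
rewrite mxE; under eq_fun do rewrite mxE.
exact: cvg_sproc.
Qed.

Lemma Dmx_sproc_le e a v : 0 <= e <= 1 ->
  Dmx e (xp_mx (sproc e #|W| a) v) <=
  \prod_(i < dp adj p v) (1 + dot (a (enum_val i)) (a (enum_val i))).
Proof.
move=> e01; apply: le_trans (Dmx_le _ e01) _; apply: ler_prod => i _.
rewrite addr_ge0 ?dot_ge0 //= lerD2l xp_mx_row dot_sproc_le //.
by case/andP: e01.
Qed.

Lemma cvg_prod_Dmx a :
  (exists v, Dmx 0 (xp_mx (sproc 0 #|W| a) v) = 0) ->
  (\prod_v Dmx (ee n) (xp_mx (sproc (ee n) #|W| a) v)) @[n --> \oo] --> (0 : R).
Proof.
case=> v0 /eqP bad0.
(* Take the first degenerate vertex in the ordering. Up to it the process converges, so its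
   determinant tends to 0; for the other vertices the bounds of [Dmx_sproc_le] suffice. *)
case: (arg_minnP (P := fun v => Dmx 0 (xp_mx (sproc 0 #|W| a) v) == 0) p bad0) => v bad vmin.
have Dv : Dmx (ee n) (xp_mx (sproc (ee n) #|W| a) v) @[n --> \oo] --> (0 : R).
  rewrite -(eqP bad); apply: cvg_Dmx_sproc => w; apply: contraTneq => Dw.
  by rewrite -leqNgt vmin // Dw.
pose B w := \prod_(i < dp adj p w) (1 + dot (a (enum_val i)) (a (enum_val i))).
have DB : Dmx (ee n) (xp_mx (sproc (ee n) #|W| a) v) * (\prod_(w | w != v) B w)
    @[n --> \oo] --> (0 : R).
  rewrite -[X in _ --> X](mul0r (\prod_(w | w != v) B w)).
  by apply: cvgM => //; exact: cvg_cst.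
apply: (squeeze_cvgr (f := fun=> 0) _ _ DB); last exact: cvg_cst.
apply: nearW => n; rewrite prodr_ge0 /= => [|w _]; last exact: Dmx_ge0.
rewrite (bigD1 v) //= ler_wpM2l ?Dmx_ge0 //; apply: ler_prod => w _.
by rewrite Dmx_ge0 Dmx_sproc_le.
Qed.

End ProcessLimit.

Section ExactProcess.
Local Open Scope ring_scope.
Variables (R : realType) (W : finType) (adj : rel W) (d : nat) (p : W -> 'I_#|W|).
Implicit Types (g : W * 'I_d -> R) (v w : W).
Local Notation sproc := (sproc adj p).
Local Notation xp_mx := (xp_mx adj p).

Lemma enormE (y : 'rV[R]_d) : enorm y = Num.sqrt (dot y y).
Proof. by []. Qed.

Lemma enorm_eq0 (y : 'rV[R]_d) : (enorm y == 0) = (y == 0).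
Proof. by rewrite enormE sqrtr_eq0 -dot_eq0 eq_le dot_ge0 andbT. Qed.

Lemma normalizeK (y : 'rV[R]_d) : y = enorm y *: normalize y.
Proof.
rewrite /normalize; case: eqP => [/eqP|/eqP y0].
  by rewrite enorm_eq0 => /eqP ->; rewrite scaler0.
by rewrite scalerA divff // scale1r.
Qed.

Lemma normalize_eqmx k (X Y : 'M[R]_(k, d)) :
  (forall i, row i X = normalize (row i Y)) -> (X :=: Y)%MS.
Proof.
move=> XY; apply/eqmxP/andP; split; apply/row_subP => i.
  rewrite XY /normalize; case: eqP => _; first exact: sub0mx.
  by rewrite scalemx_sub // row_sub.
by rewrite (normalizeK (row i Y)) -XY scalemx_sub // row_sub.
Qed.

(** Normalising the earlier points, a zero vector included, preserves the space that they span,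
    hence the projection applied at [v]. *)
Lemma rso_procE g k v : (p v < k)%N ->
  rso_proc adj p k g v = normalize (sproc 0 k (cfg g) v).
Proof.
elim: k v => // k IH v; rewrite ltnS => vk /=.
case: eqP => [pv|/eqP pv]; last by apply: IH; rewrite ltn_neqAle pv.
rewrite /rso_step; congr (normalize (_ *m _)); apply: orth_projE.
apply: normalize_eqmx => i; rewrite !xp_mx_row IH // -pv.
exact: Np_lt.
Qed.

Lemma enorm_le (y : 'rV[R]_d) : enorm y <= 1 + dot y y.
Proof.
have y0 := dot_ge0 y; rewrite enormE -(@ler_pXn2r _ 2) ?nnegrE ?sqrtr_ge0 ?addr_ge0 //.
rewrite sqr_sqrtr // sqrrD expr1n mul1r addrAC -[leLHS]addr0 addrC.
by rewrite lerD ?addr_ge0 ?sqr_ge0 // mulr2n lerDl.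
Qed.

Lemma Det_rso g v (b := sproc 0 #|W| (cfg g)) :
  Dmx 0 (xp_mx b v) = (\prod_(i < dp adj p v) enorm (b (enum_val i)))
                      * Det (xp_mx (rso adj p g) v).
Proof.
rewrite -DetE /Det (@det_gram_scale _ _ _ (xp_mx (rso adj p g) v) _
  (fun i => enorm (b (enum_val i)))) => [|i]; last first.
  by rewrite !xp_mx_row /rso rso_procE // -normalizeK.
rewrite sqrtrM ?sqr_ge0 // sqrtr_sqr ger0_norm //.
by apply: prodr_ge0 => i _; exact: sqrtr_ge0.
Qed.

(** A polynomial bound for the norm that is at least 1, so that products of it may be enlarged by
    further factors. *)
Definition rho (x : 'rV[R]_d) : R := 1 + dot x x.

Lemma rho_ge1 x : 1 <= rho x.
Proof. by rewrite lerDl dot_ge0. Qed.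

Lemma inv_Det_le g v (b := sproc 0 #|W| (cfg g)) : Dmx 0 (xp_mx b v) != 0 ->
  (Det (xp_mx (rso adj p g) v))^-1 <= (\prod_w rho (b w)) * (Dmx 0 (xp_mx b v))^-1.
Proof.
move=> D0; have := Det_rso g v; rewrite -/b => DE.
have Dpos : 0 < Dmx 0 (xp_mx b v) by rewrite lt_neqAle eq_sym D0 Dmx_ge0.
have Dn : Det (xp_mx (rso adj p g) v) != 0.
  by apply: contraNneq D0 => D00; rewrite DE D00 mulr0.
have Dp : 0 < Det (xp_mx (rso adj p g) v) by rewrite lt_neqAle eq_sym Dn sqrtr_ge0.
rewrite ler_pdivlMr // mulrC ler_pdivrMr // DE ler_wpM2r ?(ltW Dp) //.
have -> : \prod_w rho (b w) = (\prod_(w in Np adj p v) rho (b w)) *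
    (\prod_(w | w \notin Np adj p v) rho (b w)) by rewrite (bigID (mem (Np adj p v))).
rewrite -[leLHS]mulr1 ler_pM //.
- by apply: prodr_ge0 => i _; exact: sqrtr_ge0.
- rewrite [leRHS]big_enum_val; apply: ler_prod => i _.
  by rewrite sqrtr_ge0 enorm_le.
- elim/big_ind: _ => // [x y x1 y1|w _]; last exact: rho_ge1.
  by rewrite -[leLHS]mulr1 ler_pM.
Qed.

Lemma sphere_area_gt0 k : 0 < sphere_area R k.
Proof.
elim: k {-2}k (leqnn k) => [|m IH] [|[|k]] km //=; rewrite ?mulr_gt0 ?pi_gt0 //.
by apply: IH; rewrite -ltnS; apply: ltn_trans km.
Qed.

End ExactProcess.

Section PointwiseLimit.
Variables (R : realType) (W : finType) (adj : rel W) (d : nat) (p : W -> 'I_#|W|).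
Implicit Types (g : W * 'I_d -> R) (v w : W).
Local Notation sproc := (sproc adj p).
Local Notation xp_mx := (xp_mx adj p).
Variable ee : nat -> R.
Hypothesis ee01 : forall n, (0 <= ee n <= 1)%R.
Hypothesis ee_gt0 : forall n, (0 < ee n)%R.
Hypothesis ee_cvg : ee n @[n --> \oo] --> (0 : R)%R.

Definition tconst : R :=
  ((sphere_area R d.-1 ^ ((nedges adj)%:Z - (#|W|)%:Z)%R
    / sphere_area R d.-2 ^+ nedges adj) * \prod_v sphere_area R (d - dp adj p v).-1)%R.

Lemma tconst_gt0 : (0 < tconst)%R.
Proof.
rewrite /tconst !mulr_gt0 ?invr_gt0 ?exprn_gt0 ?exprz_gt0 ?sphere_area_gt0 //.
by apply: prodr_gt0 => v _; exact: sphere_area_gt0.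
Qed.

(** The exponent counts the vertices: [inv_Det_le] uses one full product of [rho] for the
    determinant at each of them. *)
Definition rhoprod (a : W -> 'rV[R]_d) : R := (\prod_w rho (a w) ^+ #|W|)%R.

Lemma rhoprod_ge1 a : (1 <= rhoprod a)%R.
Proof.
rewrite /rhoprod; elim/big_ind: _ => // [x y x1 y1|w _]; last exact/exprn_ege1/rho_ge1.
by rewrite -[leLHS]mulr1 ler_pM.
Qed.

Definition treg e (a : W -> 'rV[R]_d) : R :=
  (tconst * ((\prod_v Dmx e (xp_mx (sproc e #|W| a) v))^-1 * rhoprod (sproc e #|W| a)))%R.

(* The factor [rhoprod], which bounds the norms lost by normalising, makes the
   regularised integrand tend to +oo where a Gram determinant vanishes and
   dominate the integrand elsewhere. *)
Lemma t_integrand_cvg g : exists2 l,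
  (treg (ee n) (cfg g))%:E @[n --> \oo] --> l &
  t_integrand adj p (rso adj p g) <= l.
Proof.
set a := cfg g; have [bad|good] := pselect (exists v, Dmx 0 (xp_mx (sproc 0 #|W| a) v) = 0%R).
  exists +oo; last exact: leey.
  apply/cvgeryP.
  pose u n := (\prod_v Dmx (ee n) (xp_mx (sproc (ee n) #|W| a) v))%R.
  have u0 n : (0 < u n)%R by apply: prodr_gt0 => v _; exact: Dmx_gt0.
  have uy : ((u n)^-1)%R @[n --> \oo] --> +oo%R.
    apply/gtr0_cvgV0; first by apply: nearW => n; rewrite invr_gt0.
    by rewrite inv_funK; exact: cvg_prod_Dmx.
  apply/cvgryPge => A; move/cvgryPge: uy => /(_ (A / tconst)%R); apply: filterS => n.
  rewrite ler_pdivrMr ?tconst_gt0 // mulrC => An.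
  rewrite (le_trans An) // ler_wpM2l ?(ltW tconst_gt0) // -[leLHS]mulr1.
  by rewrite ler_wpM2l ?rhoprod_ge1 // invr_ge0 ltW.
have {}good v : Dmx 0 (xp_mx (sproc 0 #|W| a) v) != 0%R.
  by apply/eqP => D0; apply: good; exists v.
exists (treg 0 a)%:E.
  apply: cvg_EFin; first exact: nearW.
  apply: cvgM; first exact: cvg_cst.
  apply: cvgM.
    apply: cvgV; first by apply/prodf_neq0 => v _; exact: good.
    by apply: cvg_prodP => v _; apply: cvg_Dmx_sproc.
  apply: cvg_prodP => v _.
  have rv : rho (sproc (ee n) #|W| a v) @[n --> \oo] --> rho (sproc 0 #|W| a v).
    apply: (@cvgD _ R^o); first exact: cvg_cst.
    by apply: cvg_dot => j; apply: cvg_sproc.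
  suff powk k : (rho (sproc (ee n) #|W| a v) ^+ k)%R @[n --> \oo]
      --> (rho (sproc 0 #|W| a v) ^+ k)%R by exact: powk.
  elim: k => [|k IH]; first by rewrite expr0; under eq_fun do rewrite expr0; exact: cvg_cst.
  by rewrite exprS; under eq_fun do rewrite exprS; apply: cvgM.
rewrite /t_integrand.
have Dn v : Det (xp_mx (rso adj p g) v) != 0%R.
  apply: contraNneq (good v) => D0; have := Det_rso adj p g v; rewrite -/a => ->.
  by rewrite D0 mulr0.
under eq_bigr do rewrite /einv (negbTE (Dn _)) -EFinM.
rewrite prodEFin -EFinM lee_fin /treg /tconst -[leRHS]mulrA ler_wpM2l //.
  by rewrite !mulr_ge0 ?invr_ge0 ?exprn_ge0 ?exprz_ge0 // ltW // sphere_area_gt0.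
rewrite big_split /= ler_wpM2l //.
  by apply: prodr_ge0 => v _; rewrite ltW // sphere_area_gt0.
have -> : rhoprod (sproc 0 #|W| a) = (\prod_(v : W) \prod_w rho (sproc 0 #|W| a w))%R.
  by rewrite prodr_const -prodrXl.
rewrite -prodfV -big_split /=; apply: ler_prod => v _.
by rewrite invr_ge0 sqrtr_ge0 /= mulrC inv_Det_le.
Qed.

End PointwiseLimit.

Section GaussianIntegral.
Variables (R : realType) (W : finType) (adj : rel W) (d : nat) (p : W -> 'I_#|W|).
Implicit Types (g : W * 'I_d -> R) (s : seq (W * 'I_d)).
Local Notation mu := (@lebesgue_measure R).

(* The integral of a nonnegative function is a supremum over the simple functions
   below it, so no measurability is needed; none is known for [rso]. *)
Lemma ge0_le_integral_nonmeas (f1 f2 : R -> \bar R) :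
  (forall z, 0 <= f1 z) -> (forall z, f1 z <= f2 z) ->
  \int[mu]_z f1 z <= \int[mu]_z f2 z.
Proof.
move=> f10 f12; have f20 z : 0 <= f2 z by exact: le_trans (f12 z).
rewrite !ge0_integralTE //; apply: ereal_sup_le => _ [h hf1 <-].
by exists h => // z; apply: le_trans (f12 z).
Qed.

Lemma gauss_iint_ge0 s f g : (forall g, 0 <= f g) -> 0 <= gauss_iint s f g :> \bar R.
Proof.
move=> f0; elim: s g => //= i s IH g; apply: integral_ge0 => z _.
by rewrite mule_ge0 // lee_fin normal_pdf_ge0.
Qed.

Lemma le_gauss_iint s f1 f2 g : (forall g, 0 <= f1 g) -> (forall g, f1 g <= f2 g) ->
  gauss_iint s f1 g <= gauss_iint s f2 g :> \bar R.
Proof.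
move=> f10 f12; elim: s g => //= i s IH g; apply: ge0_le_integral_nonmeas => z.
  by rewrite mule_ge0 ?lee_fin ?normal_pdf_ge0 ?gauss_iint_ge0.
by apply: lee_wpmul2l; rewrite ?lee_fin ?normal_pdf_ge0.
Qed.

Definition pdfs s g : R := (\prod_(i <- s) normal_pdf 0 1 (g i))%R.

Lemma pdfs_ge0 s g : (0 <= pdfs s g)%R.
Proof. by apply: prodr_ge0 => i _; exact: normal_pdf_ge0. Qed.

Lemma measurable_pdfs s : coord_measurable (fun g => (pdfs s g)%:E).
Proof.
move=> disp T h mh; apply/measurable_EFinP; apply: measurable_prodP => i _.
exact: measurableT_comp (measurable_normal_pdf _ _) (mh i).
Qed.

Lemma gauss_iintE s f g : uniq s -> (forall g, 0 <= f g) -> coord_measurable f ->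
  gauss_iint s f g = lint s (fun g => (pdfs s g)%:E * f g) g.
Proof.
move=> + f0 mf; elim: s g => [g _|i s IH g /= /andP[is_ us]] /=.
  by rewrite /pdfs big_nil mul1e.
have mpf : coord_measurable (fun g => (pdfs s g)%:E * f g).
  by apply: coord_measurableM => //; exact: measurable_pdfs.
apply: eq_integral => z _; rewrite -/(upd g i z) IH // -lintZl //; last 2 first.
- by rewrite lee_fin normal_pdf_ge0.
- by move=> h; rewrite mule_ge0 // lee_fin pdfs_ge0.
apply: lint_eq_const => h hg; rewrite muleA -EFinM /pdfs big_cons.
by rewrite (hg _ is_) upd_eq.
Qed.

Lemma pdfsE s g : uniq s -> (forall z, z \in s) ->
  pdfs s g = (normal_peak 1 ^+ size s * \prod_v gdens (cfg g v))%R.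
Proof.
move=> us sT.
have -> : (\prod_v gdens (cfg g v) = \prod_(z : W * 'I_d) expR (- (g z ^+ 2 / 2)))%R.
  transitivity (\prod_(z : W * 'I_d) expR (- (g (z.1, z.2) ^+ 2 / 2)))%R; last first.
    by apply: eq_bigr => -[v j].
  rewrite -(pair_bigA _ (fun v j => expR (- (g (v, j) ^+ 2 / 2)))) /=.
  apply: eq_bigr => v _; rewrite -expR_sum /gdens; congr expR.
  rewrite /dot mulr_suml -sumrN; apply: eq_bigr => j _.
  by rewrite mxE expr2.
have -> : (\prod_(z : W * 'I_d) expR (- (g z ^+ 2 / 2)) = \prod_(z <- s) expR (- (g z ^+ 2 / 2)))%R.
  by apply: perm_big; apply: uniq_perm => [|//|z]; rewrite ?index_enum_uniq // sT mem_index_enum.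
have -> : (normal_peak 1 ^+ size s = \prod_(z <- s) normal_peak 1 :> R)%R.
  by rewrite big_const_seq count_predT iter_mulr_1.
rewrite /pdfs -big_split /=; apply: eq_bigr => z _.
rewrite normal_pdfE ?oner_neq0 // /normal_fun subr0 expr1n mulNr.
by rewrite -[(1 *+ 2)%R]/(2%:R)%R.
Qed.

End GaussianIntegral.

Section FatouReduction.
Variables (R : realType) (W : finType) (adj : rel W) (d : nat) (p : W -> 'I_#|W|).
Hypothesis pinj : injective p.
Implicit Types (g : W * 'I_d -> R).

Lemma rhoprod_ge0 (a : W -> 'rV[R]_d) : (0 <= rhoprod a)%R.
Proof. exact: le_trans (rhoprod_ge1 a). Qed.

Lemma measurable_rhoprod : cfg_measurable (fun a : W -> 'rV[R]_d => (rhoprod a)%:E).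
Proof.
move=> disp T h mh; apply/measurable_EFinP; apply: measurable_prodP => v _.
apply: measurable_funX; apply: measurable_funD => //.
by apply: measurable_dot => j; exact: mh.
Qed.

(** The integrand of [tdens] is first replaced by the limit of the regularised integrands, which
    dominates it and is measurable as a limit of measurable functions; Fatou's lemma is applied to
    that limit. *)
Lemma tdens_lty (C : R) :
  (forall (s : seq (W * 'I_d)) (e : R), uniq s -> (forall z, z \in s) ->
     (0 < e <= 1)%R -> lint s
     (fun g => ((\prod_v gdens (cfg g v)) * (\prod_v vertex_kernel adj p e (cfg g) v)
                * rhoprod (cfg g))%:E) (fun=> 0%R) <= C%:E) ->
  tdens R adj d p < +oo.
Proof.
move=> HC; rewrite /tdens; set s := enum _.
have us : uniq s by exact: enum_uniq.
have sT z : z \in s by rewrite mem_enum inE.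
pose ee n : R := n.+1%:R^-1%R.
have ee0 n : (0 < ee n)%R by rewrite invr_gt0.
have ee1 n : (ee n <= 1)%R by rewrite invf_le1 // ler1n.
have ee01 n : (0 <= ee n <= 1)%R by rewrite ee1 (ltW (ee0 n)).
have ee_cvg : ee n @[n --> \oo] --> (0 : R)%R by exact: cvg_harmonic.
pose F n g := (treg adj p (ee n) (cfg g))%:E.
pose lim g := limn_einf (fun n => F n g).
have tregE n (a : W -> 'rV[R]_d) : treg adj p (ee n) a =
    (tconst R adj d p * (hybrid adj p (ee n) #|W| (sproc adj p (ee n) #|W| a)
     * rhoprod (sproc adj p (ee n) #|W| a)))%R.
  rewrite /treg; congr (_ * (_ * _))%R; rewrite -prodfV; apply: eq_bigr => v _.
  by rewrite ltn_ord.
have F0 n g : 0 <= F n g.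
  rewrite lee_fin tregE mulr_ge0 ?(ltW (tconst_gt0 _ _ _ _)) //.
  by rewrite mulr_ge0 ?rhoprod_ge0 ?hybrid_ge0.
have mF n : coord_measurable (F n).
  apply: (@coord_measurable_cfg R W d (fun a => (treg adj p (ee n) a)%:E)) => disp T h mh.
  have ms := @measurable_sproc R W adj d p _ T (ee n) #|W| h (ltW (ee0 n)) mh.
  under eq_fun do rewrite tregE.
  apply/measurable_EFinP; apply: measurable_funM => //; apply: measurable_funM.
    exact: (measurable_hybrid adj p (ee0 n) #|W|
      (h := fun v x => sproc adj p (ee n) #|W| (fun v => h v x) v)).
  have /measurable_EFinP := measurable_rhoprod
    (h := fun v x => sproc adj p (ee n) #|W| (fun v => h v x) v) ms.
  by [].
have lim_cvg g : F n g @[n --> \oo] --> lim g.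
  have [l Fl _] := @t_integrand_cvg R W adj d p ee ee01 ee0 ee_cvg g.
  by rewrite /lim (cvg_limn_einf_sup Fl).1.
have t_lim g : t_integrand adj p (rso adj p g) <= lim g.
  have [l Fl tl] := @t_integrand_cvg R W adj d p ee ee01 ee0 ee_cvg g.
  by rewrite /lim (cvg_limn_einf_sup Fl).1.
have t0 g : 0 <= t_integrand adj p (rso adj p g).
  rewrite /t_integrand mule_ge0 //.
    by rewrite lee_fin !mulr_ge0 ?invr_ge0 ?exprn_ge0 ?exprz_ge0 // ltW // sphere_area_gt0.
  apply: prode_ge0 => v _; rewrite mule_ge0 ?lee_fin ?(ltW (sphere_area_gt0 _ _)) //.
  by rewrite /einv; case: eqP => // _; rewrite lee_fin invr_ge0 sqrtr_ge0.
have lim0 g : 0 <= lim g by exact: le_trans (t_lim g).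
have mlim : coord_measurable lim.
  move=> disp T h mh; apply: (emeasurable_fun_cvg (fun n x => F n (fun i => h i x))) => //.
  by move=> n; exact: mF.
pose G n g := (pdfs s g)%:E * F n g.
apply: (@le_lt_trans _ _ (limn_einf (fun n => lint s (G n) (fun=> 0%R)))).
  apply: le_trans (le_gauss_iint s _ t0 t_lim) _.
  rewrite gauss_iintE //.
  apply: le_trans (lint_fatou s _ _ _); last 2 first.
  - by move=> n g; rewrite mule_ge0 // lee_fin pdfs_ge0.
  - by move=> n; apply: coord_measurableM => //; exact: measurable_pdfs.
  rewrite le_eqVlt; apply/predU1P; left; apply: eq_lint => g; apply/esym.
  have Gl : G n g @[n --> \oo] --> (pdfs s g)%:E * lim g by exact: cvgeZl.
  by rewrite (cvg_limn_einf_sup Gl).1.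
pose K := (normal_peak 1 ^+ size s * tconst R adj d p)%R.
have K0 : (0 <= K)%R by rewrite mulr_ge0 ?exprn_ge0 ?normal_peak_ge0 ?(ltW (tconst_gt0 _ _ _ _)).
apply: (@le_lt_trans _ _ (K * C)%:E); last exact: ltry.
have GK n : lint s (G n) (fun=> 0%R) <= (K * C)%:E.
  have -> : lint s (G n) (fun=> 0%R) = lint s (fun g => K%:E *
      ginteg adj p (ee n) (fun a => (rhoprod a)%:E) #|W| (cfg g)) (fun=> 0%R).
    apply: eq_lint => g; rewrite /G /F /ginteg tregE pdfsE // -!EFinM; congr (_%:E).
    by rewrite /K; ring.
  have H0 (a : W -> 'rV[R]_d) : 0 <= (rhoprod a)%:E by rewrite lee_fin rhoprod_ge0.
  rewrite lintZl //; last 2 first.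
  - by move=> g; apply: ginteg_ge0.
  - by apply: coord_measurable_cfg; apply: measurable_ginteg => //; exact: measurable_rhoprod.
  rewrite ginteg_process //; last exact: measurable_rhoprod.
  rewrite [leRHS]EFinM; apply: lee_wpmul2l; first by rewrite lee_fin.
  apply: le_trans (HC s (ee n) us sT _); last by rewrite ee0 ee1.
  rewrite le_eqVlt; apply/predU1P; left; apply: eq_lint => g.
  by rewrite /ginteg -EFinM.
rewrite limn_einf_lim; apply: lime_le; first exact: is_cvg_einfs.
by apply: nearW => n; apply: le_trans (GK n); apply: ereal_inf_lbound; exists n => /=.
Qed.

End FatouReduction.

(** * Integrating out the midpoint of an edge *)

Section OneDimensional.
Variable R : realType.
Local Notation mu := (@lebesgue_measure R).

Lemma integral_gauss_affine (a b c : R) : a != 0%R -> (0 < c)%R ->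
  \int[mu]_z (expR (- ((a * z + b) ^+ 2 / c)))%:E = (Num.sqrt c * Num.sqrt pi / `|a|)%:E.
Proof.
move=> a0 c0; have sc0 : (0 < Num.sqrt c)%R by rewrite sqrtr_gt0.
have := @ge0_integral_affine R (a / Num.sqrt c) (b / Num.sqrt c)
  (fun w => (gauss_fun w)%:E).
rewrite integralT_gauss => H.
transitivity (\int[mu]_z (gauss_fun (a / Num.sqrt c * z + b / Num.sqrt c))%:E).
  apply: eq_integral => z _; rewrite /gauss_fun; congr ((expR (- _))%:E).
  rewrite -{1}(sqr_sqrtr (ltW c0)); field; exact: lt0r_neq0.
rewrite H.
- rewrite -EFinM normrM normfV (gtr0_norm sc0) invf_div mulrAC //.
- by rewrite mulf_neq0 // invr_eq0 gt_eqF.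
- by apply/measurable_EFinP; exact: measurable_gauss_fun.
- by move=> z; rewrite lee_fin gauss_fun_ge0.
Qed.

(* The library sets [0 `^ x] to 0 for x != 0, hence the separate value at 0. *)
Definition negpow (ga t : R) : \bar R := if t == 0%R then +oo else (`|t| `^ (- ga))%:E.

Lemma negpow_0 ga : negpow ga 0 = +oo.
Proof. by rewrite /negpow eqxx. Qed.

Lemma negpow_gt0 ga t : 0 < negpow ga t.
Proof. by rewrite /negpow; case: eqP => // /eqP t0; rewrite lte_fin powR_gt0 // normr_gt0. Qed.

Lemma negpow_ge0 ga t : 0 <= negpow ga t.
Proof. exact/ltW/negpow_gt0. Qed.

Lemma measurable_negpow ga : measurable_fun [set: R] (negpow ga).
Proof.
rewrite /negpow; apply: (measurable_fun_ifT (f := fun t : R => t == 0%R)) => //=.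
  by apply: measurable_fun_eqr.
apply/measurable_EFinP; apply: (measurableT_comp (measurable_powR (- ga)%R)).
exact: normr_measurable.
Qed.

Lemma negpow_scale2 ga t : negpow ga (2^-1 * t) = (2 `^ ga)%:E * negpow ga t.
Proof.
rewrite /negpow mulf_eq0 invr_eq0 pnatr_eq0 /=; case: eqP => _.
  by rewrite gt0_muley // lte_fin powR_gt0.
rewrite -EFinM normrM powRM ?normr_ge0 // gtr0_norm ?invr_gt0 //.
by rewrite -powR_inv1 // -powRrM mulrNN mul1r.
Qed.

(** By self-similarity: with q = 2^ga < 2, the substitution z -> z / 2 shows that the integral I
    satisfies 2 I <= q (I + 4), hence I <= 4 q / (2 - q). Truncating the integrand at n makes I
    finite, so that it can be moved to one side. *)
Lemma integral_negpow_lty ga : (0 <= ga < 1)%R -> exists2 C : R, (0 <= C)%R &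
  \int[mu]_z (negpow ga z * (\1_`[(-1)%R, 1%R] z)%:E) <= C%:E.
Proof.
move=> /andP[ga0 ga1]; set A := `[(-1)%R, 1%R]%classic.
have mA : measurable (A : set (measurableTypeR R)) by exact: measurable_itv.
pose q : R := (2 `^ ga)%R.
have q0 : (0 < q)%R by exact: powR_gt0.
have q2 : (q < 2)%R.
  rewrite -[ltRHS]powRr1 // /q /powR pnatr_eq0 /= ltr_expR ltr_pM2r ?ln_gt0 ?ltr1n //.
pose T (n : nat) z := Order.min (negpow ga z) n%:R%:E * (\1_A z)%:E.
have T0 n z : 0 <= T n z by rewrite mule_ge0 ?lee_fin // le_min negpow_ge0 lee_fin ler0n.
have mT n : measurable_fun [set: R] (T n).
  apply: emeasurable_funM; last by apply/measurable_EFinP; exact: measurable_indic.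
  by apply: measurable_mine => //; exact: measurable_negpow.
have mA1 : measurable_fun [set: R] (fun z => (\1_A z)%:E : \bar R).
  by apply/measurable_EFinP; exact: measurable_indic.
have L n : \int[mu]_z T n z <= (4 * q / (2 - q))%:E.
  have Lfin : \int[mu]_z T n z \is a fin_num.
    rewrite ge0_fin_numE; last by apply: integral_ge0 => z _; exact: T0.
    apply: (@le_lt_trans _ _ (\int[mu]_z (n%:R%:E * (\1_A z)%:E))).
      apply: ge0_le_integral => //.
      - exact: mT.
      - apply: emeasurable_funM; first exact: measurable_cst.
        exact: mA1.
      - by move=> z _; apply: lee_wpmul2r; rewrite ?lee_fin // ge_min lexx orbT.
    rewrite ge0_integralZl //.
    by rewrite integral_indic //= setIT /A lebesgue_measure_itv /=
      lte_fin gt0_cp // -EFinB -EFinM ltry.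
  have mI : measurable_fun [set: R] (fun z => (\1_`[(-2)%R, 2%R] z)%:E : \bar R).
    by apply/measurable_EFinP; apply: measurable_indic; exact: measurable_itv.
  have := @ge0_integral_affine R 2^-1 0 (T n).
  rewrite invr_eq0 pnatr_eq0 gtr0_norm ?invr_gt0 // invrK => /(_ isT (mT n) (T0 n)) L2.
  (* 4 is the length of [-2, 2], which contains the support of z -> T (z / 2); on the part of it
     outside [-1, 1] the power is at most 1. *)
  have : 2%:E * \int[mu]_z T n z <= q%:E * (\int[mu]_z T n z + 4%:E).
    rewrite -L2.
    have -> : 4%:E = \int[mu]_z (\1_`[(-2)%R, 2%R] z)%:E.
      rewrite integral_indic //= setIT lebesgue_measure_itv /= lte_fin gt0_cp //.
      by rewrite -EFinB; congr (_%:E); ring.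
    apply: (@le_trans _ _ (\int[mu]_z (q%:E * (T n z + (\1_`[(-2)%R, 2%R] z)%:E)))); last first.
      rewrite ge0_integralZl //; last 3 first.
      - by apply: emeasurable_funD; [exact: mT|exact: mI].
      - by move=> z _; rewrite adde_ge0 ?lee_fin.
      - by rewrite lee_fin ltW.
      by rewrite ge0_integralD //; exact: mT.
    apply: ge0_le_integral => //.
    - apply: (measurableT_comp (mT n)); exact: measurable_affine.
    - apply: emeasurable_funM; first exact: measurable_cst.
      by apply: emeasurable_funD; [exact: mT|exact: mI].
    move=> z _; rewrite addr0 /T negpow_scale2 -/q.
    have q1 : (1 <= q)%R by rewrite -[leLHS](powRr0 2) ler_powR // ler1n.
    (* The truncation level need not be rescaled, because q >= 1. *)
    have qmin : Order.min (q%:E * negpow ga z) n%:R%:E <= q%:E * Order.min (negpow ga z) n%:R%:E.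
      have nq : n%:R%:E <= q%:E * n%:R%:E by rewrite -EFinM lee_fin ler_peMl.
      by case: (leP (negpow ga z) n%:R%:E) => pn; rewrite ge_min ?lexx // nq orbT.
    have p0 := negpow_ge0 ga z.
    have pn0 : 0 <= Order.min (negpow ga z) n%:R%:E by rewrite le_min p0 lee_fin ler0n.
    rewrite !indicE; have [zA|zA] := boolP (z \in A).
      apply: (@le_trans _ _ (q%:E * Order.min (negpow ga z) n%:R%:E)).
        rewrite -[leRHS]mule1; apply: lee_pmul => //.
          by rewrite le_min mule_ge0 ?lee_fin ?ler0n ?(ltW q0).
        by case: (_ \in _).
      by rewrite mule1; apply: lee_wpmul2l; [rewrite lee_fin ltW|rewrite leeDl ?lee_fin].
    rewrite mule0 add0e; have [z2|z2] := boolP (z \in (`[(-2)%R, 2%R]%classic : set R)).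
      have z1 : (1 <= `|z|)%R.
        move: zA; rewrite notin_setE /A /= in_itv /= => /negP; rewrite -ler_norml -ltNge.
        exact: ltW.
      rewrite mule1; apply: (@le_trans _ _ (q%:E * negpow ga z)).
        rewrite -[leRHS]mule1; apply: lee_pmul => //.
        - by rewrite le_min mule_ge0 ?lee_fin ?ler0n ?(ltW q0).
        - by rewrite ge_min lexx.
        - by case: (_ \in _).
      rewrite -[leRHS]mule1; apply: lee_wpmul2l; first by rewrite lee_fin ltW.
      rewrite /negpow; case: eqP z1 => [->|_ z1]; first by rewrite normr0 ler10.
      by rewrite lee_fin powRN invf_le1 ?powR_gt0 ?(lt_le_trans _ z1) //
        -[leLHS](powRr0 `|z|) ler_powR.
    have -> : ((2^-1 * z)%R \in A) = false; last by rewrite !mule0.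
    apply/negbTE; move: z2; rewrite !notin_setE /A /= !in_itv /= -!ler_norml.
    by rewrite normrM gtr0_norm ?invr_gt0 // ler_pdivrMl // mulr1.
  rewrite -(fineK Lfin) -EFinD -!EFinM !lee_fin => Lq.
  rewrite ler_pdivlMr ?subr_gt0 //; nra.
exists (4 * q / (2 - q))%R.
  by rewrite divr_ge0 ?mulr_ge0 ?(ltW q0) // subr_ge0 ltW.
have Tl z : T n z @[n --> \oo] --> negpow ga z * (\1_A z)%:E.
  suff minl : Order.min (negpow ga z) n%:R%:E @[n --> \oo] --> negpow ga z.
    rewrite /T indicE; case: (z \in A).
      by rewrite mule1; under eq_fun do rewrite mule1.
    by rewrite mule0; under eq_fun do rewrite mule0; exact: cvg_cst.
  rewrite /negpow; case: eqP => _.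
    by under eq_fun do rewrite minye; apply/cvgeryP; exact: cvgr_idn.
  apply: cvg_near_cst; near=> n; apply/min_idPl; rewrite lee_fin.
  by near: n; exact: nbhs_infty_ger.
apply: (@le_trans _ _ (\int[mu]_z limn_einf (T^~ z))).
  rewrite le_eqVlt; apply/predU1P; left; apply: eq_integral => z _.
  by rewrite (cvg_limn_einf_sup (Tl z)).1.
apply: le_trans (fatou mu measurableT mT (fun n z _ => T0 n z)) _.
rewrite limn_einf_lim; apply: lime_le; first exact: is_cvg_einfs.
by apply: nearW => n; apply: le_trans (L n); apply: ereal_inf_lbound; exists n => /=.
Unshelve. all: by end_near. Qed.

End OneDimensional.

Section ProductBound.
Variables (R : realType) (I : eqType).
Local Notation mu := (@lebesgue_measure R).

Lemma coord_measurable_prod (J : Type) (r : seq J) (phi : J -> (I -> R) -> \bar R) :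
  (forall j, coord_measurable (phi j)) -> coord_measurable (fun g => \prod_(j <- r) phi j g).
Proof.
move=> mphi d T h mh; apply: measurable_bigop => [f1 f2|j _]; first exact: emeasurable_funM.
exact: mphi.
Qed.

(** Triangular integration. The last coordinate of [s], integrated innermost, enters only its own
    factor, whose integral is bounded whatever the values of the other coordinates; then the next to
    last, and so on. *)
Lemma lint_prod_le (s : seq I) (phi : I -> (I -> R) -> \bar R) (C : I -> R) g :
  uniq s -> (forall i g, 0 <= phi i g) -> (forall i, coord_measurable (phi i)) ->
  (forall i, (0 <= C i)%R) ->
  (forall i g, i \in s -> \int[mu]_z phi i (upd g i z) <= (C i)%:E) ->
  (forall i k g z, i \in s -> k \in s -> (index i s < index k s)%N ->
    phi i (upd g k z) = phi i g) ->
  lint s (fun g => \prod_(i <- s) phi i g) g <= (\prod_(i <- s) C i)%:E.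
Proof.
move=> + phi0 mphi C0; elim: s g => [|i s IH] g /=.
  by move=> _ _ _; rewrite !big_nil.
move=> /andP[is_ us] Cphi indep.
have P0 h : 0 <= \prod_(j <- s) phi j h by apply: prode_ge0 => j _; exact: phi0.
have IHs h : lint s (fun g => \prod_(i <- s) phi i g) h <= (\prod_(i <- s) C i)%:E.
  apply: IH => // [k h' ks|k l h' z ks ls kl]; first by apply: Cphi; rewrite inE ks orbT.
  apply: indep; rewrite ?inE ?ks ?ls ?orbT //.
  by case: eqP => [ik|_]; [rewrite ik ks in is_|case: eqP => [il|//]; rewrite il ls in is_].
rewrite big_cons EFinM muleC.
have -> : \int[mu]_z lint s (fun g => \prod_(j <- i :: s) phi j g) (upd g i z) =
    \int[mu]_z (phi i (upd g i z) * lint s (fun g => \prod_(j <- s) phi j g) (upd g i z)).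
  apply: eq_integral => z _; rewrite -lint_factor //.
  - by apply: eq_lint => h; rewrite big_cons.
  - move=> h k y ks; apply: indep; rewrite ?mem_head ?inE ?ks ?orbT // eqxx.
    by case: eqP => // ik; rewrite ik ks in is_.
  - exact: coord_measurable_prod.
apply: (@le_trans _ _ (\int[mu]_z ((\prod_(j <- s) C j)%:E * phi i (upd g i z)))).
  have mint : coord_measurable (lint s (fun g => \prod_(j <- s) phi j g)).
    by apply: coord_measurable_lint => //; exact: coord_measurable_prod.
  apply: ge0_le_integral => //.
  - by move=> z _; rewrite mule_ge0 // lint_ge0.
  - by apply: emeasurable_funM; exact: coord_measurable_section.
  - apply: emeasurable_funM; first exact: measurable_cst.
    exact: coord_measurable_section.
  - by move=> z _; rewrite muleC; apply: lee_wpmul2r.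
rewrite ge0_integralZl //.
- apply: lee_wpmul2l; first by rewrite lee_fin prodr_ge0.
  by apply: Cphi; rewrite mem_head.
- exact: coord_measurable_section.
- by rewrite lee_fin prodr_ge0.
Qed.

End ProductBound.

Section GaussianBounds.
Variable R : realType.
Local Notation mu := (@lebesgue_measure R).

(** Half of the exponent in [gdens]; the other half absorbs the powers of [rho], see
    [gdens_rho_le]. *)
Definition e4 (z : R) : R := expR (- (z ^+ 2 / 4)).

Lemma e4_ge0 z : (0 <= e4 z)%R. Proof. exact: expR_ge0. Qed.

Lemma e4_le1 z : (e4 z <= 1)%R.
Proof. by rewrite -expR0 ler_expR oppr_le0 divr_ge0 ?sqr_ge0. Qed.

Lemma measurable_e4 : measurable_fun [set: R] e4.
Proof.
by apply: measurableT_comp => //; apply: measurable_funN; apply: measurable_funM.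
Qed.

Lemma integral_e4 : \int[mu]_z (e4 z)%:E = (2 * Num.sqrt pi)%:E.
Proof.
have := @integral_gauss_affine R 1 0 4 (oner_neq0 _) (ltr0n _ 4).
rewrite normr1 divr1 (_ : 4 = 2 ^+ 2)%R; last by ring.
rewrite sqrtr_sqr ger0_norm // => <-.
by apply: eq_integral => z _; rewrite mul1r addr0 /e4 (_ : 4 = 2 ^+ 2)%R //; ring.
Qed.

(** Where |z - c| <= 1, the Gaussian is at most 1 and the power is integrable; elsewhere the power
    is at most 1 and the Gaussian is integrable. Both bounds are independent of [c]. *)
Lemma integral_e4_negpow ga : (0 <= ga < 1)%R -> exists2 C : R, (0 <= C)%R &
  forall c, \int[mu]_z ((e4 z)%:E * negpow ga (z - c)%R) <= C%:E.
Proof.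
move=> ga01; have [C C0 HC] := integral_negpow_lty ga01.
exists (C + 2 * Num.sqrt pi)%R; first by rewrite addr_ge0 ?mulr_ge0 ?sqrtr_ge0.
move=> c; pose A := `[(-1)%R, 1%R]%classic : set R.
have mA : measurable (A : set (measurableTypeR R)) by exact: measurable_itv.
pose f w := negpow ga w * (\1_A w)%:E.
have mf : measurable_fun [set: R] f.
  apply: emeasurable_funM; first exact: measurable_negpow.
  by apply/measurable_EFinP; exact: measurable_indic.
have f0 w : 0 <= f w by rewrite mule_ge0 ?negpow_ge0 // lee_fin.
have mfc : measurable_fun [set: R] (fun z => f (1 * z + - c)%R).
  by apply: (measurableT_comp mf); exact: measurable_affine.
apply: (@le_trans _ _ (\int[mu]_z (f (1 * z + - c)%R + (e4 z)%:E))).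
  apply: ge0_le_integral => //.
  - by move=> z _; rewrite mule_ge0 ?negpow_ge0 // lee_fin e4_ge0.
  - apply: emeasurable_funM; first by apply/measurable_EFinP; exact: measurable_e4.
    apply: (measurableT_comp (measurable_negpow ga)); exact: measurable_funB.
  - by apply: emeasurable_funD; [exact: mfc|apply/measurable_EFinP; exact: measurable_e4].
  move=> z _; rewrite mul1r /f indicE; have [zA|zA] := boolP ((z - c)%R \in A).
    rewrite mule1; apply: (@le_trans _ _ (negpow ga (z - c)%R)).
      by rewrite -[leRHS]mul1e; apply: lee_wpmul2r; rewrite ?negpow_ge0 // lee_fin e4_le1.
    by rewrite leeDl // lee_fin e4_ge0.
  rewrite mule0 add0e -[leRHS]mule1; apply: lee_wpmul2l; first by rewrite lee_fin e4_ge0.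
  have z1 : (1 <= `|(z - c)%R|)%R.
    move: zA; rewrite notin_setE /A /= in_itv /= => /negP; rewrite -ler_norml -ltNge.
    exact: ltW.
  rewrite /negpow; case: eqP z1 => [->|_ z1]; first by rewrite normr0 ler10.
  rewrite lee_fin powRN invf_le1 ?powR_gt0 ?(lt_le_trans _ z1) //.
  by rewrite -[leLHS](powRr0 `|(z - c)%R|) ler_powR //; case/andP: ga01.
rewrite ge0_integralD //; last 2 first.
- by move=> z _; rewrite lee_fin e4_ge0.
- by apply/measurable_EFinP; exact: measurable_e4.
rewrite integral_e4 EFinD leeD2r // ge0_integral_affine ?oner_neq0 //.
by rewrite normr1 invr1 mul1e.
Qed.

End GaussianBounds.

Section RowBounds.
Variables (R : realType) (d : nat).
Implicit Types y z : 'rV[R]_d.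

Definition gauss4 y : R := expR (- (dot y y / 4)).

Lemma gauss4E y : gauss4 y = (\prod_i e4 (y ord0 i))%R.
Proof.
by rewrite /gauss4 /e4 -expR_sum /dot mulr_suml -sumrN; congr expR.
Qed.

(** Sums of absolute values stand in for the Euclidean norms of vectors and of 2-minors: they are
    comparable up to constants and bound each coordinate and each minor directly. *)
Definition norm1 y : R := (\sum_i `|y ord0 i|)%R.

Definition minor2 y z i j : R := (y ord0 i * z ord0 j - y ord0 j * z ord0 i)%R.

Definition wedge y z : R := (\sum_i \sum_j `|minor2 y z i j|)%R.

Lemma norm1_ge0 y : (0 <= norm1 y)%R. Proof. exact: sumr_ge0. Qed.

Lemma wedge_ge0 y z : (0 <= wedge y z)%R.
Proof. by apply: sumr_ge0 => i _; exact: sumr_ge0. Qed.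

Lemma wedgeC y z : wedge y z = wedge z y.
Proof.
apply: eq_bigr => i _; apply: eq_bigr => j _.
by rewrite -normrN; congr `|_|%R; rewrite /minor2; ring.
Qed.

Lemma sum_le_max (J : finType) (f : J -> R) (j0 : J) :
  exists j, (\sum_i f i <= #|J|%:R * f j)%R /\ forall i, (f i <= f j)%R.
Proof.
case: (arg_maxP f (erefl : xpredT j0)) => j _ jmax; exists j; split; last first.
  by move=> i; exact: jmax.
rewrite mulr_natl -sumr_const; apply: ler_sum => i _; exact: jmax.
Qed.

End RowBounds.

Section EdgeIntegral.
Variables (R : realType) (d : nat).
Implicit Types (y z : 'rV[R]_d) (g : 'I_d -> R).
Local Notation mu := (@lebesgue_measure R).
Local Notation sqpi := (Num.sqrt (pi : R)).

Lemma measurable_sum_coords (c : 'I_d -> R) (F : R -> R) :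
  measurable_fun [set: R] F -> coord_measurable (fun g => (F (\sum_i g i * c i)%R)%:E).
Proof.
move=> mF disp T h mh; apply/measurable_EFinP; apply: (measurableT_comp mF).
by apply: measurable_sumP => i _; exact: measurable_funM.
Qed.

Lemma sum_coords_upd (c : 'I_d -> R) g i (w : R) :
  (\sum_l upd g i w l * c l = c i * w + \sum_(l | l != i) g l * c l)%R.
Proof.
rewrite (bigD1 i) //= upd_eq mulrC; congr (_ + _)%R; apply: eq_bigr => l li.
by rewrite /upd (negbTE li).
Qed.

Definition gexp (c w : R) : R := expR (- (w ^+ 2 / c)).

Lemma measurable_gexp c : measurable_fun [set: R] (gexp c).
Proof.
by apply: measurableT_comp => //; apply: measurable_funN; apply: measurable_funM.
Qed.

(** Eliminate x_i from the second kernel by Gaussian elimination, at the price of wider Gaussians.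
    Integrating x_i and then x_j gives 1 / (|y_i| |b_j|), which is the inverse of the minor; the
    other d - 2 coordinates keep their Gaussian weight. *)
Lemma edge_integral_pivot e y z i j g : (0 < e)%R -> i != j ->
  minor2 y z i j != 0%R -> (`|z ord0 i| <= `|y ord0 i|)%R ->
  lint (enum 'I_d) (fun x =>
    (gauss4 (rowv x) * gker e (dot (rowv x) y) * gker e (dot (rowv x) z))%:E) g
  <= ((2 * sqpi) ^+ (d - 2) * (2 * sqpi * (Num.sqrt 8 * sqpi)) / `|minor2 y z i j|)%:E.
Proof.
move=> e0 ij m0 zy; set m := minor2 y z i j in m0 *.
have yi : y ord0 i != 0%R.
  apply: contraNneq m0 => yi; move: zy; rewrite yi normr0 normr_le0 => /eqP zi.
  by rewrite /m /minor2 yi zi; apply/eqP; ring.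
(* The vector b = z - t y has b_i = 0, so <x, b> is free of x_i. The pivot hypothesis gives |t| <=
   1. *)
pose t := (z ord0 i / y ord0 i)%R.
pose b l := (z ord0 l - t * y ord0 l)%R.
have bi : b i = 0%R by rewrite /b /t divfK // subrr.
have bj : b j = (m / y ord0 i)%R by rewrite /b /t /m /minor2; field.
have bj0 : b j != 0%R by rewrite bj mulf_neq0 // invr_eq0.
pose phi k g : \bar R :=
  if k == i then (e^-1 * gexp (4 * e ^+ 2) (\sum_l g l * y ord0 l))%:E
  else if k == j then (e^-1 * gexp (8 * e ^+ 2) (\sum_l g l * b l))%:E
  else (e4 (g k))%:E.
pose C k : R := (if k == i then 2 * sqpi / `|y ord0 i|
  else if k == j then Num.sqrt 8 * sqpi / `|b j| else 2 * sqpi)%R.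
pose r := [seq k <- enum 'I_d | (k != i) && (k != j)].
(* The order makes the factors triangular: [phi i] may involve every coordinate, [phi j] every one
   but [i], and the others only their own. *)
pose s := r ++ [:: j; i].
have us : uniq s.
  rewrite cat_uniq filter_uniq ?enum_uniq //= inE eq_sym ij /= !andbT.
  by rewrite orbF !mem_filter !eqxx /= andbF.
have ps : perm_eq (enum 'I_d) s.
  apply: uniq_perm => //; first exact: enum_uniq.
  move=> k; rewrite mem_enum mem_cat mem_filter !inE mem_enum andbT.
  by case: (k == i) => //=; case: (k == j).
have e2 : (0 < e ^+ 2)%R by rewrite exprn_gt0.
have ei0 : (0 <= e^-1)%R by rewrite invr_ge0 ltW.
have phi0 k h : 0 <= phi k h.
  by rewrite /phi; do 2?case: ifP => _; rewrite lee_fin ?mulr_ge0 ?expR_ge0.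
have mphi k : coord_measurable (phi k).
  rewrite /phi; case: (k == i); last case: (k == j).
  - apply: (@measurable_sum_coords (fun l => y ord0 l) (fun w => e^-1 * gexp (4 * e ^+ 2) w)%R).
    by apply: measurable_funM => //; exact: measurable_gexp.
  - apply: (@measurable_sum_coords b (fun w => e^-1 * gexp (8 * e ^+ 2) w)%R).
    by apply: measurable_funM => //; exact: measurable_gexp.
  - move=> disp T h mh; apply/measurable_EFinP.
    exact: measurableT_comp (@measurable_e4 R) (mh k).
have C0 k : (0 <= C k)%R.
  by rewrite /C; do 2?case: ifP => _; rewrite ?mulr_ge0 ?invr_ge0 ?sqrtr_ge0.
have int_gexp (c c' : R) (a : 'I_d -> R) k h : a k != 0%R -> (0 < c)%R -> (c * e ^+ 2 = c')%R ->
    \int[mu]_w (e^-1 * gexp c' (\sum_l upd h k w l * a l))%:E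
    = (Num.sqrt c * sqpi / `|a k|)%:E.
  move=> ak c0 <-.
  under eq_integral do rewrite EFinM sum_coords_upd.
  rewrite ge0_integralZl //; last 2 first.
  - apply/measurable_EFinP; apply: (measurableT_comp (measurable_gexp (c * e ^+ 2))).
    exact: measurable_affine.
  - by move=> w _; rewrite lee_fin expR_ge0.
  rewrite integral_gauss_affine ?mulr_gt0 // sqrtrM ?(ltW c0) // sqrtr_sqr gtr0_norm //.
  rewrite -EFinM; congr (_%:E); field.
  by rewrite normr_eq0 ak gt_eqF.
have sqrt4 : Num.sqrt 4 = 2%R :> R.
  rewrite (_ : 4 = 2 ^+ 2)%R; last by ring.
  by rewrite sqrtr_sqr ger0_norm.
have main : lint s (fun g => \prod_(k <- s) phi k g) g <= (\prod_(k <- s) C k)%:E.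
  apply: lint_prod_le => //.
  - move=> k h _; rewrite /phi /C; case: (eqVneq k i) => [->|ki].
      by rewrite (int_gexp 4%R) // sqrt4.
    case: (eqVneq k j) => [->|kj]; first by rewrite (int_gexp 8%R).
    by rewrite -integral_e4 le_eqVlt; apply/predU1P; left;
      apply: eq_integral => w _; rewrite upd_eq.
  move=> k l h w ks ls kl; rewrite /phi; case: (eqVneq k i) => [ki|ki].
    move: kl; rewrite ki /s index_cat mem_filter eqxx /= [j == i]eq_sym (negbTE ij) eqxx addn1.
    have := ls; rewrite -index_mem /s size_cat /= addn2 ltnS => ls' kl.
    by rewrite ltnNge ls' in kl.
  case: (eqVneq k j) => [kj|kj].
    have -> : l = i; last first.
      rewrite sum_coords_upd bi mul0r add0r [in RHS](bigD1 i) //= bi mulr0 add0r //.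
    move: ls; rewrite /s mem_cat !inE => /or3P[lr|/eqP lj|/eqP //].
      have := kl; rewrite kj /s !index_cat lr mem_filter eqxx andbF /= eqxx addn0.
      by rewrite ltnNge index_size.
    by rewrite lj kj ltnn in kl.
  congr ((e4 _)%:E); rewrite /upd; case: eqP => // kl'.
  by rewrite kl' ltnn in kl.
have mE : coord_measurable (fun x : 'I_d -> R =>
    (gauss4 (rowv x) * gker e (dot (rowv x) y) * gker e (dot (rowv x) z))%:E).
  apply: (@row_measurable_rowv R d (fun x => (gauss4 x * gker e (dot x y) * gker e (dot x z))%:E)).
  move=> disp T h mh; apply/measurable_EFinP; apply: measurable_funM.
    apply: measurable_funM; last by apply: measurable_gker; exact: measurable_dot.
    apply: measurableT_comp => //; apply: measurable_funN; apply: measurable_funM => //.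
    exact: measurable_dot.
  by apply: measurable_gker; exact: measurable_dot.
have E0 (h : 'I_d -> R) : 0 <=
    (gauss4 (rowv h) * gker e (dot (rowv h) y) * gker e (dot (rowv h) z))%:E.
  by rewrite lee_fin !mulr_ge0 ?expR_ge0 ?gker_ge0.
have sr : size r = (d - 2)%N.
  by have := perm_size ps; rewrite size_enum_ord size_cat /= => dr; rewrite [in RHS]dr addnK.
have rP k : k \in r -> (k == i = false) * (k == j = false).
  by rewrite mem_filter => /andP[/andP[/negbTE -> /negbTE ->]].
apply: (@le_trans _ _ (lint s (fun g => \prod_(k <- s) phi k g) g)).
  rewrite (lint_perm _ E0 mE (enum_uniq _) ps); apply: le_lint => //.
    exact: coord_measurable_prod.
  move=> h; rewrite /s big_cat /= big_cons big_seq1.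
  have -> : \prod_(k <- r) phi k h = (\prod_(k <- r) e4 (h k))%:E.
    rewrite -prodEFin; apply: eq_big_seq => k kr.
    by rewrite /phi !(rP _ kr).
  rewrite /phi eqxx eq_sym (negbTE ij) eqxx -!EFinM lee_fin.
  have -> : gauss4 (rowv h) = (\prod_(k <- r) e4 (h k) * (e4 (h j) * e4 (h i)))%R.
    rewrite gauss4E -big_enum /= (perm_big _ ps) /s big_cat /= big_cons big_seq1 !mxE.
    by congr (_ * _)%R; apply: eq_bigr => k _; rewrite mxE.
  set P := (\prod_(k <- r) _)%R; have P0 : (0 <= P)%R by apply: prodr_ge0 => k _; exact: e4_ge0.
  set A := (\sum_l h l * y ord0 l)%R; set B' := (\sum_l h l * b l)%R.
  have -> : dot (rowv h) y = A by apply: eq_bigr => l _; rewrite mxE.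
  pose B := dot (rowv h) z; rewrite -/B.
  have B'E : B' = (B - t * A)%R.
    rewrite /B /dot /A mulr_sumr -sumrB; apply: eq_bigr => l _.
    by rewrite mxE /b; ring.
  have ee1 : (e4 (h j) * e4 (h i) <= 1)%R.
    by rewrite -[leRHS]mulr1 ler_pM ?e4_ge0 ?e4_le1.
  rewrite [leLHS](_ : _ = P * ((e4 (h j) * e4 (h i)) * (gker e A * gker e B)))%R; last by ring.
  rewrite ler_wpM2l //; apply: (@le_trans _ _ (gker e A * gker e B)%R).
    by rewrite ler_piMl // mulr_ge0 ?gker_ge0.
  rewrite /gker /gexp mulrACA [leRHS]mulrACA ler_wpM2l ?mulr_ge0 // -!expRD ler_expR.
  rewrite -subr_ge0.
  have -> : (- (B' ^+ 2 / (8 * e ^+ 2)) + - (A ^+ 2 / (4 * e ^+ 2)) -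
    (- (A ^+ 2 / (2 * e ^+ 2)) + - (B ^+ 2 / (2 * e ^+ 2)))
    = (2 * A ^+ 2 + 4 * B ^+ 2 - B' ^+ 2) / (8 * e ^+ 2))%R by field; rewrite gt_eqF.
  apply: divr_ge0; last by rewrite mulr_ge0 // ltW.
  rewrite B'E.
  have t1 : (t ^+ 2 <= 1)%R.
    rewrite -real_normK ?num_real // expr_le1 // /t normrM normfV ler_pdivrMr ?normr_gt0 //.
    by rewrite mul1r.
  have tA : (t ^+ 2 * A ^+ 2 <= A ^+ 2)%R by rewrite ler_piMl ?sqr_ge0.
  (* (B - t A)^2 + (B + t A)^2 = 2 B^2 + 2 t^2 A^2 <= 2 B^2 + 2 A^2. *)
  have := sqr_ge0 (B + t * A)%R; have := sqr_ge0 B; nra.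
apply: le_trans main _; rewrite lee_fin /s big_cat /= big_cons big_seq1.
have -> : (\prod_(k <- r) C k = (2 * sqpi) ^+ (d - 2))%R.
  rewrite -sr -[RHS]iter_mulr_1 -count_predT -big_const_seq.
  by apply: eq_big_seq => k kr; rewrite /C !(rP _ kr).
rewrite /C eqxx eq_sym (negbTE ij) eqxx bj normrM normfV le_eqVlt; apply/predU1P; left.
by field; rewrite !normr_eq0 m0 yi.
Qed.

End EdgeIntegral.

Section EdgeBound.
Variables (R : realType) (d : nat).
Implicit Types (y z : 'rV[R]_d) (g : 'I_d -> R).
Local Notation sqpi := (Num.sqrt (pi : R)).

Lemma measurable_gauss4 disp (T : measurableType disp) (h : T -> 'rV[R]_d) :
  (forall j, measurable_fun [set: T] (fun x => h x ord0 j)) ->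
  measurable_fun [set: T] (fun x => gauss4 (h x)).
Proof.
move=> mh; apply: measurableT_comp => //; apply: measurable_funN.
by apply: measurable_funM => //; exact: measurable_dot.
Qed.

Definition edge_fun e y z (x : 'rV[R]_d) : R :=
  (gauss4 x * gker e (dot x y) * gker e (dot x z))%R.

Lemma edge_fun_ge0 e y z x : (0 < e)%R -> (0 <= edge_fun e y z x)%R.
Proof. by move=> e0; rewrite /edge_fun mulr_ge0 ?gker_ge0 // mulr_ge0 ?expR_ge0 ?gker_ge0. Qed.

Lemma measurable_edge_fun e disp (T : measurableType disp) (y z h : T -> 'rV[R]_d) :
  (forall j, measurable_fun [set: T] (fun x => y x ord0 j)) ->
  (forall j, measurable_fun [set: T] (fun x => z x ord0 j)) ->
  (forall j, measurable_fun [set: T] (fun x => h x ord0 j)) ->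
  measurable_fun [set: T] (fun x => edge_fun e (y x) (z x) (h x)).
Proof.
move=> my mz mh; apply: measurable_funM.
  apply: measurable_funM; first exact: measurable_gauss4.
  by apply: measurable_gker; exact: measurable_dot.
by apply: measurable_gker; exact: measurable_dot.
Qed.

Lemma edge_funC e y z x : edge_fun e y z x = edge_fun e z y x.
Proof. by rewrite /edge_fun; ring. Qed.

Lemma lint_gauss4_le g : lint (enum 'I_d) (fun x => (gauss4 (rowv x))%:E) g
  <= ((2 * sqpi) ^+ d)%:E.
Proof.
pose phi i (x : 'I_d -> R) := (e4 (x i))%:E.
have -> : ((2 * sqpi) ^+ d = \prod_(i <- enum 'I_d) (2 * sqpi))%R.
  by rewrite big_const_seq count_predT size_enum_ord iter_mulr_1.
have -> : lint (enum 'I_d) (fun x => (gauss4 (rowv x))%:E) g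
    = lint (enum 'I_d) (fun x => \prod_(i <- enum 'I_d) phi i x) g.
  apply: eq_lint => x; rewrite gauss4E big_enum /phi prodEFin; congr (_%:E).
  by apply: eq_bigr => i _; rewrite mxE.
apply: lint_prod_le.
- exact: enum_uniq.
- by move=> i x; rewrite lee_fin e4_ge0.
- move=> i disp T h mh; apply/measurable_EFinP.
  exact: measurableT_comp (@measurable_e4 R) (mh i).
- by move=> _; rewrite mulr_ge0 ?sqrtr_ge0.
- move=> i x _; rewrite -integral_e4 le_eqVlt; apply/predU1P; left.
  by apply: eq_integral => w _; rewrite /phi upd_eq.
- move=> i k x z _ _ ik; rewrite /phi /upd; case: eqP => // kl.
  by rewrite kl ltnn in ik.
Qed.

(** Two bounds on the integral are added: times [wedge] it is at most C1 times the number d^2 of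
    minors, by pivoting on a largest minor; times e^2 it is at most C2, since each kernel is at most
    1/e. The term e^2 keeps the bound finite when y and z are parallel. *)
Lemma edge_integral : exists2 C : R, (0 <= C)%R & forall e y z g, (0 < e)%R ->
  lint (enum 'I_d) (fun x => (edge_fun e y z (rowv x))%:E) g
  <= (C / (wedge y z + e ^+ 2))%:E.
Proof.
pose C1 : R := ((2 * sqpi) ^+ (d - 2) * (2 * sqpi * (Num.sqrt 8 * sqpi)))%R.
pose C2 : R := ((2 * sqpi) ^+ d)%R.
have C10 : (0 <= C1)%R by rewrite !mulr_ge0 ?exprn_ge0 ?mulr_ge0 ?sqrtr_ge0.
have C20 : (0 <= C2)%R by rewrite exprn_ge0 ?mulr_ge0 ?sqrtr_ge0.
exists (C1 * #|{: 'I_d * 'I_d}|%:R + C2)%R; first by rewrite addr_ge0 ?mulr_ge0.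
move=> e y z g e0; have e2 : (0 < e ^+ 2)%R by rewrite exprn_gt0.
set L := lint _ _ _.
have L0 : 0 <= L by apply: lint_ge0 => x; rewrite lee_fin edge_fun_ge0.
have mE : coord_measurable (fun x : 'I_d -> R => (edge_fun e y z (rowv x))%:E).
  apply: (@row_measurable_rowv R d (fun x => (edge_fun e y z x)%:E)) => disp T h mh.
  by apply/measurable_EFinP; apply: measurable_edge_fun.
have LC2 : L <= (C2 / e ^+ 2)%:E.
  apply: (@le_trans _ _ (((e ^+ 2)^-1)%:E * lint (enum 'I_d) (fun x => (gauss4 (rowv x))%:E) g)).
    rewrite -lintZl //; last 3 first.
    - by rewrite lee_fin invr_ge0 ltW.
    - by move=> x; rewrite lee_fin expR_ge0.
    - apply: (@row_measurable_rowv R d (fun x => (gauss4 x)%:E)) => disp T h mh.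
      by apply/measurable_EFinP; apply: measurable_gauss4.
    apply: le_lint => //.
    - by move=> x; rewrite lee_fin edge_fun_ge0.
    - apply: (@row_measurable_rowv R d (fun x => ((e ^+ 2)^-1)%:E * (gauss4 x)%:E)) => disp T h mh.
      apply: emeasurable_funM; first exact: measurable_cst.
      by apply/measurable_EFinP; apply: measurable_gauss4.
    move=> x; rewrite -EFinM lee_fin /edge_fun -mulrA mulrC ler_wpM2r ?expR_ge0 //.
    have gk t : (gker e t <= e^-1)%R.
      apply: ler_piMr; first by rewrite invr_ge0 ltW.
      rewrite -[leRHS]expR0 ler_expR oppr_le0.
      by rewrite divr_ge0 ?sqr_ge0 // mulr_ge0 // ltW.
    by rewrite expr2 invfM ler_pM ?gker_ge0.
  rewrite mulrC EFinM; apply: lee_wpmul2l; first by rewrite lee_fin invr_ge0 ltW.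
  exact: lint_gauss4_le.
have Lfin : L \is a fin_num by rewrite ge0_fin_numE // (le_lt_trans LC2) // ltry.
have LW : (fine L * wedge y z <= C1 * #|{: 'I_d * 'I_d}|%:R)%R.
  have WE : wedge y z = (\sum_(p : 'I_d * 'I_d) `|minor2 y z p.1 p.2|)%R.
    by rewrite /wedge pair_bigA.
  have [W0|W0] := eqVneq (wedge y z) 0%R; first by rewrite W0 mulr0 mulr_ge0.
  have [p0 _] : exists p : 'I_d * 'I_d, minor2 y z p.1 p.2 != 0%R.
    apply/existsP; apply: contraNT W0 => /existsPn H0; rewrite WE big1 // => p _.
    by have := H0 p; rewrite negbK => /eqP ->; rewrite normr0.
  have [[i j] [Wij _]] := @sum_le_max R _ (fun p => `|minor2 y z p.1 p.2|%R) p0.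
  rewrite -WE /= in Wij.
  have mij : minor2 y z i j != 0%R.
    apply: contraNneq W0 => mij; move: Wij; rewrite mij normr0 mulr0 => W1.
    by rewrite eq_le W1 wedge_ge0.
  have ij : i != j.
    by apply: contraNneq mij => ->; rewrite /minor2; apply/eqP; ring.
  have Lm : L <= (C1 / `|minor2 y z i j|)%:E.
    (* If z has the larger i-th coordinate, exchange y and z; the minor only changes sign. *)
    have [zy|yz] := leP `|z ord0 i|%R `|y ord0 i|%R; first exact: edge_integral_pivot.
    have mC : minor2 z y i j = (- minor2 y z i j)%R by rewrite /minor2; ring.
    rewrite -normrN -mC; apply: le_trans (edge_integral_pivot g e0 ij _ (ltW yz)).
      by rewrite le_eqVlt; apply/predU1P; left; apply: eq_lint => x; rewrite edge_funC.
    by rewrite mC oppr_eq0.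
  have mp : (0 < `|minor2 y z i j|)%R by rewrite normr_gt0.
  have : (fine L * `|minor2 y z i j| <= C1)%R.
    by rewrite -ler_pdivlMr // -lee_fin fineK.
  move=> Lm'; apply: le_trans (ler_wpM2l _ Wij) _; first by rewrite fine_ge0.
  by rewrite mulrCA mulrC ler_wpM2r.
have L2 : (fine L * e ^+ 2 <= C2)%R by rewrite -ler_pdivlMr // -lee_fin fineK.
rewrite -(fineK Lfin) lee_fin ler_pdivlMr ?ltr_wpDl ?wedge_ge0 //.
by rewrite mulrDr lerD.
Qed.

End EdgeBound.

(** * Eliminating the original vertices one at a time *)

Section LeafBound.
Variables (R : realType) (d : nat).
Hypothesis d3 : (3 <= d)%N.
Implicit Types (y z : 'rV[R]_d) (g : 'I_d -> R).

Definition kappa e y z : R := (1 + norm1 y * norm1 z / (wedge y z + e ^+ 2))%R.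

Definition leaf_weight y : \bar R := (gauss4 y)%:E * negpow (d.-1)%:R (norm1 y).

Lemma kappa_ge1 e y z : (1 <= kappa e y z)%R.
Proof. by rewrite lerDl divr_ge0 ?mulr_ge0 ?norm1_ge0 // addr_ge0 ?wedge_ge0 ?sqr_ge0. Qed.

Lemma kappaC e y z : kappa e y z = kappa e z y.
Proof. by rewrite /kappa wedgeC (mulrC (norm1 y)). Qed.

Lemma leaf_weight_ge0 y : 0 <= leaf_weight y.
Proof. by rewrite mule_ge0 ?negpow_ge0 // lee_fin expR_ge0. Qed.

Lemma measurable_norm1 disp (T : measurableType disp) (h : T -> 'rV[R]_d) :
  (forall j, measurable_fun [set: T] (fun x => h x ord0 j)) ->
  measurable_fun [set: T] (fun x => norm1 (h x)).
Proof.
move=> mh; apply: measurable_sumP => i _.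
by apply: measurableT_comp; [exact: normr_measurable|exact: mh].
Qed.

Lemma measurable_wedge disp (T : measurableType disp) (y z : T -> 'rV[R]_d) :
  (forall j, measurable_fun [set: T] (fun x => y x ord0 j)) ->
  (forall j, measurable_fun [set: T] (fun x => z x ord0 j)) ->
  measurable_fun [set: T] (fun x => wedge (y x) (z x)).
Proof.
move=> my mz; apply: measurable_sumP => i _; apply: measurable_sumP => j _.
apply: measurableT_comp; first exact: normr_measurable.
by apply: measurable_funB; apply: measurable_funM.
Qed.

Lemma measurable_kappa e disp (T : measurableType disp) (y z : T -> 'rV[R]_d) :
  (forall j, measurable_fun [set: T] (fun x => y x ord0 j)) ->
  (forall j, measurable_fun [set: T] (fun x => z x ord0 j)) ->
  measurable_fun [set: T] (fun x => kappa e (y x) (z x)).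
Proof.
move=> my mz; apply: measurable_funD => //; apply: measurable_funM.
  by apply: measurable_funM; exact: measurable_norm1.
apply: measurable_inv_ge0 => [x|]; first by rewrite addr_ge0 ?wedge_ge0 ?sqr_ge0.
by apply: measurable_funD => //; exact: measurable_wedge.
Qed.

Lemma row_measurable_leaf_weight : row_measurable leaf_weight.
Proof.
move=> disp T h mh; apply: emeasurable_funM.
  by apply/measurable_EFinP; exact: measurable_gauss4.
by apply: (measurableT_comp (measurable_negpow _)); exact: measurable_norm1.
Qed.

Definition leaf_fun e y z : \bar R :=
  leaf_weight y * (kappa e y z `^ (d%:R / 2))%:E.

Lemma leaf_fun_ge0 e y z : 0 <= leaf_fun e y z.
Proof. by rewrite mule_ge0 ?leaf_weight_ge0 // lee_fin powR_ge0. Qed.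

Lemma row_measurable_leaf_fun e z : row_measurable (fun y => leaf_fun e y z).
Proof.
move=> disp T h mh; apply: emeasurable_funM; first exact: row_measurable_leaf_weight.
apply/measurable_EFinP; apply: (measurableT_comp (measurable_powR _)).
exact: measurable_kappa.
Qed.

Lemma norm1_ge y i : (`|y ord0 i| <= norm1 y)%R.
Proof. by rewrite /norm1 (bigD1 i) //= lerDl sumr_ge0. Qed.

Lemma norm1_ge2 y i j : i != j -> (`|y ord0 i| + `|y ord0 j| <= norm1 y)%R.
Proof.
by move=> ij; rewrite /norm1 (bigD1 i) //= lerD2l (bigD1 j) 1?eq_sym //= lerDl sumr_ge0.
Qed.

Lemma minor2_le_wedge y z i j : (`|minor2 y z i j| <= wedge y z)%R.
Proof.
rewrite /wedge (bigD1 i) //= (bigD1 j) //= -addrA lerDl addr_ge0 ?sumr_ge0 // => k _.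
exact: sumr_ge0.
Qed.

(** For z != 0, the forms h_i = y_i - (z_i / z_j) y_j with i != j cut out the line spanned by z.
    Since |z_j| |h_i| is the absolute value of a minor and z_j is the largest coordinate, each of
    them bounds [kappa] separately. For z = 0 the quotient is 0 and h_i = y_i. *)
Lemma kappa_le e y z i j : (0 < e)%R -> i != j ->
  (forall k, `|z ord0 k| <= `|z ord0 j|)%R ->
  (norm1 z <= d%:R * `|z ord0 j|)%R ->
  (y ord0 i - z ord0 i / z ord0 j * y ord0 j != 0)%R ->
  [/\ (kappa e y z <= (1 + d%:R) * norm1 y / `|y ord0 i - z ord0 i / z ord0 j * y ord0 j|)%R &
      (`|y ord0 i - z ord0 i / z ord0 j * y ord0 j| <= norm1 y)%R].
Proof.
move=> e0 ij zmax zN; set h := (_ - _)%R => h0.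
have e2 : (0 < e ^+ 2)%R by rewrite exprn_gt0.
have hp : (0 < `|h|)%R by rewrite normr_gt0.
have c1 : (`|z ord0 i / z ord0 j| <= 1)%R.
  have [->|zj] := eqVneq (z ord0 j) 0%R; first by rewrite invr0 mulr0 normr0.
  by rewrite normrM normfV ler_pdivrMr ?normr_gt0 // mul1r.
have hN : (`|h| <= norm1 y)%R.
  apply: le_trans (norm1_ge2 y ij); apply: le_trans (ler_normB _ _) _.
  by rewrite lerD2l normrM ler_piMl.
have hm : (`|z ord0 j| * `|h| = `|minor2 y z i j|)%R.
  rewrite -normrM; congr `|_|%R; rewrite /minor2 /h.
  have [zj|zj] := eqVneq (z ord0 j) 0%R; last by field.
  have := zmax i; rewrite zj normr0 normr_le0 => /eqP ->; ring.
split => //; rewrite mulrDl mul1r mulrDl; apply: lerD; first by rewrite ler_pdivlMr ?mul1r.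
have We : (0 < wedge y z + e ^+ 2)%R by rewrite ltr_wpDl ?wedge_ge0.
rewrite ler_pdivrMr // mulrAC ler_pdivlMr // -mulrA.
rewrite [leRHS](_ : _ = norm1 y * (d%:R * (wedge y z + e ^+ 2)))%R; last by ring.
rewrite ler_wpM2l ?norm1_ge0 //.
apply: (@le_trans _ _ (d%:R * `|z ord0 j| * `|h|)%R); first by rewrite ler_wpM2r.
rewrite -mulrA hm ler_wpM2l //; apply: le_trans (minor2_le_wedge _ _ _ _) _.
by rewrite lerDl ltW.
Qed.

(* Chosen so that the exponents 1/2 (once) and [leaf_exp] (d - 1 times) add up to
   the exponent d - 1 of [leaf_weight]; it is less than 1. *)
Definition leaf_exp : R := ((2 * (d.-1)%:R - 1) / (2 * (d.-1)%:R))%R.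

(** Put D = d - 1 and take the geometric mean of the D bounds of [kappa_le]: every h_i receives the
    exponent (D + 1) / (2 D), and |y|^-((D - 1) / 2) is left. As |y_j| and all |h_i| are at most
    |y|, an exponent 1/2 of it is given to y_j and the rest, (D - 2) / 2, is spread evenly over the
    h_i. Here D >= 2 is needed. *)
Lemma leaf_pointwise e y z j : (0 < e)%R ->
  (forall k, `|z ord0 k| <= `|z ord0 j|)%R ->
  (norm1 z <= d%:R * `|z ord0 j|)%R ->
  negpow (d.-1)%:R (norm1 y) * (kappa e y z `^ (d%:R / 2))%:E <=
  ((1 + d%:R) `^ (d%:R / 2))%:E * (negpow 2^-1 (y ord0 j) *
    \prod_(i <- [seq i <- enum 'I_d | i != j])
      negpow leaf_exp (y ord0 i - z ord0 i / z ord0 j * y ord0 j)%R).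
Proof.
move=> e0 zmax zN; set r := [seq i <- _ | _].
pose h i := (y ord0 i - z ord0 i / z ord0 j * y ord0 j)%R.
have K0 : (0 < (1 + d%:R) `^ (d%:R / 2) :> R)%R by rewrite powR_gt0 // ltr_wpDr.
have pr_gt0 (s : seq 'I_d) : 0 < \prod_(i <- s) negpow leaf_exp (h i).
  elim: s => [|i s IH]; first by rewrite big_nil.
  by rewrite big_cons mule_gt0 ?negpow_gt0.
(* Where a factor on the right is infinite there is nothing to prove; elsewhere the inequality is
   checked on logarithms. *)
have [yj|yj] := eqVneq (y ord0 j) 0%R.
  rewrite (_ : negpow 2^-1 (y ord0 j) = +oo); last by rewrite yj negpow_0.
  by rewrite gt0_mulye; [rewrite gt0_muley ?lte_fin // leey|exact: pr_gt0].
have [hr|] := boolP (all (fun i => h i != 0%R) r); last first.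
  case/allPn => i ir; rewrite negbK => /eqP hi.
  rewrite (big_rem i) //= -/(h i) (_ : negpow leaf_exp (h i) = +oo); last by rewrite hi negpow_0.
  rewrite gt0_mulye; last exact: pr_gt0.
  by rewrite gt0_muley ?negpow_gt0 // gt0_muley ?lte_fin // leey.
have ypos : (0 < `|y ord0 j|)%R by rewrite normr_gt0.
have Npos : (0 < norm1 y)%R := lt_le_trans ypos (norm1_ge y j).
have kpos : (0 < kappa e y z)%R := lt_le_trans ltr01 (kappa_ge1 e y z).
pose D : R := (d.-1)%:R.
have dD : d%:R = (D + 1)%R :> R by rewrite /D natr1 prednK //; exact: leq_trans d3.
have D2 : (2 <= D)%R by rewrite /D ler_nat -ltnS prednK //; exact: leq_trans d3.
have rD : (size r)%:R = D.
  rewrite /D size_filter -(@eq_count _ (predC1 j)) //; congr (_%:R)%R.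
  have := count_predC (pred1 j) (enum 'I_d); rewrite size_enum_ord.
  have -> : count (pred1 j) (enum 'I_d) = 1%N.
    by rewrite count_uniq_mem ?enum_uniq // mem_enum.
  by rewrite add1n => cd; rewrite -[in RHS]cd.
pose S := (\sum_(i <- r) ln `|h i|)%R.
have hrP i : i \in r -> (0 < `|h i|)%R by move=> /(allP hr); rewrite normr_gt0.
have rj i : i \in r -> i != j by rewrite mem_filter => /andP[].
have -> : \prod_(i <- r) negpow leaf_exp (h i) = (expR (- leaf_exp * S))%:E.
  rewrite /S mulr_sumr expR_sum -prodEFin; apply: eq_big_seq => i ir.
  by rewrite /negpow (negbTE (allP hr _ ir)) /powR gt_eqF ?hrP.
rewrite /negpow (negbTE yj) (gt_eqF Npos) -!EFinM lee_fin /powR.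
have d1 : (0 < 1 + d%:R :> R)%R by rewrite ltr_wpDr.
rewrite (gtr0_norm Npos) (gt_eqF Npos) (gt_eqF kpos) (gt_eqF d1) (gt_eqF ypos).
rewrite -!expRD ler_expR -/D dD.
set lN := ln (norm1 y); set lk := ln (kappa _ _ _); set l1 := ln (1 + _)%R.
have Sle : (S <= D * lN)%R.
  rewrite -rD -[X in (X%:R)%R]sum1_size natr_sum mulr_suml /S !big_seq.
  apply: ler_sum => i ir; rewrite mul1r /lN ler_ln ?posrE ?hrP //.
  by have [] := kappa_le (y := y) e0 (rj _ ir) zmax zN (allP hr _ ir).
have lkle : (D * lk <= D * (l1 + lN) - S)%R.
  rewrite -{1 2}rD -[X in (X%:R)%R]sum1_size natr_sum !mulr_suml /S -sumrB !big_seq.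
  apply: ler_sum => i ir; rewrite !mul1r /lk /l1 /lN -dD.
  rewrite -lnM ?posrE // -ln_div ?posrE ?mulr_gt0 ?hrP //.
  rewrite ler_ln ?posrE ?divr_gt0 ?mulr_gt0 ?hrP //.
  by have [] := kappa_le (y := y) e0 (rj _ ir) zmax zN (allP hr _ ir).
have lyN : (ln `|y ord0 j| <= lN)%R by rewrite ler_ln ?posrE // norm1_ge.
have D0 : D != 0%R by rewrite gt_eqF // (lt_le_trans _ D2).
(* The mean of the ln |h_i|; averaging the bounds of [kappa_le] gives lk <= l1 + lN - u. *)
pose u := (S / D)%R.
have Su : S = (D * u)%R by rewrite /u mulrCA divff // mulr1.
have Dp : (0 < D)%R by rewrite (lt_le_trans _ D2).
have uN : (u <= lN)%R by rewrite -(ler_pM2l Dp) -Su.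
have ku : (lk <= l1 + lN - u)%R by rewrite -(ler_pM2l Dp) mulrBr -Su.
have -> : (- leaf_exp * S = - (D - 2^-1) * u)%R by rewrite Su /leaf_exp -/D; field.
have : (0 <= (D - 2) * (lN - u))%R by rewrite mulr_ge0 // subr_ge0.
have : (0 <= (D + 1) * (l1 + lN - u - lk))%R.
  by rewrite mulr_ge0 ?subr_ge0 // addr_ge0 ?(ltW Dp).
by move: lyN; set ly := ln _; lra.
Qed.

End LeafBound.

Section LeafIntegral.
Variables (R : realType) (d : nat).
Hypothesis d3 : (3 <= d)%N.

Lemma leaf_exp01 : (0 <= leaf_exp R d < 1)%R.
Proof.
have D2 : (2 <= (d.-1)%:R :> R)%R.
  by rewrite ler_nat -ltnS prednK //; exact: leq_trans d3.
rewrite /leaf_exp; move: ((d.-1)%:R)%R D2 => D D2.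
have D0 : (0 < 2 * D)%R by lra.
rewrite ltr_pdivrMr // mul1r divr_ge0 /=; lra.
Qed.

(** The coordinate y_j is outermost. Once it is fixed, every h_i is a translate of y_i, and the
    one-dimensional bounds are uniform in the translation, hence in z. *)
Lemma leaf_integral : exists2 C : R, (0 <= C)%R &
  forall e z g, (0 < e)%R ->
  lint (enum 'I_d) (fun y => leaf_fun e (rowv y) z) g <= C%:E.
Proof.
have half01 : (0 <= (2^-1 : R) < 1)%R by lra.
have [C1 C10 HC1] := integral_e4_negpow half01.
have [C2 C20 HC2] := integral_e4_negpow leaf_exp01.
pose K : R := ((1 + d%:R) `^ (d%:R / 2))%R.
have K0 : (0 <= K)%R by exact: powR_ge0.
exists (K * (C1 * C2 ^+ d.-1))%R; first by rewrite !mulr_ge0 ?exprn_ge0.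
move=> e z g e0.
have j0 : 'I_d by apply: (@Ordinal _ 0); exact: leq_trans d3.
have [j [zN zmax]] := @sum_le_max R _ (fun k => `|z ord0 k|%R) j0.
rewrite card_ord in zN.
pose r := [seq i <- enum 'I_d | i != j].
pose s := j :: r.
have us : uniq s by rewrite /= mem_filter eqxx filter_uniq ?enum_uniq.
have ps : perm_eq (enum 'I_d) s.
  apply: uniq_perm => //; first exact: enum_uniq.
  by move=> k; rewrite mem_enum in_cons mem_filter mem_enum andbT; case: (k == j).
pose phi i (y : 'I_d -> R) : \bar R := (e4 (y i))%:E *
  (if i == j then negpow 2^-1 (y j) else negpow (leaf_exp R d) (y i - z ord0 i / z ord0 j * y j)%R).
have phi0 i y : 0 <= phi i y.
  by rewrite mule_ge0 ?lee_fin ?e4_ge0 //; case: ifP => _; exact: negpow_ge0.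
have mphi i : coord_measurable (phi i).
  move=> disp T h mh; apply: emeasurable_funM.
    apply/measurable_EFinP; exact: measurableT_comp (@measurable_e4 R) (mh i).
  case: (i == j); apply: (measurableT_comp (measurable_negpow _)); first exact: mh.
  by apply: measurable_funB => //; exact: measurable_funM.
pose C i := if i == j then C1 else C2.
have main : lint s (fun y => \prod_(i <- s) phi i y) g <= (\prod_(i <- s) C i)%:E.
  apply: lint_prod_le => //.
  - by move=> i; rewrite /C; case: ifP.
  - move=> i y _; rewrite /phi /C; case: (eqVneq i j) => [->|ij].
      apply: le_trans (HC1 0%R); rewrite le_eqVlt; apply/predU1P; left.
      by apply: eq_integral => w _; rewrite !upd_eq subr0.
    apply: le_trans (HC2 (z ord0 i / z ord0 j * y j)%R).
    rewrite le_eqVlt; apply/predU1P; left; apply: eq_integral => w _.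
    by rewrite upd_eq /upd eq_sym (negbTE ij).
  - move=> i k y w is_ ks ik.
    have jk : (j == k) = false by apply/eqP => jk; rewrite -jk /= eqxx ltn0 in ik.
    have ik' : (i == k) = false by apply/eqP => ik'; rewrite ik' ltnn in ik.
    by rewrite /phi /upd jk ik'.
have mleaf : coord_measurable (fun y : 'I_d -> R => leaf_fun e (rowv y) z).
  exact: (@row_measurable_rowv R d (fun y => leaf_fun e y z) (row_measurable_leaf_fun e z)).
have mprod : coord_measurable (fun y => \prod_(i <- s) phi i y).
  exact: coord_measurable_prod.
have prod0 y : 0 <= \prod_(i <- s) phi i y by apply: prode_ge0 => i _; exact: phi0.
rewrite (lint_perm _ _ mleaf (enum_uniq _) ps); last by move=> y; exact: leaf_fun_ge0.
apply: (@le_trans _ _ (K%:E * lint s (fun y => \prod_(i <- s) phi i y) g)); last first.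
  rewrite EFinM; apply: lee_wpmul2l; first by rewrite lee_fin.
  apply: le_trans main _; rewrite lee_fin big_cons /C eqxx.
  rewrite (eq_big_seq (fun=> C2)) => [|i]; last by rewrite mem_filter => /andP[/negbTE ->].
  rewrite big_const_seq iter_mulr_1 count_predT.
  suff -> : size r = d.-1 by [].
  by have := perm_size ps; rewrite size_enum_ord /= => sr; rewrite [in RHS]sr.
rewrite -lintZl //; apply: le_lint => //.
- by move=> y; exact: leaf_fun_ge0.
- by apply: coord_measurableM => // disp T h mh; exact: measurable_cst.
move=> y; rewrite /leaf_fun /leaf_weight -muleA.
have -> : \prod_(i <- s) phi i y = (gauss4 (rowv y))%:E * (negpow 2^-1 (y j) *
    \prod_(i <- r) negpow (leaf_exp R d) (y i - z ord0 i / z ord0 j * y j)%R).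
  rewrite /phi big_split /= prodEFin; congr (_%:E * _).
    rewrite gauss4E -big_enum /= (perm_big _ ps); apply: eq_bigr => i _.
    by rewrite mxE.
  rewrite big_cons eqxx; congr (_ * _); apply: eq_big_seq => i.
  by rewrite mem_filter => /andP[/negbTE ->].
rewrite [leRHS]muleCA; apply: lee_wpmul2l; first by rewrite lee_fin expR_ge0.
have := @leaf_pointwise R d d3 e (rowv y) z j e0 zmax zN; rewrite !mxE => H.
apply: le_trans H _; rewrite le_eqVlt; apply/predU1P; left; congr (_ * (_ * _)).
by apply: eq_bigr => i _; rewrite mxE.
Qed.

End LeafIntegral.

(** * Choosing a vertex whose deletion is cheap, by averaging *)

Section AveragedElimination.
Local Open Scope ring_scope.
Variables (R : realType) (V : finType) (adj : rel V).
Hypothesis adj_irr : irreflexive adj.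
Implicit Types (S : {set V}) (w : V -> V -> R).

(* The weights 1 / (degin + 1) are such that, for v uniformly random in S,
   [wsum S w - wsum (S :\ v) w] has the same mean as the average of [w v] over
   the neighbours of v in S. *)
Definition degin S a : nat := #|[set b in S | adj a b]|.

Definition wsum S w : R := \sum_(a in S) \sum_(b in S | adj a b) w a b / (degin S a).+1%:R.

Lemma degin_setD1 S a v : v \in S -> (degin S a = degin (S :\ v) a + adj a v)%N.
Proof.
move=> vS; rewrite /degin (cardsD1 v [set b in S | adj a b]) inE vS /= addnC.
congr (_ + _)%N; apply: eq_card => b; rewrite !inE.
by case: (b == v).
Qed.

(** With D = [degin S a], deleting v turns the weight 1 / (D + 1) of a into 1 / D if v is a
    neighbour of a, and leaves it unchanged otherwise. The sum over all v in S is 1 + (|S| - D) / (D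
    + 1); then the terms of v = a and v = b are taken out. *)
Lemma sum_degin S a b : a \in S -> b \in S -> adj a b ->
  \sum_(v in S | (v != a) && (v != b)) (degin (S :\ v) a).+1%:R^-1 + (degin S a)%:R^-1
  = #|S|%:R / (degin S a).+1%:R :> R.
Proof.
move=> aS bS ab; pose D := degin S a.
have D0 : (0 < D)%N by apply/card_gt0P; exists b; rewrite inE bS.
have ba : b != a by apply: contraTneq ab => ->; rewrite adj_irr.
pose F v : R := if adj a v then D%:R^-1 else D.+1%:R^-1.
have FE v : v \in S -> (degin (S :\ v) a).+1%:R^-1 = F v.
  move=> vS; rewrite /F /D (degin_setD1 a vS); case: (adj a v).
    by rewrite addn1.
  by rewrite addn0.
have tot : \sum_(v in S) F v = 1 + (#|S| - D)%:R / D.+1%:R.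
  rewrite (bigID (adj a)) /=; congr (_ + _).
    rewrite (eq_bigr (fun=> D%:R^-1)) => [|v /andP[_ av]]; last by rewrite /F av.
    rewrite sumr_const (_ : #|_| = D); last by apply: eq_card => v; rewrite !inE.
    by rewrite -[LHS]mulr_natr mulVf // pnatr_eq0 -lt0n.
  rewrite (eq_bigr (fun=> D.+1%:R^-1)) => [|v /andP[_ av]]; last by rewrite /F (negbTE av).
  rewrite sumr_const -[LHS]mulr_natl; congr (_%:R * _).
  rewrite -(cardsID [set v | adj a v] S).
  have -> : #|S :&: [set v | adj a v]| = D by apply: eq_card => v; rewrite !inE.
  by rewrite addKn; apply: eq_card => v; rewrite !inE andbC.
have DS : (D < #|S|)%N.
  rewrite (cardsD1 a) aS add1n ltnS; apply: subset_leq_card; apply/fintype.subsetP => v.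
  by rewrite !inE => /andP[-> av]; rewrite andbT; apply: contraTneq av => ->; rewrite adj_irr.
rewrite (eq_bigr F) => [|v /andP[vS _]]; last exact: FE.
move: tot; rewrite (bigD1 a) //= (bigD1 b) /=; last by rewrite bS ba.
rewrite {1}/F adj_irr {1}/F ab natrB; last exact: ltnW.
rewrite (eq_bigl (fun v => (v \in S) && ((v != a) && (v != b)))); last first.
  by move=> v; rewrite andbA.
set T := \sum_(_ | _) _ => tot.
have -> : T = 1 + (#|S|%:R - D%:R) / D.+1%:R - D.+1%:R^-1 - D%:R^-1 by rewrite -tot; ring.
have d1 : D%:R != 0 :> R by rewrite pnatr_eq0 -lt0n.
have d2 : D%:R + 1 != 0 :> R by rewrite natr1 pnatr_eq0.
by rewrite -/D -natr1; field; rewrite d1 d2.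
Qed.

(** Compare the coefficients of [w a b]: the pair survives the deletion of every v outside {a, b},
    and v = a contributes it through the average over neighbours. [sum_degin] adds these up. *)
Lemma wsum_average S w :
  #|S|%:R * wsum S w = \sum_(v in S) ((\sum_(b in S | adj v b) w v b) / (degin S v)%:R
                                      + wsum (S :\ v) w).
Proof.
rewrite big_split /=.
have -> : \sum_(v in S) wsum (S :\ v) w = \sum_(a in S) \sum_(b in S | adj a b)
    w a b * \sum_(v in S | (v != a) && (v != b)) (degin (S :\ v) a).+1%:R^-1.
  transitivity (\sum_(v in S) \sum_(a in S) \sum_(b in S | adj a b)
      (if (v != a) && (v != b) then w a b / (degin (S :\ v) a).+1%:R else 0)).
    apply: eq_bigr => v vS; rewrite /wsum.
    rewrite [RHS](bigD1 v) //= [X in _ = X + _]big1 ?add0r => [|b _]; last by rewrite eqxx.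
    rewrite (eq_bigl (fun a => (a \in S) && (a != v))) => [|a]; last first.
      by rewrite !inE andbC.
    apply: eq_bigr => a /andP[aS av]; rewrite -big_mkcondr /=.
    apply: eq_big => [b|b _]; last by [].
    rewrite !inE [v == a]eq_sym av [v == b]eq_sym.
    by case: (b == v); case: (b \in S); case: (adj a b).
  rewrite exchange_big /=; apply: eq_bigr => a aS.
  rewrite exchange_big /=; apply: eq_bigr => b _.
  by rewrite -big_mkcondr /= mulr_sumr.
rewrite -big_split /= /wsum mulr_sumr; apply: eq_bigr => a aS.
rewrite mulr_suml -big_split /= mulr_sumr; apply: eq_bigr => b /andP[bS ab].
rewrite -mulrDr [in RHS]addrC sum_degin //; ring.
Qed.

(** Some v does at least as well as the mean over S, and then some neighbour of v at least as well
    as the mean over its neighbours. The first alternative is the case of a vertex without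
    neighbours in S. *)
Lemma wsum_elim S w : S != finset.set0 -> exists2 v, v \in S &
  wsum S w <= wsum (S :\ v) w \/
  exists u, [/\ u \in S, u != v & wsum S w <= w v u + wsum (S :\ v) w].
Proof.
move=> S0; have cS : (0 < #|S|)%N by rewrite card_gt0.
pose Z v := (\sum_(b in S | adj v b) w v b) / (degin S v)%:R + wsum (S :\ v) w.
have [v vS vZ] : exists2 v, v \in S & wsum S w <= Z v.
  have [/exists_inP[v vS vZ]|] := boolP [exists v in S, wsum S w <= Z v]; first by exists v.
  rewrite negb_exists_in => /forall_inP H.
  have : \sum_(v in S) Z v < \sum_(v in S) wsum S w.
    apply: ltr_sum => [|v vS]; last by rewrite ltNge H.
    by apply/hasP; have /finset.set0Pn[v vS] := S0; exists v; rewrite ?mem_index_enum.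
  by rewrite sumr_const -mulr_natl wsum_average ltxx.
exists v => //; have [D0|D0] := posnP (degin S v).
  by left; apply: le_trans vZ _; rewrite /Z D0 invr0 mulr0 add0r.
right.
have [/exists_inP[u uN uw]|] := boolP [exists u in [set b in S | adj v b],
    (\sum_(b in S | adj v b) w v b) / (degin S v)%:R <= w v u].
  move: uN; rewrite inE => /andP[uS vu]; exists u; split => //.
    by apply: contraTneq vu => ->; rewrite adj_irr.
  by apply: le_trans vZ _; rewrite lerD2r.
rewrite negb_exists_in => /forall_inP H; exfalso.
have : \sum_(u in [set b in S | adj v b]) w v u <
    \sum_(u in [set b in S | adj v b]) (\sum_(b in S | adj v b) w v b) / (degin S v)%:R.
  apply: ltr_sum => [|u uN]; last by rewrite ltNge H.
  by apply/hasP; have /card_gt0P[u uN] := D0; exists u; rewrite ?mem_index_enum.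
rewrite sumr_const -[X in _ < X]mulr_natl -/(degin S v) mulrCA divff ?mulr1 ?pnatr_eq0 -?lt0n //.
rewrite (eq_bigl (fun b => (b \in S) && adj v b)) ?ltxx // => b.
by rewrite inE.
Qed.

End AveragedElimination.

Lemma coord_measurable_block (R : realType) (W : finType) (d : nat) (v : W)
    (f : (W * 'I_d -> R) -> \bar R) : (forall g, 0 <= f g) -> coord_measurable f ->
  coord_measurable (fun g => lint (enum 'I_d) (fun y => f (glue g v y)) (fun j => g (v, j))).
Proof.
move=> f0 mf; have := @coord_measurable_lint _ _ [seq (v, j) | j <- enum 'I_d] _ f0 mf.
by congr coord_measurable; apply/funext => g; exact: lint_glue.
Qed.

Lemma lee_sum_term (R : realType) (J : finType) (P : pred J) (F : J -> \bar R) j :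
  P j -> (forall i, 0 <= F i) -> F j <= \sum_(i | P i) F i.
Proof. by move=> Pj F0; rewrite (bigD1 j) //= leeDl // sume_ge0. Qed.

Lemma lint_sum (R : realType) (I : eqType) (J : Type) (r : seq J) (P : pred J) (s : seq I)
    (F : J -> (I -> R) -> \bar R) (g : I -> R) :
  (forall j g, 0 <= F j g) -> (forall j, coord_measurable (F j)) ->
  lint s (fun g => \sum_(j <- r | P j) F j g) g = \sum_(j <- r | P j) lint s (F j) g.
Proof.
move=> F0 mF; under eq_lint do rewrite -big_filter; rewrite -[RHS]big_filter.
elim: s g => //= i s IH g; under eq_integral do rewrite IH.
rewrite ge0_integral_sum //.
- by move=> j; apply: coord_measurable_section; apply: coord_measurable_lint.
- by move=> j z _; exact: lint_ge0.
Qed.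

Section VertexIntegral.
Variables (R : realType) (d : nat).
Hypothesis d3 : (3 <= d)%N.
Variables (W V : finType) (io : V -> W) (adj : rel V).
Hypothesis io_inj : injective io.
Hypothesis adj_irr : irreflexive adj.
Implicit Types (S : {set V}) (a : W -> 'rV[R]_d) (g : W * 'I_d -> R).

Definition logk e a u v : R := ln (kappa e (a (io u)) (a (io v))).

Definition wsum_exp e S a : R := expR (d%:R / 2 * wsum adj S (logk e a)).

Definition vertex_fun e S a : \bar R :=
  (\prod_(v in S) leaf_weight (a (io v))) * (wsum_exp e S a)%:E.

(** The index u = v encodes the alternative of [wsum_elim] in which no kappa is paid, as
    [kappa e y 0] is 1. *)
Definition vertex_term e S v u a : \bar R :=
  vertex_fun e (S :\ v) a * leaf_fun e (a (io v)) (if u == v then 0%R else a (io u)).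

Lemma vertex_fun_ge0 e S a : 0 <= vertex_fun e S a.
Proof.
rewrite mule_ge0 ?lee_fin ?expR_ge0 //; apply: prode_ge0 => v _.
exact: leaf_weight_ge0.
Qed.

Lemma vertex_term_ge0 e S v u a : 0 <= vertex_term e S v u a.
Proof. by rewrite mule_ge0 ?vertex_fun_ge0 ?leaf_fun_ge0. Qed.

Lemma cfg_measurable_vertex_fun e S : cfg_measurable (vertex_fun e S).
Proof.
move=> disp T h mh; apply: emeasurable_funM.
  apply: measurable_bigop => [f1 f2|v _]; first exact: emeasurable_funM.
  by apply: row_measurable_leaf_weight => j; exact: mh.
apply/measurable_EFinP; apply: measurableT_comp => //; apply: measurable_funM => //.
apply: measurable_sumP => u _; apply: measurable_sumP => v _; apply: measurable_funM => //.
apply: (measurableT_comp (@measurable_ln R)).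
by apply: measurable_kappa => j; exact: mh.
Qed.

Lemma cfg_measurable_vertex_term e S v u : cfg_measurable (vertex_term e S v u).
Proof.
move=> disp T h mh; apply: emeasurable_funM; first exact: cfg_measurable_vertex_fun.
apply: emeasurable_funM; first by apply: row_measurable_leaf_weight => j; exact: mh.
apply/measurable_EFinP; apply: (measurableT_comp (measurable_powR _)).
by apply: measurable_kappa => j; case: (u == v) => //; exact: mh.
Qed.

Lemma kappa_0 e (y : 'rV[R]_d) : kappa e y 0 = 1%R.
Proof.
rewrite /kappa (_ : norm1 0 = 0%R) ?mulr0 ?mul0r ?addr0 //.
by rewrite /norm1 big1 // => i _; rewrite mxE normr0.
Qed.

(** The pair (v, u) provided by [wsum_elim] depends on the configuration; summing over all pairs
    makes the bound hold for every configuration at once. *)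
Lemma vertex_fun_le_terms e S a : S != finset.set0 ->
  vertex_fun e S a <= \sum_(v in S) \sum_u vertex_term e S v u a.
Proof.
move=> S0; suff [v vS [u le_uv]] : exists2 v, v \in S &
  exists u, vertex_fun e S a <= vertex_term e S v u a.
  apply: le_trans le_uv (le_trans (lee_sum_term (F := fun u => vertex_term e S v u a) _ _) _).
  - exact: isT.
  - by move=> i; exact: vertex_term_ge0.
  apply: (lee_sum_term (F := fun v => \sum_u vertex_term e S v u a) vS) => i.
  by apply: sume_ge0 => j _; exact: vertex_term_ge0.
have [v vS H] := wsum_elim adj_irr (logk e a) S0; exists v => //.
have X0 : 0 <= \prod_(i in S :\ v) leaf_weight (a (io i)).
  by apply: prode_ge0 => i _; exact: leaf_weight_ge0.
suff [u Xu] : exists u, (wsum_exp e S a <= wsum_exp e (S :\ v) a *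
    kappa e (a (io v)) (if u == v then 0%R else a (io u)) `^ (d%:R / 2))%R.
  exists u; rewrite /vertex_fun /vertex_term /vertex_fun /leaf_fun (bigD1 v) //=.
  rewrite (eq_bigl (fun i => i \in S :\ v)) => [|i]; last by rewrite !inE andbC.
  rewrite [leRHS]muleACA -EFinM (muleC (leaf_weight _)); apply: lee_wpmul2l.
    by rewrite mule_ge0 ?leaf_weight_ge0.
  by rewrite lee_fin.
have d20 : (0 <= d%:R / 2 :> R)%R by rewrite divr_ge0.
case: H => [H|[u [uS uv H]]].
  exists v; rewrite eqxx kappa_0 powR1 mulr1 ler_expR ler_wpM2l //.
exists u; rewrite (negbTE uv) /powR gt_eqF ?(lt_le_trans ltr01 (kappa_ge1 _ _ _)) //.
by rewrite -expRD ler_expR -mulrDr ler_wpM2l // addrC.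
Qed.

Lemma eq_vertex_fun e S a b : (forall v, v \in S -> a (io v) = b (io v)) ->
  vertex_fun e S a = vertex_fun e S b.
Proof.
move=> ab; rewrite /vertex_fun; congr (_ * (expR (_ * _))%:E).
  by apply: eq_bigr => v vS; rewrite ab.
apply: eq_bigr => u uS; apply: eq_bigr => v /andP[vS _].
by rewrite /logk !ab.
Qed.

Lemma vertex_integral : exists2 C : R, (0 <= C)%R & forall S e s g, (0 < e)%R ->
  uniq s -> (forall z, (z \in s) = [exists v in S, z.1 == io v]) ->
  lint s (fun g => vertex_fun e S (cfg g)) g <= (C ^+ #|S|)%:E.
Proof.
have [C C0 HC] := @leaf_integral R d d3.
(* A bound for the number of pairs (v, u); each deletion costs the constant of [leaf_integral] times
   this number. *)
pose N : R := (#|V| * #|V|)%:R.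
exists (C * N)%R; first by rewrite mulr_ge0.
move=> S; move: {2}#|S| (erefl #|S|) => n; elim: n S => [|n IH] S cS e s g e0 us sS.
  have S0 : S = finset.set0 by apply/eqP; rewrite -cards_eq0 cS.
  have -> : s = [::].
    case: s sS {us} => // z s /(_ z); rewrite mem_head S0 => /esym/existsP[v].
    by rewrite inE.
  rewrite /= S0 cards0 expr0 /vertex_fun big1 => [|v]; last by rewrite inE.
  rewrite /wsum_exp /wsum big1 => [|v]; last by rewrite inE.
  by rewrite mulr0 expR0 mule1.
have S0 : S != finset.set0 by rewrite -card_gt0 cS.
have mv v u : coord_measurable (fun g => vertex_term e S v u (cfg g)).
  exact: coord_measurable_cfg (cfg_measurable_vertex_term e S v u).
have mF S' : coord_measurable (fun g => vertex_fun e S' (cfg g)).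
  exact: coord_measurable_cfg (cfg_measurable_vertex_fun e S').
have tN v u g' : v \in S ->
    lint s (fun g => vertex_term e S v u (cfg g)) g' <= (C * (C * N) ^+ n)%:E.
  move=> vS; have sv j : (io v, j) \in s by rewrite sS; apply/existsP; exists v; rewrite vS eqxx.
  rewrite (lint_block _ us sv) //; last by move=> h; exact: vertex_term_ge0.
  set s' := [seq z <- s | z.1 != io v].
  have us' : uniq s' by exact: filter_uniq.
  have s'S z : (z \in s') = [exists u in S :\ v, z.1 == io u].
    rewrite mem_filter sS; apply/andP/existsP => [[zv /existsP[w /andP[wS /eqP zw]]]|[w]].
      exists w; rewrite zw eqxx andbT !inE wS andbT.
      by apply: contraNneq zv => wv; rewrite zw wv.
    rewrite !inE => /andP[/andP[wv wS] /eqP ->]; split; first by rewrite (inj_eq io_inj).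
    by apply/existsP; exists w; rewrite wS eqxx.
  have cS' : #|S :\ v| = n by have := cardsD1 v S; rewrite vS cS add1n => -[].
  apply: (@le_trans _ _ (C%:E * lint s' (fun g => vertex_fun e (S :\ v) (cfg g)) g')); last first.
    rewrite EFinM; apply: lee_wpmul2l; first by rewrite lee_fin.
    by have := IH (S :\ v) cS' e s' g' e0 us' s'S; rewrite cS'.
  rewrite -lintZl //; last by move=> h; exact: vertex_fun_ge0.
  apply: le_lint.
  - by move=> h; apply: lint_ge0 => y; exact: vertex_term_ge0.
  - exact: (@coord_measurable_block R W d (io v) (fun g => vertex_term e S v u (cfg g))
      (fun g => vertex_term_ge0 e S v u (cfg g)) (mv v u)).
  - by apply: coord_measurableM => // disp T h mh; exact: measurable_cst.
  move=> h.
  pose z := if u == v then 0%R else cfg h (io u).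
  have tE y : vertex_term e S v u (cfg (glue h (io v) y)) =
      vertex_fun e (S :\ v) (cfg h) * leaf_fun e (rowv y) z.
    have vE : vertex_fun e (S :\ v) (upd (cfg h) (io v) (rowv y)) = vertex_fun e (S :\ v) (cfg h).
      apply: eq_vertex_fun => w; rewrite !inE => /andP[wv _].
      by rewrite /upd (inj_eq io_inj) (negbTE wv).
    rewrite cfg_glue /vertex_term (upd_eq (cfg h) (io v)) vE /z; case: (eqVneq u v) => [//|uv].
    by rewrite /upd (inj_eq io_inj) (negbTE uv).
  under eq_lint do rewrite tE.
  rewrite lintZl ?vertex_fun_ge0 //; last 2 first.
  - by move=> y; exact: leaf_fun_ge0.
  - exact: (@row_measurable_rowv R d (fun y => leaf_fun e y z) (row_measurable_leaf_fun e z)).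
  by rewrite muleC; apply: lee_wpmul2r; rewrite ?vertex_fun_ge0 // HC.
apply: (@le_trans _ _ (lint s (fun g => \sum_(v in S) \sum_u vertex_term e S v u (cfg g)) g)).
  apply: le_lint => //.
  - by move=> h; exact: vertex_fun_ge0.
  - move=> disp T h mh; apply: measurable_bigop => [f1 f2|v _]; first exact: emeasurable_funD.
    apply: measurable_bigop => [f1 f2|u _]; first exact: emeasurable_funD.
    exact: mv.
  - by move=> h; exact: vertex_fun_le_terms.
rewrite lint_sum; last 2 first.
- by move=> v h; apply: sume_ge0 => u _; exact: vertex_term_ge0.
- move=> v disp T h mh; apply: measurable_bigop => [f1 f2|u _]; first exact: emeasurable_funD.
  exact: mv.
apply: (@le_trans _ _ (\sum_(v in S) \sum_(u : V) (C * (C * N) ^+ n)%:E)).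
  apply: lee_sum => v vS; rewrite lint_sum //; last by move=> u h; exact: vertex_term_ge0.
  by apply: lee_sum => u _; exact: tN.
have X0 : (0 <= C * (C * N) ^+ n)%R by rewrite mulr_ge0 ?exprn_ge0 ?mulr_ge0.
under eq_bigr do rewrite sumEFin.
rewrite sumEFin lee_fin !sumr_const -mulrnA -mulr_natl cS exprS.
rewrite [leRHS](_ : _ = N * (C * (C * N) ^+ n))%R; last by ring.
by rewrite ler_wpM2r // /N ler_nat leq_mul2l -cS max_card orbT.
Qed.

End VertexIntegral.

Section Elimination.
Variables (R : realType) (W : finType) (d : nat).
Implicit Types (g : W * 'I_d -> R) (a : W -> 'rV[R]_d).

(** For L the set of midpoints, which are pairwise non-adjacent, so that each kernel involves a
    single vertex of L. In the induction the bound [B v] joins the factor [A], being free of the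
    vertices of L. *)
Lemma lint_eliminate (L : seq W) (s : seq (W * 'I_d)) (A : (W -> 'rV[R]_d) -> \bar R)
    (k B : W -> (W -> 'rV[R]_d) -> \bar R) g :
  uniq L -> uniq s -> (forall v j, v \in L -> (v, j) \in s) ->
  (forall a, 0 <= A a) -> cfg_measurable A ->
  (forall v a, 0 <= k v a) -> (forall v, cfg_measurable (k v)) ->
  (forall v a, 0 <= B v a) -> (forall v, cfg_measurable (B v)) ->
  (forall v a x, v \in L -> A (upd a v x) = A a) ->
  (forall u v a x, u \in L -> v \in L -> u != v -> k u (upd a v x) = k u a) ->
  (forall u v a x, u \in L -> v \in L -> B u (upd a v x) = B u a) ->
  (forall v a h, v \in L -> lint (enum 'I_d) (fun y => k v (upd a v (rowv y))) h <= B v a) ->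
  lint s (fun g => A (cfg g) * \prod_(v <- L) k v (cfg g)) g <=
  lint [seq z <- s | z.1 \notin L] (fun g => A (cfg g) * \prod_(v <- L) B v (cfg g)) g.
Proof.
move=> + + + + + k0 mk B0 mB; elim: L s A g => [|v L IH] s A g.
  move=> _ _ _ _ _ _ _ _ _; rewrite (eq_filter (a2 := xpredT)) // filter_predT.
  by rewrite le_eqVlt; apply/predU1P; left; apply: eq_lint => h; rewrite !big_nil.
move=> /= /andP[vL uL] us sL A0 mA AL kL BL kB.
have vs j : (v, j) \in s by apply: sL; rewrite mem_head.
have vvL : v \in v :: L by rewrite mem_head.
have sub u : u \in L -> u \in v :: L by rewrite inE => ->; rewrite orbT.
have mprod (F : W -> (W -> 'rV[R]_d) -> \bar R) (r : seq W) :
    (forall v, cfg_measurable (F v)) -> cfg_measurable (fun a => \prod_(u <- r) F u a).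
  move=> mF disp T h mh; apply: measurable_bigop => [f1 f2|u _]; first exact: emeasurable_funM.
  exact: mF.
have mprod2 (F1 F2 : (W -> 'rV[R]_d) -> \bar R) :
    cfg_measurable F1 -> cfg_measurable F2 -> cfg_measurable (fun a => F1 a * F2 a).
  by move=> m1 m2 disp T h mh; apply: emeasurable_funM; [exact: m1|exact: m2].
pose P a := A a * \prod_(u <- L) k u a.
have P0 a : 0 <= P a by rewrite mule_ge0 //; apply: prode_ge0 => u _.
have mP : cfg_measurable P by apply: mprod2 => //; exact: mprod.
pose F a := A a * \prod_(u <- v :: L) k u a.
have F0 a : 0 <= F a by rewrite mule_ge0 //; apply: prode_ge0 => u _.
have mF : coord_measurable (fun g => F (cfg g)).
  by apply: coord_measurable_cfg; apply: mprod2 => //; exact: mprod.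
rewrite (lint_block (f := fun g => F (cfg g)) g us vs) //.
have -> : [seq z <- s | z.1 \notin v :: L] = [seq z <- [seq z <- s | z.1 != v] | z.1 \notin L].
  by rewrite -filter_predI; apply: eq_filter => z; rewrite /= inE negb_or andbC.
set s' := [seq z <- s | z.1 != v].
have us' : uniq s' by exact: filter_uniq.
have sL' u j : u \in L -> (u, j) \in s'.
  move=> uL'; rewrite mem_filter sL ?sub // andbT /=.
  by apply: contraNneq vL => <-.
have := IH s' (fun a => A a * B v a) g uL us' sL'.
have -> : lint [seq z <- s' | z.1 \notin L]
    (fun g => A (cfg g) * \prod_(u <- v :: L) B u (cfg g)) g =
  lint [seq z <- s' | z.1 \notin L]
    (fun g => A (cfg g) * B v (cfg g) * \prod_(u <- L) B u (cfg g)) g.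
  by apply: eq_lint => h; rewrite big_cons muleA.
move=> H; apply: le_trans (H _ _ _ _ _ _); last first.
- by move=> u a h uL'; apply: kB; exact: sub.
- by move=> u w a x uL' wL; apply: BL; exact: sub.
- by move=> u w a x uL' wL; apply: kL; exact: sub.
- by move=> u a x uL'; rewrite (AL _ _ _ (sub _ uL')) (BL _ _ _ _ vvL (sub _ uL')).
- exact: mprod2.
- by move=> a; rewrite mule_ge0.
apply: le_lint.
- by move=> h; apply: lint_ge0 => y; exact: F0.
- exact: (@coord_measurable_block R W d v (fun g => F (cfg g)) (fun g => F0 (cfg g)) mF).
- apply: (@coord_measurable_cfg R W d (fun a => A a * B v a * \prod_(u <- L) k u a)).
  by apply: (mprod2 _ _ _ _); [exact: mprod2|exact: mprod].
move=> h.
have FE y : F (cfg (glue h v y)) = P (cfg h) * k v (upd (cfg h) v (rowv y)).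
  rewrite cfg_glue /F big_cons AL // /P muleCA [RHS]muleC; congr (_ * (_ * _)).
  apply: eq_big_seq => u uL'; apply: kL => //; first exact: sub.
  by apply: contraNneq vL => <-.
have -> : lint (enum 'I_d) (fun y => F (cfg (glue h v y))) (fun j => h (v, j)) =
    lint (enum 'I_d) (fun y => P (cfg h) * k v (upd (cfg h) v (rowv y))) (fun j => h (v, j)).
  by apply: eq_lint => y; exact: FE.
rewrite lintZl //; last first.
  apply: (@row_measurable_rowv R d (fun x => k v (upd (cfg h) v x))).
  by apply: upd_row_measurable.
rewrite [leRHS](_ : _ = P (cfg h) * B v (cfg h)); last first.
  by rewrite /P -!muleA; congr (_ * _); exact: muleC.
by apply: lee_wpmul2l => //; exact: kB.
Qed.

End Elimination.

(** * The subdivision *)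

Section Subdivision.
Variables (V : finType) (adj : rel V).
Hypothesis adj_sym : symmetric adj.
Hypothesis adj_irr : irreflexive adj.
Local Notation E := (edge_type adj).

Lemma edge_ends : exists xt : E -> V * V, forall s,
  adj (xt s).1 (xt s).2 /\ val s = [set (xt s).1; (xt s).2]%SET.
Proof.
suff [f fP] : {f : E -> V * V & forall s,
  adj (f s).1 (f s).2 /\ val s = [set (f s).1; (f s).2]%SET} by exists f.
apply: (@choice E (V * V)%type (fun s xt => adj xt.1 xt.2 /\ val s = [set xt.1; xt.2]%SET)).
by case=> s /= /existsP[x /existsP[t /andP[xt /eqP ->]]]; exists (x, t).
Qed.

Variable xt : E -> V * V.
Hypothesis xtP : forall s, adj (xt s).1 (xt s).2 /\ val s = [set (xt s).1; (xt s).2]%SET.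

Lemma ends_neq s : (xt s).1 != (xt s).2.
Proof.
by have [a _] := xtP s; apply: contraTneq a => ->; rewrite adj_irr.
Qed.

(** An edge with a choice of direction is an ordered pair of adjacent vertices, and [h] is this
    bijection. *)
Lemma big_edge_ends (A : Type) (idx : A) (op : Monoid.com_law idx) (F : V -> V -> A) :
  \big[op/idx]_(a : V) \big[op/idx]_(b | adj a b) F a b
  = \big[op/idx]_(s : E) op (F (xt s).1 (xt s).2) (F (xt s).2 (xt s).1).
Proof.
pose h (sb : E * bool) : V * V := if sb.2 then xt sb.1 else ((xt sb.1).2, (xt sb.1).1).
have h_inj : injective h.
  move=> [s b] [s' b'] hE.
  have vE : val s = val s'.
    have [_ ->] := xtP s; have [_ ->] := xtP s'; move: hE; rewrite /h /=.
    case: (xt s) (xt s') => [x t] [x' t'] /=.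
    by case: b b' => -[] [-> ->] //=; rewrite finset.setUC.
  have ss' : s = s' by exact: val_inj.
  rewrite -ss' in hE *; congr (_, _); move: hE (ends_neq s); rewrite /h /=.
  case: (xt s) => x t /=; case: b b' => -[] //= [xt' tx'] /eqP //.
rewrite pair_big_dep /= -big_filter.
transitivity (\big[op/idx]_(ab <- [seq h sb | sb <- index_enum (E * bool)%type]) F ab.1 ab.2).
  apply: perm_big; apply: uniq_perm.
  - by rewrite filter_uniq ?index_enum_uniq.
  - by rewrite map_inj_uniq ?index_enum_uniq.
  move=> [a b]; rewrite mem_filter mem_index_enum andbT /=.
  apply/idP/mapP => [ab|[[s c] _]].
    have sP : is_edge_set adj [set a; b]%SET.
      by apply/existsP; exists a; apply/existsP; exists b; rewrite ab eqxx.
    pose s : E := Sub [set a; b]%SET sP.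
    have [_ /= sE] := xtP s; have ne := ends_neq s.
    have ains : a \in [set (xt s).1; (xt s).2]%SET by rewrite -sE !inE eqxx.
    have bins : b \in [set (xt s).1; (xt s).2]%SET by rewrite -sE !inE eqxx orbT.
    have nab : a != b by apply: contraTneq ab => ->; rewrite adj_irr.
    move: ains bins; rewrite !inE => /orP[]/eqP aE /orP[]/eqP bE.
    - by rewrite aE bE eqxx in nab.
    - by exists (s, true); rewrite ?mem_index_enum // /h /= aE bE -surjective_pairing.
    - by exists (s, false); rewrite ?mem_index_enum // /h /= aE bE.
    - by rewrite aE bE eqxx in nab.
  have [xts _] := xtP s; rewrite /h /=; case: c => [abE|[-> ->]]; last by rewrite adj_sym.
  by move: xts; rewrite -abE.
rewrite big_map -(pair_big xpredT xpredT (fun s b => F (h (s, b)).1 (h (s, b)).2)) /=.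
by apply: eq_bigr => s _; rewrite big_bool.
Qed.

Local Open Scope ring_scope.
Variables (R : realType) (p : subdiv_vertex adj -> 'I_#|subdiv_vertex adj|).
Hypothesis p_inj : injective p.

(** On the left each edge of the subdivision occurs once, at its later end. With a symmetric kernel
    it may be charged to its midpoint instead, and the ordering disappears. *)
Lemma prod_subdiv (K : subdiv_vertex adj -> subdiv_vertex adj -> R) :
  (forall u v, K u v = K v u) ->
  \prod_(v : subdiv_vertex adj) \prod_(u in Np (@subdiv_rel V adj) p v) K v u
  = \prod_(s : E) (K (inr s) (inl (xt s).1) * K (inr s) (inl (xt s).2)).
Proof.
move=> Ksym; rewrite big_sumType /=.
have -> : \prod_(v : V) \prod_(u in Np (@subdiv_rel V adj) p (inl v)) K (inl v) u =
    \prod_(s : E) \prod_(v in val s | (p (inr s) < p (inl v))%N) K (inr s) (inl v).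
  transitivity (\prod_(v : V) \prod_(s : E | (v \in val s) && (p (inr s) < p (inl v))%N)
      K (inr s) (inl v)).
    apply: eq_bigr => v _; rewrite big_sumType /= [X in X * _]big1 ?mul1r => [|u]; last first.
      by rewrite inE.
    by apply: eq_big => [s|s _]; [rewrite inE|exact: Ksym].
  rewrite (exchange_big_dep xpredT) //=.
have -> : \prod_(s : E) \prod_(u in Np (@subdiv_rel V adj) p (inr s)) K (inr s) u =
    \prod_(s : E) \prod_(v in val s | ~~ (p (inr s) < p (inl v))%N) K (inr s) (inl v).
  apply: eq_bigr => s _; rewrite big_sumType /= [X in _ * X]big1 ?mulr1 => [|u]; last first.
    by rewrite inE.
  apply: eq_bigl => v; rewrite inE /=; congr (_ && _); rewrite -leqNgt [in RHS]leq_eqVlt.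
  (* There are no ties, since [p] is injective and a midpoint is not an original vertex. *)
  case: eqP => // pE; have /p_inj := val_inj pE; by [].
rewrite -big_split /=; apply: eq_bigr => s _; rewrite -bigID.
have [_ ->] := xtP s.
by rewrite big_setU1 ?inE ?ends_neq // big_set1.
Qed.

End Subdivision.

(** * Pointwise bounds, and assembly of the uniform bound for the subdivision *)

Section PointwiseBounds.
Variables (R : realType) (d : nat).
Implicit Types (y z : 'rV[R]_d).

Lemma gdens_rho_le M y :
  (gdens y * rho y ^+ M <= (4 * M + 1)%:R ^+ M * gauss4 y)%R.
Proof.
set t := dot y y; have t0 : (0 <= t)%R := dot_ge0 y.
(* Adding 1 gives m >= 1 even for M = 0. *)
pose m : R := (4 * M + 1)%:R.
have m0 : (0 < m)%R by rewrite ltr0n addn1.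
have m1 : (1 <= m)%R by rewrite ler1n addn1.
(* 1 + t <= m (1 + t / m) <= m exp (t / m), and M / m <= 1 / 4 *)
have rhoE : (rho y <= m * expR (t / m))%R.
  apply: (@le_trans _ _ (m * (1 + t / m))%R); last by rewrite ler_pM2l // expR_ge1Dx.
  by rewrite mulrDr mulr1 mulrCA divff ?gt_eqF // mulr1 lerD.
apply: (@le_trans _ _ (gdens y * (m * expR (t / m)) ^+ M)%R).
  by rewrite ler_wpM2l ?expR_ge0 // lerXn2r ?nnegrE ?mulr_ge0 ?expR_ge0 ?(ltW m0) //
    (le_trans ler01) // rho_ge1.
rewrite exprMn mulrCA ler_pM2l ?exprn_gt0 // -expRM_natl -expRD ler_expR -/t.
have MM : (M%:R / m <= 4^-1 :> R)%R.
  by rewrite ler_pdivrMr // /m natrD natrM mulrDr mulKf // lerDl.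
have : (M%:R / m * t <= 4^-1 * t)%R by rewrite ler_wpM2r.
rewrite -mulr_natl; lra.
Qed.

Lemma norm1_le_rho y : (norm1 y <= d%:R * rho y)%R.
Proof.
apply: (@le_trans _ _ (\sum_(j < d) rho y)%R); last by rewrite sumr_const card_ord mulr_natl.
apply: ler_sum => j _; rewrite /rho /dot (bigD1 j) //=.
set S := (\sum_(i | _) _)%R.
have S0 : (0 <= S)%R by apply: sumr_ge0 => i _; rewrite -expr2 sqr_ge0.
rewrite -expr2 -real_normK ?num_real //; set u := `| _ |%R.
have := sqr_ge0 (u - 1)%R; have := sqr_ge0 u; rewrite sqrrB1 => u2 v2; lra.
Qed.

(** A vertex of degree below d - 1 collects fewer inverse powers of its norm than [leaf_weight] has.
    The missing ones are made up by positive powers, bounded by at most d - 1 further factors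
    [d%:R * rho y]. *)
Lemma vertex_weight_le M (I : finType) (P : pred I) y : (0 < d)%N -> (#|P| <= d.-1)%N ->
  (gdens y * rho y ^+ M)%:E * \prod_(b | P b) negpow 1 (norm1 y) <=
  (d%:R ^+ d.-1 * (4 * (M + d.-1) + 1)%:R ^+ (M + d.-1))%:E * leaf_weight y.
Proof.
move=> d0 Pd; set K : R := (d%:R ^+ _ * _)%R; set m := (M + d.-1)%N.
have K0 : (0 < K)%R.
  rewrite /K; apply: mulr_gt0; apply: exprn_gt0; rewrite ltr0n ?addn1 //.
have [N0|N0] := eqVneq (norm1 y) 0%R.
  by rewrite /leaf_weight N0 !negpow_0 !gt0_muley ?lte_fin ?expR_gt0 // leey.
have Npos : (0 < norm1 y)%R by rewrite lt_neqAle eq_sym N0 norm1_ge0.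
rewrite /leaf_weight /negpow (negbTE N0) prodEFin prodr_const ger0_norm ?norm1_ge0 //.
rewrite powR_inv1 ?norm1_ge0 // powRN powR_mulrn ?norm1_ge0 // -!EFinM lee_fin.
have -> : ((norm1 y)^-1 ^+ #|P| = norm1 y ^+ (d.-1 - #|P|) * (norm1 y ^+ d.-1)^-1)%R.
  rewrite -{2}(subnK Pd) exprD invfM mulrA divff ?mul1r ?exprVn //.
  by rewrite expf_neq0.
rewrite !mulrA ler_wpM2r ?invr_ge0 ?exprn_ge0 ?norm1_ge0 //.
have r1 := rho_ge1 y; have r0 : (0 < rho y)%R by exact: lt_le_trans r1.
have d1 : (1 <= d%:R :> R)%R by rewrite ler1n.
have Nle : (norm1 y ^+ (d.-1 - #|P|) <= d%:R ^+ d.-1 * rho y ^+ d.-1)%R.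
  apply: (@le_trans _ _ ((d%:R * rho y) ^+ (d.-1 - #|P|))%R).
    by rewrite lerXn2r ?nnegrE ?norm1_ge0 ?norm1_le_rho // mulr_ge0 ?(ltW r0).
  rewrite -exprMn ler_weXn2l ?leq_subr //.
  by rewrite -[leLHS]mulr1 ler_pM.
apply: (@le_trans _ _ (gdens y * rho y ^+ M * (d%:R ^+ d.-1 * rho y ^+ d.-1))%R).
  by rewrite ler_wpM2l // mulr_ge0 ?expR_ge0 ?exprn_ge0 ?(ltW r0).
rewrite mulrCA -mulrA -exprD /K -!mulrA ler_pM2l ?exprn_gt0 ?ltr0n //.
exact: gdens_rho_le.
Qed.

Lemma inv_wedge_le e y z : (0 < e)%R ->
  ((wedge y z + e ^+ 2)^-1)%:E <= (kappa e y z)%:E * (negpow 1 (norm1 y) * negpow 1 (norm1 z)).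
Proof.
move=> e0; have k0 : (0 < kappa e y z)%R by apply: lt_le_trans (kappa_ge1 _ _ _).
have w0 : (0 < wedge y z + e ^+ 2)%R by rewrite ltr_wpDl ?wedge_ge0 ?exprn_gt0.
have [Ny|Ny] := eqVneq (norm1 y) 0%R.
  by rewrite Ny negpow_0 gt0_mulye ?negpow_gt0 // gt0_muley ?lte_fin // leey.
have [Nz|Nz] := eqVneq (norm1 z) 0%R.
  by rewrite Nz negpow_0 gt0_muley ?negpow_gt0 // gt0_muley ?lte_fin // leey.
have y0 : (0 < norm1 y)%R by rewrite lt_neqAle eq_sym Ny norm1_ge0.
have z0 : (0 < norm1 z)%R by rewrite lt_neqAle eq_sym Nz norm1_ge0.
rewrite /negpow (negbTE Ny) (negbTE Nz) !ger0_norm ?norm1_ge0 // !powR_inv1 ?norm1_ge0 //.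
rewrite -!EFinM lee_fin -invfM ler_pdivlMr ?mulr_gt0 //.
by rewrite /kappa mulrC lerDr.
Qed.

End PointwiseBounds.

Section EdgeProduct.
Variables (R : realType) (d : nat) (V : finType) (adj : rel V).
Hypothesis adj_sym : symmetric adj.
Hypothesis adj_irr : irreflexive adj.
Variable xt : edge_type adj -> V * V.
Hypothesis xtP : forall s, adj (xt s).1 (xt s).2 /\ val s = [set (xt s).1; (xt s).2]%SET.
Hypothesis deg_lt : forall v, (#|[pred w | adj v w]| < d)%N.

(** This is the origin of the exponent d/2: the oriented sum counts each edge twice, and d / (deg u
    + 1) >= 1 by the degree bound. *)
Lemma prod_kappa_le (W : finType) (io : V -> W) e (a : W -> 'rV[R]_d) :
  (\prod_s kappa e (a (io (xt s).1)) (a (io (xt s).2)) <=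
   wsum_exp io adj e [set: V]%SET a)%R.
Proof.
pose w u v : R := logk io e a u v.
have w0 u v : (0 <= w u v)%R by rewrite ln_ge0 // kappa_ge1.
have -> : (\prod_s kappa e (a (io (xt s).1)) (a (io (xt s).2)) =
    expR (\sum_s w (xt s).1 (xt s).2))%R.
  rewrite expR_sum; apply: eq_bigr => s _.
  by rewrite /w /logk lnK // posrE (lt_le_trans _ (kappa_ge1 _ _ _)).
rewrite ler_expR.
have -> : (\sum_s w (xt s).1 (xt s).2 = 2^-1 * \sum_u \sum_(v | adj u v) w u v)%R.
  rewrite (big_edge_ends adj_sym adj_irr xtP) big_distrr /=; apply: eq_bigr => s _.
  rewrite {3}/w /logk kappaC -/(logk io e a _ _) -/(w _ _); lra.
rewrite /wsum !mulr_sumr; rewrite [leRHS](eq_bigl xpredT) => [|u]; last by rewrite inE.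
apply: ler_sum => u _; rewrite !mulr_sumr [leRHS](eq_bigl (adj u)) => [|v]; last by rewrite inE.
apply: ler_sum => v _.
have dE : degin adj [set: V]%SET u = #|[pred w | adj u w]|.
  by apply: eq_card => z; rewrite !inE.
rewrite [leRHS](_ : _ = 2^-1 * w u v * (d%:R / (degin adj [set: V]%SET u).+1%:R))%R; last first.
  by rewrite -/(w u v); set c := (_.+1%:R^-1)%R; ring.
rewrite -[leLHS]mulr1 ler_wpM2l // ?mulr_ge0 // ler_pdivlMr ?ltr0n // mul1r ler_nat dE.
exact: deg_lt.
Qed.

End EdgeProduct.

Lemma lee_prod (R : realType) (I : Type) (r : seq I) (P : pred I) (f g : I -> \bar R) :
  (forall i, P i -> 0 <= f i <= g i) ->
  \prod_(i <- r | P i) f i <= \prod_(i <- r | P i) g i.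
Proof.
move=> fg; suff /andP[] : 0 <= \prod_(i <- r | P i) f i <= \prod_(i <- r | P i) g i by [].
elim/big_ind2: _ => [|x1 x2 y1 y2 /andP[x0 x12] /andP[y0 y12]|//].
  by rewrite lexx lee_fin ler01.
by rewrite mule_ge0 // lee_pmul.
Qed.

Section SubdivisionBound.
Variables (R : realType) (d : nat) (V : finType) (adj : rel V).
Hypothesis d3 : (3 <= d)%N.
Hypothesis adj_sym : symmetric adj.
Hypothesis adj_irr : irreflexive adj.
Hypothesis deg_lt : forall v, (#|[pred w | adj v w]| < d)%N.
Variable xt : edge_type adj -> V * V.
Hypothesis xtP : forall s, adj (xt s).1 (xt s).2 /\ val s = [set (xt s).1; (xt s).2]%SET.
Local Notation W := (subdiv_vertex adj).
Implicit Types (a : W -> 'rV[R]_d).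

Definition vmass (y : 'rV[R]_d) : R := (gdens y * rho y ^+ #|W|)%R.

Lemma vmass_ge0 y : (0 <= vmass y)%R.
Proof. by rewrite mulr_ge0 ?expR_ge0 ?exprn_ge0 // (le_trans ler01) ?rho_ge1. Qed.

Lemma measurable_vmass disp (T : measurableType disp) (h : T -> 'rV[R]_d) :
  (forall j, measurable_fun [set: T] (fun x => h x ord0 j)) ->
  measurable_fun [set: T] (fun x => vmass (h x)).
Proof.
move=> mh; apply: measurable_funM; first exact: measurable_gdens.
by apply: measurable_funX; apply: measurable_funD => //; exact: measurable_dot.
Qed.

Definition edge_const : R := ((4 * #|W| + 1)%:R ^+ #|W|)%R.

Definition edge_kernel e (w : W) a : \bar R :=
  if w is inr s then
    (edge_const * edge_fun e (a (inl (xt s).1)) (a (inl (xt s).2)) (a (inr s)))%:E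
  else 0.

Definition edge_bound (C e : R) (w : W) a : \bar R :=
  if w is inr s then
    (C / (wedge (a (inl (xt s).1)) (a (inl (xt s).2)) + e ^+ 2))%:E
  else 0.

Local Notation midpoints := [seq (inr s : W) | s <- enum {: edge_type adj}].

(** At the midpoints the powers of [rho] are absorbed right away. At the original vertices they are
    kept in [vmass], because [vertex_weight_le] will add further powers before the Gaussian absorbs
    them all. *)
Lemma process_integrand_le e p a : injective p -> (0 < e)%R ->
  ((\prod_v gdens (a v)) * (\prod_v vertex_kernel (@subdiv_rel V adj) p e a v) * rhoprod a)%:E
  <= (\prod_(v : V) vmass (a (inl v)))%:E * \prod_(w <- midpoints) edge_kernel e w a.
Proof.
move=> p_inj e0; rewrite big_map big_enum prodEFin -EFinM lee_fin.
rewrite mulrAC -big_split /= [X in (X * _)%R](big_sumType) /=.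
have -> : (\prod_v vertex_kernel (@subdiv_rel V adj) p e a v =
  \prod_(s : edge_type adj) (gker e (dot (a (inr s)) (a (inl (xt s).1)))
     * gker e (dot (a (inr s)) (a (inl (xt s).2)))))%R.
  rewrite -(prod_subdiv adj_irr xtP p_inj (K := fun v u => gker e (dot (a v) (a u)))).
    by apply: eq_bigr => v _; rewrite big_enum_val.
  by move=> u v; rewrite dotC.
rewrite -mulrA ler_wpM2l ?prodr_ge0 // => [v _|]; first exact: vmass_ge0.
have gk0 t : (0 <= gker e t)%R by apply: gker_ge0.
rewrite -big_split /=; apply: ler_prod => s _; apply/andP; split.
  by apply: mulr_ge0; [exact: vmass_ge0|exact: mulr_ge0].
have mono (m c h k1 k2 : R) : (0 <= k1 -> 0 <= k2 -> m <= c * h ->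
    m * (k1 * k2) <= c * (h * k1 * k2))%R.
  by move=> k10 k20 mh; rewrite -mulrA [leRHS]mulrA ler_wpM2r ?mulr_ge0.
by apply: mono => //; exact: gdens_rho_le.
Qed.

(** [inv_wedge_le] gives each edge one kappa and one inverse norm for each end. Regrouped by
    vertices, v receives as many inverse norms as its degree, to which [vertex_weight_le]
    applies. *)
Lemma edge_bounds_le C e a : (0 <= C)%R -> (0 < e)%R ->
  (\prod_(v : V) vmass (a (inl v)))%:E * \prod_(w <- midpoints) edge_bound C e w a <=
  (C ^+ #|{: edge_type adj}|
     * (d%:R ^+ d.-1 * (4 * (#|W| + d.-1) + 1)%:R ^+ (#|W| + d.-1)) ^+ #|V|)%:E *
  vertex_fun inl adj e [set: V]%SET a.
Proof.
move=> C0 e0; rewrite big_map big_enum; set C1 : R := (d%:R ^+ _ * _)%R.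
have C10 : (0 <= C1)%R by rewrite mulr_ge0 ?exprn_ge0.
pose ka s := kappa e (a (inl (xt s).1)) (a (inl (xt s).2)).
have ka0 s : (0 <= ka s)%R := le_trans ler01 (kappa_ge1 _ _ _).
pose pw v := negpow 1 (norm1 (a (inl v))).
have pw0 v : 0 <= pw v by exact: negpow_ge0.
have vm0 : (0 <= \prod_(v : V) vmass (a (inl v)))%R by apply: prodr_ge0 => v _; exact: vmass_ge0.
apply: (@le_trans _ _ ((\prod_(v : V) vmass (a (inl v)))%:E *
    \prod_(s : edge_type adj) ((C * ka s)%:E * (pw (xt s).1 * pw (xt s).2)))).
  apply: lee_wpmul2l; first by rewrite lee_fin.
  apply: lee_prod => s _; rewrite /= lee_fin divr_ge0 ?addr_ge0 ?wedge_ge0 ?sqr_ge0 //=.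
  rewrite !EFinM -muleA; apply: lee_wpmul2l; first by rewrite lee_fin.
  exact: inv_wedge_le.
rewrite [X in _ * X]big_split /= [X in _ * (X * _)]prodEFin
  -(big_edge_ends adj_sym adj_irr xtP _ (fun u v => pw u)).
have -> : (\prod_s (C * ka s) = C ^+ #|{: edge_type adj}| * \prod_s ka s)%R.
  by rewrite big_split /= prodr_const.
rewrite muleCA -[X in _ * (X * _)]prodEFin -[X in _ * X]big_split /= /vertex_fun [leRHS](_ : _ =
  (C ^+ #|{: edge_type adj}| * wsum_exp inl adj e [set: V]%SET a)%:E *
  \prod_(v : V) (C1%:E * leaf_weight (a (inl v)))); last first.
  rewrite [X in _ = _ * X]big_split /= [X in _ = _ * (X * _)]prodEFin prodr_const !EFinM.
  rewrite -!muleA [X in _ = _ * X]muleCA [X in _ = _ * (_ * X)]muleC.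
  by congr (_ * (_ * (_ * _))); apply: eq_bigl => v; rewrite inE.
apply: lee_pmul.
- by rewrite lee_fin mulr_ge0 ?exprn_ge0 ?prodr_ge0.
- apply: prode_ge0 => v _; rewrite mule_ge0 ?lee_fin ?vmass_ge0 //; exact: prode_ge0.
- by rewrite lee_fin ler_wpM2l ?exprn_ge0 // prod_kappa_le.
apply: lee_prod => v _; rewrite mule_ge0 ?lee_fin ?vmass_ge0 ?prode_ge0 //=.
apply: vertex_weight_le; first by rewrite (leq_trans _ d3).
by rewrite -ltnS prednK ?deg_lt // (leq_trans _ d3).
Qed.

Lemma subdiv_process_bound p : injective p -> exists C : R,
  forall (s : seq (W * 'I_d)) (e : R), uniq s -> (forall z, z \in s) -> (0 < e <= 1)%R ->
  lint s (fun g => ((\prod_v gdens (cfg g v))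
      * (\prod_v vertex_kernel (@subdiv_rel V adj) p e (cfg g) v) * rhoprod (cfg g))%:E) (fun=> 0%R)
  <= C%:E.
Proof.
move=> p_inj; have [CE CE0 HE] := @edge_integral R d.
have [CV CV0 HV] := @vertex_integral R d d3 W V inl adj inl_inj adj_irr.
pose C := (edge_const * CE)%R.
have ec0 : (0 <= edge_const)%R by rewrite exprn_ge0.
have C0 : (0 <= C)%R by rewrite mulr_ge0.
pose K : R := (C ^+ #|{: edge_type adj}|
     * (d%:R ^+ d.-1 * (4 * (#|W| + d.-1) + 1)%:R ^+ (#|W| + d.-1)) ^+ #|V|)%R.
have K0 : (0 <= K)%R by rewrite mulr_ge0 ?exprn_ge0 // mulr_ge0 ?exprn_ge0.
exists (K * CV ^+ #|[set: V]%SET|)%R => s e us sT /andP[e0 _].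
pose A a := (\prod_(v : V) vmass (a (inl v)))%:E.
have A0 a : 0 <= A a by rewrite lee_fin prodr_ge0 // => v _; exact: vmass_ge0.
have mA : cfg_measurable A.
  move=> disp T h mh; apply/measurable_EFinP; apply: measurable_prodP => v _.
  by apply: measurable_vmass => j; exact: mh.
have k0 w a : 0 <= edge_kernel e w a.
  by case: w => [//|x]; rewrite lee_fin mulr_ge0 ?edge_fun_ge0.
have mk w : cfg_measurable (edge_kernel e w).
  case: w => [v|x] disp T h mh; first exact: measurable_cst.
  apply/measurable_EFinP; apply: measurable_funM => //.
  by apply: measurable_edge_fun => j; exact: mh.
have B0 w a : 0 <= edge_bound C e w a.
  by case: w => [//|x]; rewrite lee_fin divr_ge0 ?addr_ge0 ?wedge_ge0 ?sqr_ge0.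
have mB w : cfg_measurable (edge_bound C e w).
  case: w => [v|x] disp T h mh; first exact: measurable_cst.
  apply/measurable_EFinP; apply: measurable_funM => //; apply: measurable_inv_ge0 => [y|].
    by rewrite addr_ge0 ?wedge_ge0 ?sqr_ge0.
  by apply: measurable_funD => //; apply: measurable_wedge => j; exact: mh.
have mprod (F : W -> (W -> 'rV[R]_d) -> \bar R) : (forall w, cfg_measurable (F w)) ->
    cfg_measurable (fun a => A a * \prod_(w <- midpoints) F w a).
  move=> mF disp T h mh; apply: emeasurable_funM; first exact: mA.
  by apply: measurable_bigop => [f1 f2|w _]; [exact: emeasurable_funM|exact: mF].
have prod0 (F : W -> (W -> 'rV[R]_d) -> \bar R) a : (forall w a, 0 <= F w a) ->
    0 <= A a * \prod_(w <- midpoints) F w a.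
  by move=> F0; rewrite mule_ge0 // prode_ge0.
apply: (@le_trans _ _ (lint s (fun g => A (cfg g) *
    \prod_(w <- midpoints) edge_kernel e w (cfg g)) (fun=> 0%R))).
  apply: le_lint => [g|||g].
  - rewrite lee_fin; apply: mulr_ge0; last exact: rhoprod_ge0.
    apply: mulr_ge0; apply: prodr_ge0 => v _; first exact: expR_ge0.
    by apply: prodr_ge0 => i _; exact: gker_ge0.
  - apply: (coord_measurable_cfg (H := fun a => ((\prod_v gdens (a v)) *
      (\prod_v vertex_kernel (@subdiv_rel V adj) p e a v) * rhoprod a)%:E)) => disp T h mh.
    apply/measurable_EFinP; apply: measurable_funM; last first.
      by apply/measurable_EFinP; exact: measurable_rhoprod.
    apply: measurable_funM; apply: measurable_prodP => v _.
      by apply: measurable_gdens => j; exact: mh.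
    apply: measurable_prodP => i _; apply: measurable_gker.
    by apply: measurable_dot => j; exact: mh.
  - exact: coord_measurable_cfg (mprod _ mk).
  - exact: process_integrand_le.
pose s' := [seq z <- s | z.1 \notin midpoints].
apply: (@le_trans _ _ (lint s' (fun g => A (cfg g) *
    \prod_(w <- midpoints) edge_bound C e w (cfg g)) (fun=> 0%R))).
  apply: (@lint_eliminate R W d midpoints s A (edge_kernel e) (edge_bound C e)) => //.
  - by rewrite map_inj_uniq ?enum_uniq // => x y [].
  - by move=> w a x /mapP[x' _ ->]; rewrite /A /upd.
  - move=> u w a x /mapP[u' _ ->] /mapP[w' _ ->] uw.
    by rewrite /edge_kernel /upd /= (negbTE uw).
  - by move=> u w a x /mapP[u' _ ->] /mapP[w' _ ->]; rewrite /edge_bound /upd.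
  - move=> w a h /mapP[x _ ->] /=.
    under eq_lint do rewrite /upd /= eqxx EFinM.
    rewrite lintZl ?lee_fin //; last 2 first.
    - by move=> y; rewrite lee_fin edge_fun_ge0.
    - apply: (@row_measurable_rowv R d (fun y => (edge_fun e _ _ y)%:E)).
      move=> disp T h' mh; apply/measurable_EFinP.
      by apply: measurable_edge_fun => // j; exact: measurable_cst.
    rewrite /C -mulrA [leRHS]EFinM; apply: lee_wpmul2l; first by rewrite lee_fin.
    exact: HE.
apply: (@le_trans _ _ (lint s' (fun g => K%:E * vertex_fun inl adj e [set: V]%SET (cfg g))
    (fun=> 0%R))).
  apply: le_lint => [g|||g]; first exact: prod0.
  - exact: coord_measurable_cfg (mprod _ mB).
  - apply: coord_measurableM; first by move=> disp T h mh; exact: measurable_cst.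
    exact: coord_measurable_cfg (cfg_measurable_vertex_fun _ _ _ _).
  - exact: edge_bounds_le.
rewrite lintZl ?lee_fin //; last 2 first.
- by move=> g; exact: vertex_fun_ge0.
- exact: coord_measurable_cfg (cfg_measurable_vertex_fun _ _ _ _).
rewrite [leRHS]EFinM; apply: lee_wpmul2l; first by rewrite lee_fin.
apply: HV => //; first by rewrite filter_uniq.
move=> [w j]; rewrite mem_filter sT andbT /=.
case: w => [v|x].
  rewrite (_ : _ \notin _); last by apply/mapP => -[].
  by apply/esym/existsP; exists v; rewrite inE eqxx.
rewrite (map_f _ (mem_enum _ x)) /=.
by apply/esym/existsP => -[v]; rewrite andbF.
Qed.

End SubdivisionBound.

Local Close Scope ereal_scope.
Local Close Scope ring_scope.
Local Close Scope classical_set_scope.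

Theorem theorem16 (R : realType) (d : nat) (V : finType) (e : rel V) :
  (3 <= d)%N ->
  simple_graph e ->
  (forall v : V, (#|[set w | e v w]| <= d.-1)%N) ->
  forall p : subdiv_vertex e -> 'I_#|subdiv_vertex e|, injective p ->
  (tdens R (@subdiv_rel V e) d p < +oo)%E.
Proof.
move=> d3 [adj_sym adj_irr] deg p p_inj.
have [xt xtP] := edge_ends e.
have deg_lt v : (#|[pred w | e v w]| < d)%N.
  have -> : #|[pred w | e v w]| = #|[set w | e v w]| by apply: eq_card => w; rewrite !inE.
  by rewrite -(prednK (leq_trans (isT : 0 < 3) d3)) ltnS deg.
have [C HC] := @subdiv_process_bound R d V e d3 adj_sym adj_irr deg_lt xt xtP p p_inj.
exact: (tdens_lty p_inj HC).
Qed.
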